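(* Let $\Omega$ be a multi-coated inclusion with core $\Omega_0$, coating layers $\Omega_1,\dots,\Omega_L$ and conductivities $\boldsymbol{\sigma}=(\sigma_0,\dots,\sigma_L)$, with $\sigma_{L+1}=1$ in the exterior $\Omega_{L+1}$, as described in the context. Let $C=(c_{mn})_{m,n=1}^\infty$ be the Grunsky matrix of the core and $D_1,D_2,D_3,D_4$ the diagonal matrices $D_j=(d_n^{(j)}\delta_{mn})_{m,n=1}^\infty$ defined in the context. Assume that $D_4$ and $D_4-D_2\overline{C}D_4^{-1}D_2C$ are invertible. Then the Faber polynomial polarization tensors of $\Omega$ satisfy, for all $m,n\in\mathbb{N}$, $$\mathbb{F}^{(1)}_{mn}(\Omega,\boldsymbol{\sigma})=4\pi n\,c_{mn}-4\pi n\,\sigma_0^{-1}\sigma_{L+1}\left[D_4^{-1}C\left(D_4-D_2\,\overline{C}\,D_4^{-1}D_2\,C\right)^{-1}\right]_{mn},$$ $$\mathbb{F}^{(2)}_{mn}(\Omega,\boldsymbol{\sigma})=4\pi n\left[\left(D_3-D_1\,\overline{C}\,D_4^{-1}D_2\,C\right)\left(D_4-D_2\,\overline{C}\,D_4^{-1}D_2\,C\right)^{-1}\right]_{mn}.$$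
   Context: Core: $\Omega_0\subset\mathbb{R}^2\cong\mathbb{C}$ is a bounded simply connected domain. There are a unique $\gamma>0$ and a unique conformal map $\Psi$ from $\{|w|>\gamma\}$ onto $\mathbb{C}\setminus\overline{\Omega_0}$ with $\Psi(w)=w+a_0+\frac{a_1}{w}+\frac{a_2}{w^2}+\cdots$. It is assumed that $\Psi$ extends conformally to $\{|w|>\gamma-\delta\}$ for some $\delta>0$. Faber polynomials $F_m$ of the core: $\frac{w\Psi'(w)}{\Psi(w)-z}=\sum_{m\ge0}F_m(z)w^{-m}$ for $z\in\overline{\Omega_0}$, $|w|>\gamma$. Grunsky coefficients: $F_m(\Psi(w))=w^m+\sum_{n\ge1}c_{mn}w^{-n}$ for $|w|>\gamma$, $m\geq 1$. Layers: $L\ge0$ is an integer ($L=0$ meaning no coating), $\gamma=r_0<r_1<\cdots<r_L<\infty$, $\Omega_j=\{\Psi(w):r_{j-1}<|w|<r_j\}$ for $1\le j\le L$, and $\Omega_{L+1}=\{\Psi(w):|w|>r_L\}$ is the exterior of $\Omega$. The conductivity in $\Omega_j$ is a positive constant $\sigma_j$ for $0\le j\le L+1$, with $\sigma_{L+1}=1$. Transmission problem: for a real entire harmonic $H$, $u$ solves $\nabla\cdot\sigma\nabla u=0$ in $\mathbb{R}^2$, $u(x)-H(x)=O(|x|^{-1})$ as $|x|\to\infty$, with $\sigma=\sigma_j$ in $\Omega_j$; that is, $u$ is harmonic in each $\Omega_j$ and for $j=0,\dots,L$, on the interface $\partial\Omega_j=\{\Psi(w):|w|=r_j\}$ between $\Omega_j$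 and $\Omega_{j+1}$, $u|^+=u|^-$ and $\sigma_{j+1}\frac{\partial u}{\partial\nu}|^+=\sigma_j\frac{\partial u}{\partial\nu}|^-$ ($+$ exterior limit, $-$ interior limit). FPTs of $\Omega$: $\mathbb{F}^{(1)}_{mn}=\mathbb{F}^{(1)}_{mn}(\Omega,\boldsymbol\sigma)$ and $\mathbb{F}^{(2)}_{mn}=\mathbb{F}^{(2)}_{mn}(\Omega,\boldsymbol\sigma)$ are the complex coefficients such that, for $H=\alpha_0+\sum_{m\ge1}(\alpha_mF_m(z)+\overline{\alpha_m}\,\overline{F_m(z)})$ with arbitrary complex $\alpha_m$, the solution satisfies, for $z=\Psi(w)\in\mathbb{C}\setminus\overline\Omega$, $$u(z)=H(z)-\sum_{n=1}^\infty\sum_{m=1}^\infty\frac1{4\pi n}\left[\left(\alpha_m\mathbb{F}^{(1)}_{mn}+\overline{\alpha_m}\mathbb{F}^{(2)}_{mn}\right)w^{-n}+\left(\overline{\alpha_m}\,\overline{\mathbb{F}^{(1)}_{mn}}+\alpha_m\overline{\mathbb{F}^{(2)}_{mn}}\right)\overline{w^{-n}}\right].$$ Numbers $d_n^{(j)}$: for $n\ge1$ and $0\le j\le L$ set $$T_n^j=\frac12\begin{bmatrix}1+\frac{\sigma_{j+1}}{\sigma_j}&\left(1-\frac{\sigma_{j+1}}{\sigma_j}\right)r_j^{-2n}\\ \left(1-\frac{\sigma_{j+1}}{\sigma_j}\right)r_j^{2n}&1+\frac{\sigma_{j+1}}{\sigma_j}\end{bmatrix},\qquad \begin{bmatrix}d_n^{(1)}&d_n^{(2)}\\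 d_n^{(3)}&d_n^{(4)}\end{bmatrix}=T_n^0T_n^1\cdots T_n^L.$$ All matrices are semi-infinite, indexed by $m,n\in\mathbb{N}=\{1,2,\dots\}$; $\overline{C}$ is the entrywise conjugate of $C$. *)

(* Defs.v *)
From Stdlib Require Export Reals.
From Coquelicot Require Export Coquelicot.

Open Scope R_scope.
Open Scope C_scope.

(** * Planar topology *)

Definition closure (D : C -> Prop) (z : C) : Prop :=
  ~ locally z (fun y => ~ D y).

Definition boundary (D : C -> Prop) (z : C) : Prop :=
  closure D z /\ closure (fun y => ~ D y) z.

Definition bounded (D : C -> Prop) : Prop :=
  exists M : R, forall z, D z -> (Cmod z <= M)%R.

Definition connected (D : C -> Prop) : Prop :=
  forall U V : C -> Prop, open U -> open V ->
    (forall z, D z -> U z \/ V z) ->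
    (exists z, D z /\ U z) -> (exists z, D z /\ V z) ->
    exists z, D z /\ U z /\ V z.

Definition unit_interval (t : R) : Prop := (0 <= t <= 1)%R.

Definition unit_square (p : R * R) : Prop :=
  unit_interval (fst p) /\ unit_interval (snd p).

Definition loop_in (D : C -> Prop) (p : R -> C) : Prop :=
  continuous_on unit_interval p /\
  (forall t, unit_interval t -> D (p t)) /\ p 0%R = p 1%R.

(** Free homotopy, through loops, to a constant loop; this is the same as a
    homotopy with fixed base point to a constant loop. *)
Definition null_homotopic_in (D : C -> Prop) (p : R -> C) : Prop :=
  exists h : R * R -> C,
    continuous_on unit_square h /\
    (forall q, unit_square q -> D (h q)) /\
    (forall t, unit_interval t -> h (0%R, t) = p t) /\
    (forall s, unit_interval s -> h (s, 0%R) = h (s, 1%R)) /\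
    (forall t, unit_interval t -> h (1%R, t) = h (1%R, 0%R)).

Definition simply_connected (D : C -> Prop) : Prop :=
  connected D /\ forall p, loop_in D p -> null_homotopic_in D p.

Definition is_domain (D : C -> Prop) : Prop :=
  open D /\ connected D /\ exists z, D z.

(** * The core and its exterior conformal map *)

Definition conformal_on (D : C -> Prop) (f : C -> C) : Prop :=
  (forall w, D w -> ex_derive (K := C_AbsRing) (V := C_NormedModule) f w) /\
  (forall w1 w2, D w1 -> D w2 -> f w1 = f w2 -> w1 = w2).

(** [a n] is the coefficient of [w^(-n)], so [a 0] is the constant term.  The
    symbol [Psi] also denotes the extension across [|w| = gamma]; the last
    clause says that the interface of the core is the image of that circle
    (it rules out, for instance, slit domains). *)
Definition exterior_conformal_map
    (Omega0 : C -> Prop) (gamma : R) (Psi : C -> C) (a : nat -> C) : Prop :=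
  (0 < gamma)%R /\
  (forall z, ~ closure Omega0 z <->
     exists w, (gamma < Cmod w)%R /\ z = Psi w) /\
  (forall w, (gamma < Cmod w)%R ->
     is_series (fun n => a n * (/ w) ^ n) (Psi w - w)) /\
  (exists delta : R, (0 < delta)%R /\
     conformal_on (fun w => (gamma - delta < Cmod w)%R) Psi) /\
  (forall z, boundary Omega0 z <->
     exists w, Cmod w = gamma /\ z = Psi w).

Definition is_polynomial (f : C -> C) : Prop :=
  exists (d : nat) (p : nat -> C), forall z,
    f z = sum_n (fun k => p k * z ^ k) d.

Definition faber_polynomials
    (Omega0 : C -> Prop) (gamma : R) (Psi : C -> C) (F : nat -> C -> C) : Prop :=
  (forall m, is_polynomial (F m)) /\
  forall z w, closure Omega0 z -> (gamma < Cmod w)%R ->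
    is_series (fun m => F m z * (/ w) ^ m)
      (w * C_derive Psi w / (Psi w - z)).

(** * Semi-infinite matrices

    Rows and columns are numbered from 1: entries with an index 0 are
    meaningless and never used. *)

Definition mat := nat -> nat -> C.

Definition grunsky_matrix
    (gamma : R) (Psi : C -> C) (F : nat -> C -> C) (c : mat) : Prop :=
  forall m w, (1 <= m)%nat -> (gamma < Cmod w)%R ->
    is_series (fun n => c m (S n) * (/ w) ^ (S n)) (F m (Psi w) - w ^ m).

Definition CSeries (a : nat -> C) : C :=
  (Series (fun n => fst (a n)), Series (fun n => snd (a n))).

Definition mat_apply (A : mat) (x : nat -> C) : nat -> C :=
  fun m => CSeries (fun k => A m (S k) * x (S k)).

Definition mat_mul (A B : mat) : mat :=
  fun m n => mat_apply A (fun k => B k n) m.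

Infix "**" := mat_mul (at level 40, left associativity).

Definition mat_sub (A B : mat) : mat := fun m n => A m n - B m n.

Infix "--" := mat_sub (at level 50, left associativity).

Definition mat_conj (A : mat) : mat := fun m n => Cconj (A m n).

Definition diag (d : nat -> R) : mat :=
  fun m n => if Nat.eqb m n then RtoC (d n) else 0.

Definition identity : mat := diag (fun _ => 1%R).

(** Products of semi-infinite matrices are neither always defined nor always
    associative, and an entrywise two-sided inverse need not be unique, so
    invertibility needs an underlying space.  Here it is the space of
    sequences [x] with [sum_n gamma^(2n) |x_n|^2] finite, i.e. of the
    coefficients of [L^2] series [sum_n x_n w^n] on the circle [|w| = gamma]. *)
Definition l2_term (gamma : R) (x : nat -> C) (n : nat) : R :=
  ((gamma ^ S n * Cmod (x (S n))) ^ 2)%R.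

Definition in_l2 (gamma : R) (x : nat -> C) : Prop :=
  ex_series (l2_term gamma x).

Definition l2_norm (gamma : R) (x : nat -> C) : R :=
  sqrt (Series (l2_term gamma x)).

Definition bounded_operator (gamma : R) (A : mat) : Prop :=
  exists K : R, forall x, in_l2 gamma x ->
    (forall m, (1 <= m)%nat -> ex_series (fun k => A m (S k) * x (S k))) /\
    in_l2 gamma (mat_apply A x) /\
    (l2_norm gamma (mat_apply A x) <= K * l2_norm gamma x)%R.

Definition is_inverse (gamma : R) (A B : mat) : Prop :=
  bounded_operator gamma A /\ bounded_operator gamma B /\
  forall m n, (1 <= m)%nat -> (1 <= n)%nat ->
    (A ** B) m n = identity m n /\ (B ** A) m n = identity m n.

(** * Layers and the transmission problem *)

(** Only [r 0, ..., r L] and [sigma 0, ..., sigma (L + 1)] are meaningful. *)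
Definition coating
    (gamma : R) (L : nat) (r : nat -> R) (sigma : nat -> R) : Prop :=
  r 0%nat = gamma /\
  (forall j, (j < L)%nat -> (r j < r (S j))%R) /\
  (forall j, (j <= S L)%nat -> (0 < sigma j)%R) /\
  sigma (S L) = 1%R.

(** Index 0 is the core, index [S i] with [i < L] is a coating layer and
    [S L] is the unbounded exterior. *)
Definition region (Omega0 : C -> Prop) (Psi : C -> C) (L : nat) (r : nat -> R)
    (j : nat) (z : C) : Prop :=
  match j with
  | O => Omega0 z
  | S i => exists w, (r i < Cmod w)%R /\
             ((i < L)%nat -> (Cmod w < r (S i))%R) /\ z = Psi w
  end.

Definition partial (m k : nat) (u : C -> R) (z : C) : R :=
  partial_derive m k (fun x y => u (x, y)) (fst z) (snd z).

Definition harmonic_at (u : C -> R) (z : C) : Prop :=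
  ex_diff_n (fun x y => u (x, y)) 2 (fst z) (snd z) /\
  (partial 2 0 u z + partial 0 2 u z)%R = 0%R.

(** Outward unit normal at [Psi w] to the curve [t |-> Psi (|w| e^(it))],
    whose tangent vector is [i w Psi'(w)]. *)
Definition normal (Psi : C -> C) (w : C) : C :=
  w * C_derive Psi w / RtoC (Cmod (w * C_derive Psi w)).

Definition directional_derivative (u : C -> R) (v z : C) : R :=
  (partial 1 0 u z * fst v + partial 0 1 u z * snd v)%R.

(** [f] has limit [l] at [z0] from inside [D]. *)
Definition limit_within (D : C -> Prop) (f : C -> R) (z0 : C) (l : R) : Prop :=
  filterlim f (within D (locally z0)) (locally l).

Definition transmission_solution
    (Omega0 : C -> Prop) (Psi : C -> C) (L : nat) (r sigma : nat -> R)
    (H u : C -> R) : Prop :=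
  let Omega := region Omega0 Psi L r in
  (forall j z, (j <= S L)%nat -> Omega j z -> harmonic_at u z) /\
  (forall j w, (j <= L)%nat -> Cmod w = r j ->
     exists l : R,
       limit_within (Omega (S j)) u (Psi w) l /\
       limit_within (Omega j) u (Psi w) l) /\
  (forall j w, (j <= L)%nat -> Cmod w = r j ->
     let dnu := directional_derivative u (normal Psi w) in
     exists gp gm : R,
       limit_within (Omega (S j)) dnu (Psi w) gp /\
       limit_within (Omega j) dnu (Psi w) gm /\
       (sigma (S j) * gp = sigma j * gm)%R) /\
  (exists M R0 : R, forall z, (R0 < Cmod z)%R ->
     (Rabs (u z - H z) <= M / Cmod z)%R).

(** * Faber polynomial polarization tensors *)

Definition faber_expansion
    (F : nat -> C -> C) (alpha0 : R) (alpha : nat -> C) (H : C -> R) : Prop :=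
  forall z,
    is_series (fun m => alpha (S m) * F (S m) z
                        + Cconj (alpha (S m)) * Cconj (F (S m) z))
      (RtoC (H z) - RtoC alpha0).

Definition is_iterated_series (t : nat -> nat -> C) (l : C) : Prop :=
  exists s : nat -> C,
    (forall n, is_series (fun m => t m n) (s n)) /\ is_series s l.

Definition fpt_term (F1 F2 : mat) (alpha : nat -> C) (w : C) (m n : nat) : C :=
  / RtoC (4 * PI * INR n) *
  ((alpha m * F1 m n + Cconj (alpha m) * F2 m n) * (/ w) ^ n
   + (Cconj (alpha m) * Cconj (F1 m n) + alpha m * Cconj (F2 m n))
     * Cconj ((/ w) ^ n)).

Definition faber_polarization_tensors
    (Omega0 : C -> Prop) (Psi : C -> C) (F : nat -> C -> C)
    (L : nat) (r sigma : nat -> R) (F1 F2 : mat) : Prop :=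
  forall (alpha0 : R) (alpha : nat -> C) (H u : C -> R),
    (forall z, harmonic_at H z) ->
    faber_expansion F alpha0 alpha H ->
    transmission_solution Omega0 Psi L r sigma H u ->
    forall w, (r L < Cmod w)%R ->
      is_iterated_series (fun m n => fpt_term F1 F2 alpha w (S m) (S n))
        (RtoC (H (Psi w)) - RtoC (u (Psi w))).

(** * The numbers d_n *)

Definition transfer (r sigma : nat -> R) (n j : nat) : matrix (T := R) 2 2 :=
  let s := (sigma (S j) / sigma j)%R in
  [[ ((1 + s) / 2)%R, ((1 - s) * / r j ^ (2 * n) / 2)%R ],
   [ ((1 - s) * r j ^ (2 * n) / 2)%R, ((1 + s) / 2)%R ]].

Fixpoint transfer_product (r sigma : nat -> R) (n j : nat)
    : matrix (T := R) 2 2 :=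
  match j with
  | O => transfer r sigma n 0
  | S i => Mmult (transfer_product r sigma n i) (transfer r sigma n j)
  end.

Definition d_entry (r sigma : nat -> R) (L i k n : nat) : R :=
  coeff_mat 0%R (transfer_product r sigma n L) i k.

Definition D1 r sigma L : mat := diag (d_entry r sigma L 0 0).
Definition D2 r sigma L : mat := diag (d_entry r sigma L 0 1).
Definition D3 r sigma L : mat := diag (d_entry r sigma L 1 0).
Definition D4 r sigma L : mat := diag (d_entry r sigma L 1 1).

(* Main.v *)
Require Import Defs.
From Stdlib Require Import Lra Lia ClassicalEpsilon FunctionalExtensionality.

(** The background field [alpha F_m + conj] has an explicit response, because
    the exterior map turns every interface into a circle.  In the layer [j] the
    solution is [u (Psi w) = 2 Re (sum_n p_n w^n + q_n w^(-n))], with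
    coefficients depending on [j], and in the core it is
    [u = 2 Re (sum_n p_n F_n)].  On [|w| = r_j] one has
    [Re (q w^(-n)) = Re (conj q r_j^(-2n) w^n)], so that continuity of [u] and
    of its flux mean exactly that the pair [(p_n, conj q_n)] of layer [j] is
    [T_n^j] times the pair of layer [j + 1].  In the exterior [p] is [alpha] at
    [n = m] and [0] elsewhere, while [q] is unknown; in the core one gets
    [p = alpha D1 + conj q D2], with [alpha D3 + conj q D4] in place of [conj q].
    Since [F_n (Psi w) = w^n + sum_k c_nk w^(-k)], the core series continues
    this field if and only if [p C] is the core value of [q].  Writing the
    unknown as [q = alpha X + conj alpha Y], this becomes the pair of equations
    [X D4 = D1 C + conj Y D2 C] and [Y D4 = conj X D2 C - D3].

    They are solved by [X = kappa D4^(-1) C A] and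
    [Y = - (D3 - D1 conj C D4^(-1) D2 C) A], where [A] is the inverse of
    [D4 - D2 conj C D4^(-1) D2 C] and
    [kappa = d1 d4 - d2 d3 = sigma_(L+1) / sigma_0] is the determinant of the
    product of the transfer matrices ([transfer_det]).  The verification is the
    push-through identity [conj A D2 C = D4^(-1) D2 C A D4], that is,
    [push_through]; it leads to [field_X_identity] and [field_Y_identity].

    The tensors are read off from the expansion of this solution for
    [alpha = 1] and [alpha = i].  In the exterior [H - u] is twice the real part
    of [sum_n (alpha c_mn - q_n) w^(-n)], and a series in negative powers of [w]
    is determined by its real part ([Laurent_real_unique]); hence
    [F1 = 4 pi n (c - X)] and [F2 = - 4 pi n Y] ([fpt_coefficients],
    [fpt_formulas]).

    The analysis makes the series above legitimate.  Since [Psi] extends across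
    [|w| = gamma], its Faber generating function extends inwards on the image of
    a circle [|w| = rho] with [rho < gamma], and Cauchy's estimates give
    [|c_mn| <= K th^(m+n)] for some [th < gamma] ([faber_circle_bound],
    [grunsky_bound]).  A bounded operator on the weighted [l2] space has entries
    at most [K gamma^(n-m)] ([bounded_operator_entries]), so after conjugation
    by the weights [gamma^n] every product that occurs has a
    factor with geometric decay in the common index.  This yields
    associativity ([mul_assoc]) and [X_mn, Y_mn = O(th^n)] for fixed [m]
    ([field_decay]).  Consequently the field of each layer is given by its
    series on a full neighbourhood of both of its interfaces
    ([layer_coef_bound]), and so is that of the core ([core_field_holo]); the
    one-sided limits of [u] and of its normal derivative are then values of
    differentiable functions ([layer_limits], [core_limits]), provided that
    [Psi'] does not vanish on [|w| >= gamma] ([Psi_derive_neq_0]) and that the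
    inverse of [Psi] is continuous up to the boundary ([Psi_inverse_cont]).

    All of this rests on elementary complex analysis, developed from Goursat's
    theorem for images of squares ([goursat_square]): invariance of contour
    integrals under homotopy, Cauchy's formula, differentiability of
    derivatives ([holo_derive]), estimates for Laurent coefficients
    ([laurent_coef_bound]) and termwise differentiation ([csum_deriv]). *)

Open Scope R_scope.

(** * Complex limits in terms of the modulus *)

Lemma locally_Cmod (z : C) (P : C -> Prop) :
  locally z P <-> exists d, 0 < d /\ forall w, Cmod (w - z)%C < d -> P w.
Proof.
  split.
  - intros H.
    destruct (locally_norm_le_locally (V := C_NormedModule) z P H) as [d Hd].
    exists d; split; [apply cond_pos|]. intros w Hw. apply Hd. exact Hw.
  - intros [d [d0 Hd]].
    apply (locally_le_locally_norm (V := C_NormedModule) z P).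
    exists (mkposreal d d0). intros w Hw. apply Hd. exact Hw.
Qed.

Lemma closure_Cmod (D : C -> Prop) (z : C) :
  closure D z <-> forall e, 0 < e -> exists w, D w /\ Cmod (w - z)%C < e.
Proof.
  split.
  - intros H e He. apply NNPP. intros N. apply H. apply locally_Cmod.
    exists e; split; [exact He|]. intros w Hw Dw. apply N. exists w; auto.
  - intros H N. apply locally_Cmod in N. destruct N as [d [d0 Hd]].
    destruct (H d d0) as [w [Dw Hw]]. exact (Hd w Hw Dw).
Qed.

Lemma Cminus_diag (x : C) : (x - x)%C = 0%C.
Proof. ring. Qed.

Lemma Cmod_sub_comm (x y : C) : Cmod (x - y)%C = Cmod (y - x)%C.
Proof. rewrite <- Cmod_opp. f_equal. ring. Qed.

Lemma Cmod_sub_triangle (x y z : C) :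
  Cmod (x - z)%C <= Cmod (x - y)%C + Cmod (y - z)%C.
Proof. replace (x - z)%C with ((x - y) + (y - z))%C by ring. apply Cmod_triangle. Qed.

Lemma Cmod_sub_ge (x y : C) : Cmod x - Cmod y <= Cmod (x - y)%C.
Proof.
  generalize (Cmod_triangle (x - y) y). replace (x - y + y)%C with x by ring. lra.
Qed.

Lemma Cmod_sub_le (x y : C) : Cmod (x - y)%C <= Cmod x + Cmod y.
Proof. unfold Cminus. rewrite <- (Cmod_opp y). apply Cmod_triangle. Qed.

Lemma Cmod_RtoC_pos (x : R) : 0 <= x -> Cmod (RtoC x) = x.
Proof. intros H. rewrite Cmod_R. apply Rabs_pos_eq, H. Qed.

Lemma Cmod_pos_neq (z : C) : 0 < Cmod z -> z <> 0%C.
Proof. intros H E. rewrite E, Cmod_0 in H. lra. Qed.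

Lemma Cmod_small_0 (z : C) : (forall e, 0 < e -> Cmod z <= e) -> z = 0%C.
Proof.
  intros H. apply Cmod_eq_0. apply Rle_antisym; [|apply Cmod_ge_0].
  apply Rnot_lt_le. intros L. specialize (H (Cmod z / 2)). lra.
Qed.

Lemma Re_le_Cmod (z : C) : Rabs (fst z) <= Cmod z.
Proof. eapply Rle_trans; [|apply Rmax_Cmod]. apply Rmax_l. Qed.

Lemma Im_le_Cmod (z : C) : Rabs (snd z) <= Cmod z.
Proof. eapply Rle_trans; [|apply Rmax_Cmod]. apply Rmax_r. Qed.

Lemma fst_RtoC_mult (x : R) (z : C) : fst (RtoC x * z)%C = x * fst z.
Proof. unfold Cmult, RtoC; cbn [fst snd]. ring. Qed.

(** * Series of complex numbers *)

Definition csum (a : nat -> C) (l : C) : Prop :=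
  is_series (K := C_AbsRing) (V := C_NormedModule) a l.

Definition Csum_n (a : nat -> C) (n : nat) : C := sum_n a n.

Lemma Csum_n_S (a : nat -> C) n : Csum_n a (S n) = (Csum_n a n + a (S n))%C.
Proof. apply (sum_Sn (G := C_AbelianMonoid)). Qed.

Lemma Csum_n_0 (a : nat -> C) : Csum_n a 0 = a 0%nat.
Proof. apply (sum_O (G := C_AbelianMonoid)). Qed.

Lemma csum_eps (a : nat -> C) (l : C) :
  csum a l <-> forall e, 0 < e -> exists N, forall n, (N <= n)%nat ->
    Cmod (Csum_n a n - l)%C < e.
Proof.
  unfold csum, is_series. split.
  - intros H e He.
    assert (L : locally (T := C_UniformSpace) l (fun w => Cmod (w - l)%C < e)).
    { apply locally_Cmod. exists e; split; auto. }
    destruct (H _ L) as [N HN]. exists N. exact HN.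
  - intros H P HP. apply locally_Cmod in HP. destruct HP as [d [d0 Hd]].
    destruct (H d d0) as [N HN]. exists N. intros n Hn. apply Hd, HN, Hn.
Qed.

Lemma csum_unique (a : nat -> C) (l1 l2 : C) : csum a l1 -> csum a l2 -> l1 = l2.
Proof.
  intros H1 H2. apply (filterlim_locally_unique (V := C_NormedModule) _ _ _ H1 H2).
Qed.

Lemma csum_ext (a b : nat -> C) (l : C) :
  (forall n, a n = b n) -> csum a l -> csum b l.
Proof. apply (is_series_ext (V := C_NormedModule)). Qed.

Lemma csum_plus (a b : nat -> C) (la lb : C) :
  csum a la -> csum b lb -> csum (fun n => a n + b n)%C (la + lb)%C.
Proof. apply (is_series_plus (V := C_NormedModule)). Qed.

Lemma csum_scal (k : C) (a : nat -> C) (l : C) :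
  csum a l -> csum (fun n => k * a n)%C (k * l)%C.
Proof. apply (is_series_scal (V := C_NormedModule)). Qed.

Lemma csum_scal_r (k : C) (a : nat -> C) (l : C) :
  csum a l -> csum (fun n => a n * k)%C (l * k)%C.
Proof.
  intros H. rewrite Cmult_comm. apply csum_ext with (2 := csum_scal k a l H).
  intros n; ring.
Qed.

Lemma csum_minus (a b : nat -> C) (la lb : C) :
  csum a la -> csum b lb -> csum (fun n => a n - b n)%C (la - lb)%C.
Proof. apply (is_series_minus (V := C_NormedModule)). Qed.

Lemma csum_shift (a : nat -> C) (l : C) :
  csum a l <-> csum (fun n => a (S n)) (l - a 0%nat)%C.
Proof.
  split; intros H.
  - apply (is_series_incr_1 (V := C_NormedModule)).
    change (csum a (l - a 0%nat + a 0%nat)%C).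
    replace (l - a 0%nat + a 0%nat)%C with l by ring. exact H.
  - apply (is_series_decr_1 (V := C_NormedModule)). exact H.
Qed.

Lemma Csum_n_fst (a : nat -> C) n : fst (Csum_n a n) = sum_n (fun k => fst (a k)) n.
Proof.
  induction n; [rewrite Csum_n_0, sum_O; auto|].
  rewrite Csum_n_S, sum_Sn, <- IHn. reflexivity.
Qed.

Lemma Csum_n_snd (a : nat -> C) n : snd (Csum_n a n) = sum_n (fun k => snd (a k)) n.
Proof.
  induction n; [rewrite Csum_n_0, sum_O; auto|].
  rewrite Csum_n_S, sum_Sn, <- IHn. reflexivity.
Qed.

Lemma csum_fst (a : nat -> C) (l : C) :
  csum a l -> is_series (fun k => fst (a k)) (fst l).
Proof.
  intros H. apply (filterlim_locally (U := R_UniformSpace)). intros e.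
  destruct (proj1 (csum_eps a l) H e (cond_pos e)) as [N HN]. exists N. intros n Hn.
  rewrite <- Csum_n_fst. specialize (HN n Hn).
  apply Rle_lt_trans with (2 := HN). apply (Re_le_Cmod (_ - _)).
Qed.

Lemma csum_snd (a : nat -> C) (l : C) :
  csum a l -> is_series (fun k => snd (a k)) (snd l).
Proof.
  intros H. apply (filterlim_locally (U := R_UniformSpace)). intros e.
  destruct (proj1 (csum_eps a l) H e (cond_pos e)) as [N HN]. exists N. intros n Hn.
  rewrite <- Csum_n_snd. specialize (HN n Hn).
  apply Rle_lt_trans with (2 := HN). apply (Im_le_Cmod (_ - _)).
Qed.

Lemma csum_CSeries (a : nat -> C) (l : C) : csum a l -> CSeries a = l.
Proof.
  intros H. unfold CSeries.
  rewrite (is_series_unique _ _ (csum_fst a l H)), (is_series_unique _ _ (csum_snd a l H)).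
  symmetry; apply surjective_pairing.
Qed.

Lemma CSeries_ext (a b : nat -> C) : (forall n, a n = b n) -> CSeries a = CSeries b.
Proof.
  intros H. unfold CSeries. f_equal; apply Series_ext; intros n; rewrite H; auto.
Qed.

Lemma Csum_n_zero n : Csum_n (fun _ => 0%C) n = 0%C.
Proof. induction n; [apply Csum_n_0|rewrite Csum_n_S, IHn; ring]. Qed.

Lemma csum_zero : csum (fun _ => 0%C) 0%C.
Proof.
  apply csum_eps. intros e He. exists 0%nat. intros n _.
  rewrite Csum_n_zero. rewrite Cminus_diag. rewrite Cmod_0; auto.
Qed.

Lemma Csum_n_single (a : nat -> C) m n : (forall k, k <> m -> a k = 0%C) ->
  Csum_n a n = if Compare_dec.le_dec m n then a m else 0%C.
Proof.
  intros H. induction n.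
  - rewrite Csum_n_0. destruct (Compare_dec.le_dec m 0).
    + replace m with 0%nat by lia; auto.
    + apply H; lia.
  - rewrite Csum_n_S, IHn. destruct (Compare_dec.le_dec m n), (Compare_dec.le_dec m (S n)); try lia.
    + rewrite (H (S n)) by lia. ring.
    + replace m with (S n) by lia. ring.
    + rewrite (H (S n)) by lia. ring.
Qed.

Lemma csum_single (a : nat -> C) m : (forall k, k <> m -> a k = 0%C) -> csum a (a m).
Proof.
  intros H. apply csum_eps. intros e He. exists m. intros n Hn.
  rewrite (Csum_n_single a m n H). destruct (Compare_dec.le_dec m n); [|lia].
  rewrite Cminus_diag. rewrite Cmod_0; auto.
Qed.

Lemma Csum_n_bound (a : nat -> C) (b : nat -> R) n :
  (forall k, Cmod (a k) <= b k) -> Cmod (Csum_n a n) <= sum_n b n.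
Proof.
  intros H. induction n; [rewrite Csum_n_0, sum_O; auto|].
  rewrite Csum_n_S, sum_Sn. eapply Rle_trans; [apply Cmod_triangle|].
  apply Rplus_le_compat; auto.
Qed.

Lemma csum_abs (a : nat -> C) (b : nat -> R) (B : R) :
  (forall n, Cmod (a n) <= b n) -> is_series b B ->
  csum a (CSeries a) /\ Cmod (CSeries a) <= B.
Proof.
  intros Hb HB.
  destruct (ex_series_le (V := C_R_CompleteNormedModule) a b) as [l Hl].
  { intros n. eapply Rle_trans; [|apply Hb].
    apply Req_le. symmetry. apply Cmod_norm. }
  { exists B; exact HB. }
  assert (Hc : csum a l) by exact Hl.
  rewrite (csum_CSeries a l Hc). split; [exact Hc|].
  apply Rnot_lt_le. intros L.
  destruct (proj1 (csum_eps a l) Hc (Cmod l - B)) as [N HN]; [lra|].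
  specialize (HN N (le_n N)).
  assert (P : forall n, 0 <= b n) by (intros n; eapply Rle_trans; [apply Cmod_ge_0|apply Hb]).
  assert (S1 : sum_n b N <= B).
  { apply (is_lim_seq_incr_compare (sum_n b)).
    - exact HB.
    - intros n. rewrite sum_Sn. unfold plus; simpl. specialize (P (S n)). lra. }
  generalize (Csum_n_bound a b N Hb). intros S2.
  generalize (Cmod_sub_ge l (Csum_n a N)). rewrite Cmod_sub_comm. lra.
Qed.

(** ** Geometrically dominated sequences *)

Definition geo (t : R) (a : nat -> C) : Prop :=
  exists K, forall n, Cmod (a n) <= K * t ^ n.

Lemma is_series_geo K t : 0 <= t < 1 -> is_series (fun n => K * t ^ n) (K / (1 - t)).
Proof.
  intros Ht. apply (is_series_scal_l (V := R_NormedModule) K (fun n => t ^ n) (/ (1 - t))). apply is_series_geom.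
  rewrite Rabs_pos_eq; lra.
Qed.

Lemma csum_geo_bound (K t : R) (a : nat -> C) : 0 <= t < 1 ->
  (forall n, Cmod (a n) <= K * t ^ n) ->
  csum a (CSeries a) /\ Cmod (CSeries a) <= K / (1 - t).
Proof. intros Ht Ha. apply csum_abs with (1 := Ha). apply is_series_geo, Ht. Qed.

Lemma csum_geo (t : R) (a : nat -> C) : 0 <= t < 1 -> geo t a -> csum a (CSeries a).
Proof. intros Ht [K HK]. apply (csum_geo_bound K t a Ht HK). Qed.

Lemma geo_K_pos (K t : R) (a : nat -> C) :
  (forall n, Cmod (a n) <= K * t ^ n) -> 0 <= K.
Proof. intros H. specialize (H 0%nat). simpl in H. generalize (Cmod_ge_0 (a 0%nat)). lra. Qed.

(** This uniform estimate, applied with [K] depending on a parameter, is what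
    makes interchanges of a sum with an integral or another sum possible. *)
Lemma geo_tail (K t : R) (a : nat -> C) : 0 <= t < 1 ->
  (forall n, Cmod (a n) <= K * t ^ n) ->
  forall n, Cmod (CSeries a - Csum_n a n)%C <= K * t ^ S n / (1 - t).
Proof.
  intros Ht Ha n. revert a K Ha. induction n; intros a K Ha.
  - destruct (csum_geo_bound K t a Ht Ha) as [S1 _].
    apply (proj1 (csum_shift _ _)) in S1.
    destruct (csum_geo_bound (K * t) t (fun n => a (S n)) Ht) as [S2 B2].
    { intros n. eapply Rle_trans; [apply Ha|]. simpl; lra. }
    rewrite (csum_CSeries _ _ S1) in B2. rewrite Csum_n_0. simpl. rewrite Rmult_1_r. exact B2.
  - destruct (csum_geo_bound K t a Ht Ha) as [S1 _].
    apply (proj1 (csum_shift _ _)) in S1.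
    specialize (IHn (fun n => a (S n)) (K * t)).
    rewrite (csum_CSeries _ _ S1) in IHn.
    assert (E : forall n, Csum_n a (S n) = (a 0%nat + Csum_n (fun n => a (S n)) n)%C).
    { clear. induction n; [rewrite Csum_n_S, !Csum_n_0; auto|].
      rewrite Csum_n_S, IHn, Csum_n_S. ring. }
    rewrite E.
    replace (CSeries a - (a 0%nat + Csum_n (fun n => a (S n)) n))%C
      with (CSeries a - a 0%nat - Csum_n (fun n => a (S n)) n)%C by ring.
    replace (K * t ^ S (S n)) with (K * t * t ^ S n) by (simpl; ring).
    apply IHn. intros k. eapply Rle_trans; [apply Ha|]. simpl; lra.
Qed.

Lemma pow_small (K t e : R) : 0 <= t < 1 -> 0 < e ->
  exists N, forall n, (N <= n)%nat -> K * t ^ n < e.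
Proof.
  intros Ht He.
  destruct (pow_lt_1_zero t) with (y := e / (Rabs K + 1)) as [N HN].
  { rewrite Rabs_pos_eq; lra. }
  { apply Rdiv_lt_0_compat; auto. generalize (Rabs_pos K); lra. }
  exists N. intros n Hn. specialize (HN n Hn).
  generalize (Rabs_pos K); intros HK.
  assert (T : 0 <= t ^ n) by (apply pow_le; lra).
  rewrite Rabs_pos_eq in HN by auto.
  apply Rle_lt_trans with (Rabs K * t ^ n).
  { apply Rmult_le_compat_r; auto. apply Rle_abs. }
  apply Rle_lt_trans with ((Rabs K + 1) * t ^ n); [nra|].
  apply Rmult_lt_reg_l with (/ (Rabs K + 1)); [apply Rinv_0_lt_compat; lra|].
  rewrite <- Rmult_assoc, Rinv_l by lra. unfold Rdiv in HN. lra.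
Qed.

Lemma Csum_n_csum (a : nat -> nat -> C) (s : nat -> C) N :
  (forall n, csum (fun k => a n k) (s n)) ->
  csum (fun k => Csum_n (fun n => a n k) N) (Csum_n s N).
Proof.
  intros H. induction N.
  - rewrite Csum_n_0. apply csum_ext with (2 := H 0%nat). intros k; rewrite Csum_n_0; auto.
  - rewrite Csum_n_S. apply csum_ext with (2 := csum_plus _ _ _ _ IHN (H (S N))).
    intros k; rewrite Csum_n_S; auto.
Qed.

(** The first [n] rows may be added column by column; what this misses of the
    sum of each column [k] is at most [K t^(n+1+k) / (1 - t)] by [geo_tail],
    which is still summable over [k] and tends to [0] with [n]. *)
Lemma csum_exchange (K t : R) (a : nat -> nat -> C) : 0 <= t < 1 ->
  (forall n k, Cmod (a n k) <= K * t ^ n * t ^ k) ->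
  csum (fun n => CSeries (fun k => a n k)) (CSeries (fun k => CSeries (fun n => a n k))).
Proof.
  intros Ht Ha.
  assert (P : forall n, 0 <= t ^ n) by (intros; apply pow_le; lra).
  assert (HK : 0 <= K).
  { specialize (Ha 0%nat 0%nat). simpl in Ha. generalize (Cmod_ge_0 (a 0%nat 0%nat)). lra. }
  assert (R1 : forall n, csum (fun k => a n k) (CSeries (fun k => a n k))).
  { intros n. apply (csum_geo t); auto. exists (K * t ^ n). auto. }
  assert (C1 : forall k n, Cmod (a n k) <= K * t ^ k * t ^ n).
  { intros k n. eapply Rle_trans; [apply Ha|]. lra. }
  assert (C2 : csum (fun k => CSeries (fun n => a n k)) (CSeries (fun k => CSeries (fun n => a n k)))).
  { apply (csum_geo t); auto. exists (K / (1 - t)). intros k.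
    replace (K / (1 - t) * t ^ k) with (K * t ^ k / (1 - t)) by (field; lra).
    apply (csum_geo_bound _ t); auto. }
  apply csum_eps. intros e He.
  destruct (pow_small (K / ((1 - t) * (1 - t))) t e Ht He) as [N HN].
  exists N. intros n Hn. rewrite Cmod_sub_comm.
  assert (D := csum_minus _ _ _ _ C2 (Csum_n_csum a _ n R1)).
  destruct (csum_geo_bound (K * t ^ S n / (1 - t)) t
     (fun k => CSeries (fun n => a n k) - Csum_n (fun n => a n k) n)%C Ht) as [_ B].
  { intros k. eapply Rle_trans; [apply (geo_tail (K * t ^ k) t); auto|].
    apply Req_le. field. lra. }
  rewrite (csum_CSeries _ _ D) in B. eapply Rle_lt_trans; [apply B|].
  apply Rle_lt_trans with (2 := HN (S n) (Nat.le_trans _ _ _ Hn (Nat.le_succ_diag_r n))).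
  apply Req_le. field. lra.
Qed.

(** * Continuity and derivatives *)

Definition ccont {U : UniformSpace} (f : U -> C) (x : U) : Prop :=
  forall e, 0 < e -> locally x (fun y => Cmod (f y - f x)%C < e).

Lemma ccont_continuous {U : UniformSpace} (f : U -> C) (x : U) :
  ccont f x -> continuous (U := C_UniformSpace) f x.
Proof.
  intros H P HP. apply locally_Cmod in HP. destruct HP as [d [d0 Hd]].
  unfold filtermap. generalize (H d d0). apply filter_imp. intros y; apply Hd.
Qed.

Lemma ccont_C (f : C -> C) (z : C) :
  ccont (U := C_UniformSpace) f z <->
  forall e, 0 < e -> exists d, 0 < d /\ forall w, Cmod (w - z)%C < d -> Cmod (f w - f z)%C < e.
Proof.
  split; intros H e He; specialize (H e He).
  - apply locally_Cmod in H. exact H.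
  - apply locally_Cmod. exact H.
Qed.

(** Compactness of discs, in the form of a Lebesgue number: [Q w d] is read as
    an estimate at [w] with constant [d], which gets weaker as [d] decreases.
    If every point has a neighbourhood with a common constant, so has every
    disc. All uniform bounds and separations below are instances, for suitable
    [Q]. *)
Lemma local_uniform (Q : C -> R -> Prop) :
  (forall w d d', Q w d -> 0 < d' -> d' <= d -> Q w d') ->
  (forall p, exists d, 0 < d /\ forall w, Cmod (w - p)%C < d -> Q w d) ->
  forall M, exists d, 0 < d /\ forall w, Cmod w <= M -> Q w d.
Proof.
  intros Hm Hl M.
  (* Half of the local radius is kept, so that a point close to the centre
     [(x, y)] in each coordinate is still in the good neighbourhood. *)
  assert (D : forall x y : R, {d : posreal | forall w, Cmod (w - (x, y))%C < 2 * d -> Q w d}).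
  { intros x y. apply constructive_indefinite_description.
    destruct (Hl (x, y)) as [d [d0 Hd]]. assert (h : 0 < d / 2) by lra.
    exists (mkposreal _ h). intros w Hw. cbn [pos] in *. apply Hm with d; try lra. apply Hd; lra. }
  destruct (compactness_value_2d (- M) M (- M) M (fun x y => proj1_sig (D x y))) as [d Hd].
  exists d. split; [apply cond_pos|]. intros w Hw.
  assert (A1 := Re_le_Cmod w). assert (A2 := Im_le_Cmod w).
  assert (B1 : - M <= fst w <= M) by (apply Rabs_le_between; lra).
  assert (B2 : - M <= snd w <= M) by (apply Rabs_le_between; lra).
  apply NNPP. intros N. apply (Hd (fst w) (snd w) B1 B2). intros [u [v [_ [_ [E1 [E2 E3]]]]]].
  apply N. apply Hm with (2 := cond_pos d) (3 := E3).
  apply (proj2_sig (D u v)).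
  apply Rle_lt_trans with (Rabs (fst w - u) + Rabs (snd w - v)); [|lra].
  replace (w - (u, v))%C with (RtoC (fst w - u) + RtoC (snd w - v) * Ci)%C.
  - eapply Rle_trans; [apply Cmod_triangle|]. rewrite Cmod_mult, Cmod_Ci, !Cmod_R. lra.
  - unfold Cminus, Cplus, Copp, Cmult, RtoC, Ci; cbn [fst snd]. f_equal; ring.
Qed.

Section ContAlg.
Context {U : UniformSpace}.
Implicit Types (f g : U -> C) (x : U).

Lemma ccont_const (k : C) x : ccont (fun _ => k) x.
Proof.
  intros e He. apply filter_forall. intros y. rewrite Cminus_diag, Cmod_0. exact He.
Qed.

Lemma ccont_ext_loc f g x : locally x (fun y => f y = g y) -> ccont f x -> ccont g x.
Proof.
  intros E H e He. rewrite <- (locally_singleton _ _ E).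
  generalize (filter_and _ _ E (H e He)). apply filter_imp.
  intros y [E1 H1]. rewrite <- E1. exact H1.
Qed.

Lemma ccont_ext f g x : (forall y, f y = g y) -> ccont f x -> ccont g x.
Proof. intros E. apply ccont_ext_loc. apply filter_forall. exact E. Qed.

Lemma ccont_plus f g x : ccont f x -> ccont g x -> ccont (fun y => f y + g y)%C x.
Proof.
  intros Hf Hg e He. assert (H2 : 0 < e / 2) by lra.
  generalize (filter_and _ _ (Hf _ H2) (Hg _ H2)). apply filter_imp. intros y [H1 H3].
  replace (f y + g y - (f x + g x))%C with ((f y - f x) + (g y - g x))%C by ring.
  eapply Rle_lt_trans; [apply Cmod_triangle|]. lra.
Qed.

Lemma ccont_mult f g x : ccont f x -> ccont g x -> ccont (fun y => f y * g y)%C x.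
Proof.
  intros Hf Hg e He.
  set (A := Cmod (f x) + 1). set (B := Cmod (g x) + 1).
  assert (A0 : 0 < A) by (unfold A; generalize (Cmod_ge_0 (f x)); lra).
  assert (B0 : 0 < B) by (unfold B; generalize (Cmod_ge_0 (g x)); lra).
  assert (e1 : 0 < e / 2 / B) by (apply Rdiv_lt_0_compat; lra).
  assert (e2 : 0 < e / 2 / A) by (apply Rdiv_lt_0_compat; lra).
  generalize (filter_and _ _ (Hf _ e1) (filter_and _ _ (Hg _ e2) (Hg _ Rlt_0_1))).
  apply filter_imp. intros y [H1 [H2 H3]].
  replace (f y * g y - f x * g x)%C with ((f y - f x) * g y + f x * (g y - g x))%C by ring.
  eapply Rle_lt_trans; [apply Cmod_triangle|]. rewrite !Cmod_mult.
  assert (GB : Cmod (g y) <= B).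
  { unfold B. generalize (Cmod_sub_ge (g y) (g x)). lra. }
  assert (T1 : Cmod (f y - f x)%C * Cmod (g y) <= e / 2 / B * B).
  { apply Rmult_le_compat; try apply Cmod_ge_0; lra. }
  assert (T2 : Cmod (f x) * Cmod (g y - g x)%C < A * (e / 2 / A)).
  { apply Rle_lt_trans with (Cmod (f x) * (e / 2 / A)).
    - apply Rmult_le_compat_l; [apply Cmod_ge_0|lra].
    - apply Rmult_lt_compat_r; auto. unfold A; lra. }
  replace (e / 2 / B * B) with (e / 2) in T1 by (field; lra).
  replace (A * (e / 2 / A)) with (e / 2) in T2 by (field; lra). lra.
Qed.

Lemma ccont_opp f x : ccont f x -> ccont (fun y => - f y)%C x.
Proof.
  intros H. apply ccont_ext with (fun y => (- (1)) * f y)%C.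
  - intros y. ring.
  - apply ccont_mult; auto. apply ccont_const.
Qed.

Lemma ccont_minus f g x : ccont f x -> ccont g x -> ccont (fun y => f y - g y)%C x.
Proof. intros Hf Hg. apply ccont_plus; auto. apply ccont_opp; auto. Qed.

Lemma ccont_away f x : ccont f x -> f x <> 0%C ->
  locally x (fun y => Cmod (f x) / 2 < Cmod (f y)).
Proof.
  intros H N. apply Cmod_gt_0 in N.
  assert (h : 0 < Cmod (f x) / 2) by lra.
  generalize (H _ h). apply filter_imp. intros y Hy.
  rewrite Cmod_sub_comm in Hy. generalize (Cmod_sub_ge (f x) (f y)). lra.
Qed.

Lemma ccont_inv f x : ccont f x -> f x <> 0%C -> ccont (fun y => / f y)%C x.
Proof.
  intros H N e He. assert (P := N). apply Cmod_gt_0 in P.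
  assert (e1 : 0 < e * (Cmod (f x) * Cmod (f x) / 2)).
  { apply Rmult_lt_0_compat; auto. apply Rdiv_lt_0_compat; [|lra]. apply Rmult_lt_0_compat; auto. }
  generalize (filter_and _ _ (ccont_away f x H N) (H _ e1)).
  apply filter_imp. intros y [H1 H2].
  assert (Ny : f y <> 0%C) by (apply Cmod_pos_neq; lra).
  replace (/ f y - / f x)%C with ((f x - f y) / (f y * f x))%C by (field; auto).
  rewrite Cmod_div by (apply Cmult_neq_0; auto).
  rewrite Cmod_sub_comm, Cmod_mult.
  apply Rmult_lt_reg_r with (Cmod (f y) * Cmod (f x)); [nra|].
  unfold Rdiv. rewrite Rmult_assoc, Rinv_l by nra. rewrite Rmult_1_r.
  apply Rlt_le_trans with (1 := H2). apply Rmult_le_compat_l; [lra|]. nra.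
Qed.

Lemma ccont_pow f x n : ccont f x -> ccont (fun y => f y ^ n)%C x.
Proof.
  intros H. induction n; [apply (ccont_const 1%C)|]. apply (ccont_mult f (fun y => f y ^ n)%C); auto.
Qed.

End ContAlg.

Lemma ccont_id (z : C) : ccont (U := C_UniformSpace) (fun w => w) z.
Proof. apply ccont_C. intros e He. exists e; auto. Qed.

Lemma ccont_comp {U : UniformSpace} (f : C -> C) (g : U -> C) (x : U) :
  ccont g x -> ccont (U := C_UniformSpace) f (g x) -> ccont (fun y => f (g y)) x.
Proof.
  intros Hg Hf e He. destruct (proj1 (ccont_C _ _) Hf e He) as [d [d0 Hd]].
  generalize (Hg d d0). apply filter_imp. auto.
Qed.

Ltac dem H := match goal with
  |- context [excluded_middle_informative ?P] => destruct (excluded_middle_informative P) as [H|H]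
  end.

Lemma circle_away (p z0 : C) (r : R) : Cmod (p - z0)%C <> r ->
  exists d, 0 < d /\ forall w, Cmod (w - p)%C < d -> Cmod (w - z0)%C <> r.
Proof.
  intros N. exists (Rabs (Cmod (p - z0)%C - r)). split; [apply Rabs_pos_lt; lra|].
  intros w Hw E0. apply (Rlt_not_le _ _ Hw). rewrite <- E0.
  apply Rabs_le. assert (T1 := Cmod_sub_ge (p - z0) (w - z0)). assert (T2 := Cmod_sub_ge (w - z0) (p - z0)).
  replace (p - z0 - (w - z0))%C with (- (w - p))%C in T1 by ring. rewrite Cmod_opp in T1.
  replace (w - z0 - (p - z0))%C with (w - p)%C in T2 by ring. lra.
Qed.

Lemma circle_bounded (f : C -> C) (z0 : C) (r : R) :
  (forall w, Cmod (w - z0)%C = r -> ccont (U := C_UniformSpace) f w) ->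
  exists K, 0 < K /\ forall w, Cmod (w - z0)%C = r -> Cmod (f w) <= K.
Proof.
  intros Fc.
  destruct (local_uniform (fun w d => Cmod (w - z0)%C = r -> Cmod (f w) <= / d)) with (M := Cmod z0 + r)
    as [d [d0 Hd0]].
  - intros w d d' H Hd1 Hd2 Hw. eapply Rle_trans; [apply H, Hw|]. apply Rinv_le_contravar; lra.
  - intros p. destruct (Req_dec (Cmod (p - z0)%C) r) as [E0|N].
    + destruct (proj1 (ccont_C _ _) (Fc p E0) 1 Rlt_0_1) as [d [d0 Hd0]].
      assert (F0 := Cmod_ge_0 (f p)).
      exists (Rmin d (/ (Cmod (f p) + 1))). split; [apply Rmin_pos; [auto|apply Rinv_0_lt_compat; lra]|].
      intros w Hw _. specialize (Hd0 w (Rlt_le_trans _ _ _ Hw (Rmin_l _ _))).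
      apply Rle_trans with (Cmod (f p) + 1).
      * generalize (Cmod_sub_ge (f w) (f p)); lra.
      * rewrite <- (Rinv_inv (Cmod (f p) + 1)) at 1. apply Rinv_le_contravar; [|apply Rmin_r].
        apply Rmin_pos; auto; apply Rinv_0_lt_compat; lra.
    + destruct (circle_away p z0 r N) as [d [d0 Hd]]. exists d; split; auto.
      intros w Hw E0. destruct (Hd w Hw E0).
  - exists (/ d). split; [apply Rinv_0_lt_compat; auto|]. intros w Hw. apply Hd0; auto.
    generalize (Cmod_sub_ge w z0); lra.
Qed.

(** The distance from [f w] to [K] changes by at most [Cmod (f w - f w')],
    hence pointwise positive distances are locally, and by compactness
    globally, bounded below on the circle. *)
Lemma circle_separated (f : C -> C) (r : R) (K : C -> Prop) :
  (forall w, Cmod w = r -> ccont (U := C_UniformSpace) f w) ->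
  (forall w, Cmod w = r -> exists d, 0 < d /\ forall z, K z -> d <= Cmod (f w - z)%C) ->
  exists d, 0 < d /\ forall w z, Cmod w = r -> K z -> d <= Cmod (f w - z)%C.
Proof.
  intros Fc Hs. assert (Z : forall w : C, (w - 0)%C = w) by (intros; ring).
  destruct (local_uniform (fun w d => Cmod w = r -> forall z, K z -> d <= Cmod (f w - z)%C)) with (M := r)
    as [d [d0 Hd]].
  - intros w d d' H _ Hd2 Hw z Hz. eapply Rle_trans; [exact Hd2|]. apply H; auto.
  - intros p. destruct (Req_dec (Cmod p) r) as [E0|N].
    + destruct (Hs p E0) as [d1 [d1p Hd1]].
      destruct (proj1 (ccont_C _ _) (Fc p E0) (d1 / 2)) as [d [d0 Hd]]; [lra|].
      exists (Rmin d (d1 / 2)). split; [apply Rmin_pos; lra|].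
      intros w Hw _ z Hz. specialize (Hd w (Rlt_le_trans _ _ _ Hw (Rmin_l _ _))).
      specialize (Hd1 z Hz). assert (T := Cmod_sub_triangle (f p) (f w) z).
      rewrite (Cmod_sub_comm (f p) (f w)) in T. generalize (Rmin_r d (d1 / 2)). lra.
    + rewrite <- (Z p) in N. destruct (circle_away p 0%C r N) as [d [d0 Hd]].
      exists d; split; auto. intros w Hw E0. rewrite <- (Z w) in E0. destruct (Hd w Hw E0).
  - exists d; split; auto. intros w z Hw Hz. apply Hd; auto. lra.
Qed.

(** Caratheodory's form of the complex derivative, with a difference quotient
    that extends continuously to [z]: rules such as those for products,
    composites and inverses become algebra with quotients. *)
Definition cderiv (f : C -> C) (z l : C) : Prop :=
  exists q : C -> C, (forall w, f w - f z = q w * (w - z))%C /\ q z = l /\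
    ccont (U := C_UniformSpace) q z.

Lemma is_derive_cderiv (f : C -> C) (z l : C) :
  is_derive (K := C_AbsRing) (V := C_NormedModule) f z l -> cderiv f z l.
Proof.
  intros [_ H].
  exists (fun w => if excluded_middle_informative (w = z) then l else (f w - f z) / (w - z))%C.
  split; [|split].
  - intros w. dem E0; [rewrite E0; ring|].
    field. intros E. apply E0. replace w with ((w - z) + z)%C by ring. rewrite E; ring.
  - destruct (excluded_middle_informative (z = z)); tauto.
  - intros e He. cbv beta. dem Ez; [|tauto].
    assert (He2 : 0 < e / 2) by lra.
    specialize (H z (fun P HP => HP) (mkposreal _ He2)).
    assert (H' : locally (T := C_UniformSpace) z
       (fun y => norm (V := C_NormedModule) (minus (minus (f y) (f z)) (scal (minus y z) l))
                 <= e / 2 * norm (V := AbsRing_NormedModule C_AbsRing) (minus y z))).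
    { apply (proj2 (locally_C z _)) || apply (proj1 (locally_C z _)). exact H. }
    revert H'. apply filter_imp. intros w Hw. cbv beta.
    dem E0.
    + rewrite Cminus_diag, Cmod_0; auto.
    + assert (Nz : (w - z)%C <> 0%C).
      { intros E. apply E0. replace w with ((w - z) + z)%C by ring. rewrite E; ring. }
      change (Cmod (f w - f z - (w - z) * l)%C <= e / 2 * Cmod (w - z)%C) in Hw.
      replace ((f w - f z) / (w - z) - l)%C with ((f w - f z - (w - z) * l) / (w - z))%C
        by (field; auto).
      rewrite Cmod_div by auto. apply Cmod_gt_0 in Nz.
      apply Rmult_lt_reg_r with (1 := Nz). unfold Rdiv. rewrite Rmult_assoc, Rinv_l by lra.
      nra.
Qed.

Lemma cderiv_eps (f : C -> C) (z l : C) : cderiv f z l ->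
  forall e, 0 < e -> exists d, 0 < d /\ forall w, Cmod (w - z)%C < d ->
    Cmod (f w - f z - (w - z) * l)%C <= e * Cmod (w - z)%C.
Proof.
  intros [q [H1 [H2 H3]]] e He.
  destruct (proj1 (ccont_C _ _) H3 e He) as [d [d0 Hd]]. exists d; split; auto.
  intros w Hw. rewrite H1.
  replace (q w * (w - z) - (w - z) * l)%C with ((q w - l) * (w - z))%C by ring.
  rewrite Cmod_mult, <- H2. apply Rmult_le_compat_r; [apply Cmod_ge_0|].
  apply Rlt_le, Hd, Hw.
Qed.

Lemma eps_cderiv (f : C -> C) (z l : C) :
  (forall e, 0 < e -> exists d, 0 < d /\ forall w, Cmod (w - z)%C < d ->
    Cmod (f w - f z - (w - z) * l)%C <= e * Cmod (w - z)%C) ->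
  is_derive (K := C_AbsRing) (V := C_NormedModule) f z l.
Proof.
  intros H. split; [apply (is_linear_scal_l (K := C_AbsRing) (V := C_NormedModule))|].
  intros x Hx.
  replace x with z by (apply (is_filter_lim_locally_unique (V := AbsRing_NormedModule C_AbsRing) _ _ Hx)).
  intros e. destruct (H e (cond_pos e)) as [d [d0 Hd]].
  assert (L : locally (T := C_UniformSpace) z
       (fun y => norm (V := C_NormedModule) (minus (minus (f y) (f z)) (scal (minus y z) l))
                 <= e * norm (V := AbsRing_NormedModule C_AbsRing) (minus y z))).
  { apply locally_Cmod. exists d. split; auto. }
  apply (proj2 (locally_C z _)) || apply (proj1 (locally_C z _)). exact L.
Qed.

Lemma cderiv_is_derive (f : C -> C) (z l : C) :
  cderiv f z l <-> is_derive (K := C_AbsRing) (V := C_NormedModule) f z l.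
Proof.
  split; [|apply is_derive_cderiv]. intros H. apply eps_cderiv. apply cderiv_eps, H.
Qed.

Lemma cderiv_C_derive (f : C -> C) (z l : C) : cderiv f z l -> C_derive f z = l.
Proof. intros H. apply is_C_derive_unique. apply cderiv_is_derive, H. Qed.

Lemma cderiv_cont (f : C -> C) (z l : C) : cderiv f z l -> ccont (U := C_UniformSpace) f z.
Proof.
  intros [q [H1 [H2 H3]]].
  apply ccont_ext with (fun w => q w * (w - z) + f z)%C.
  { intros w. rewrite <- H1. ring. }
  apply ccont_plus; [|apply ccont_const]. apply ccont_mult; auto.
  apply ccont_minus; [apply ccont_id|apply ccont_const].
Qed.

Lemma cderiv_ext_loc (f g : C -> C) (z l : C) :
  locally z (fun w => f w = g w) -> cderiv f z l -> cderiv g z l.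
Proof.
  intros E H. apply cderiv_is_derive, eps_cderiv. intros e He.
  destruct (cderiv_eps _ _ _ H e He) as [d [d0 Hd]].
  apply locally_Cmod in E. destruct E as [d' [d0' Hd']].
  exists (Rmin d d'). split; [apply Rmin_pos; auto|]. intros w Hw.
  rewrite <- Hd'. rewrite <- Hd'.
  - apply Hd. eapply Rlt_le_trans; [exact Hw|apply Rmin_l].
  - rewrite Cminus_diag, Cmod_0; auto.
  - eapply Rlt_le_trans; [exact Hw|apply Rmin_r].
Qed.

Lemma cderiv_ext (f g : C -> C) (z l : C) :
  (forall w, f w = g w) -> cderiv f z l -> cderiv g z l.
Proof. intros E. apply cderiv_ext_loc. apply filter_forall; auto. Qed.

Lemma cderiv_const (k z : C) : cderiv (fun _ => k) z 0%C.
Proof.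
  exists (fun _ => 0%C). split; [intros; ring|]. split; auto. apply ccont_const.
Qed.

Lemma cderiv_id (z : C) : cderiv (fun w => w) z 1%C.
Proof.
  exists (fun _ => 1%C). split; [intros; ring|]. split; auto. apply ccont_const.
Qed.

Lemma cderiv_plus (f g : C -> C) (z a b : C) :
  cderiv f z a -> cderiv g z b -> cderiv (fun w => f w + g w)%C z (a + b)%C.
Proof.
  intros [p [P1 [P2 P3]]] [q [Q1 [Q2 Q3]]].
  exists (fun w => p w + q w)%C. split; [|split].
  - intros w. replace (f w + g w - (f z + g z))%C with ((f w - f z) + (g w - g z))%C by ring.
    rewrite P1, Q1. ring.
  - rewrite P2, Q2. auto.
  - apply ccont_plus; auto.
Qed.

Lemma cderiv_mult (f g : C -> C) (z a b : C) :
  cderiv f z a -> cderiv g z b -> cderiv (fun w => f w * g w)%C z (a * g z + f z * b)%C.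
Proof.
  intros Hf Hg. assert (Cg := cderiv_cont _ _ _ Hg). revert Hf Hg.
  intros [p [P1 [P2 P3]]] [q [Q1 [Q2 Q3]]].
  exists (fun w => p w * g w + f z * q w)%C. split; [|split].
  - intros w. replace (f w * g w - f z * g z)%C with ((f w - f z) * g w + f z * (g w - g z))%C by ring.
    rewrite P1, Q1. ring.
  - rewrite P2, Q2. auto.
  - apply ccont_plus; apply ccont_mult; auto. apply ccont_const.
Qed.

Lemma cderiv_opp (f : C -> C) (z a : C) : cderiv f z a -> cderiv (fun w => - f w)%C z (- a)%C.
Proof.
  intros H. replace (- a)%C with (0 * f z + (- (1)) * a)%C by ring.
  apply cderiv_ext with (fun w => (- (1)) * f w)%C; [intros; ring|].
  apply (cderiv_mult (fun _ => - (1))%C f); auto. apply cderiv_const.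
Qed.

Lemma cderiv_minus (f g : C -> C) (z a b : C) :
  cderiv f z a -> cderiv g z b -> cderiv (fun w => f w - g w)%C z (a - b)%C.
Proof. intros Hf Hg. apply cderiv_plus; auto. apply cderiv_opp; auto. Qed.

Lemma cderiv_scal (k : C) (f : C -> C) (z a : C) :
  cderiv f z a -> cderiv (fun w => k * f w)%C z (k * a)%C.
Proof.
  intros H. replace (k * a)%C with (0 * f z + k * a)%C by ring.
  apply (cderiv_mult (fun _ => k) f); auto. apply cderiv_const.
Qed.

Lemma cderiv_inv (f : C -> C) (z a : C) :
  cderiv f z a -> f z <> 0%C -> cderiv (fun w => / f w)%C z (- a / (f z * f z))%C.
Proof.
  intros Hf N. assert (Cf := cderiv_cont _ _ _ Hf). destruct Hf as [p [P1 [P2 P3]]].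
  assert (A := ccont_away _ _ Cf N).
  assert (Q : cderiv (fun w => if excluded_middle_informative (f w = 0%C) then / f z + / (f z) * / (f z) * (- p w) * (w - z) else / f w)%C z (- a / (f z * f z))%C).
  { exists (fun w => if excluded_middle_informative (f w = 0%C) then / (f z) * / (f z) * (- p w) else - p w / (f w * f z))%C.
    split; [|split].
    - intros w. destruct (excluded_middle_informative (f z = 0%C)); [tauto|].
      destruct (excluded_middle_informative (f w = 0%C)); [ring|].
      replace (/ f w - / f z)%C with (- (f w - f z) / (f w * f z))%C by (field; auto).
      rewrite P1. field; auto.
    - destruct (excluded_middle_informative (f z = 0%C)); [tauto|]. rewrite P2; auto.
    - apply ccont_ext_loc with (fun w => - p w * / (f w * f z))%C.
      + revert A. apply filter_imp. intros w Hw.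
        dem E; auto.
        rewrite E, Cmod_0 in Hw. generalize (Cmod_ge_0 (f z)); lra.
      + apply ccont_mult; [apply ccont_opp; auto|].
        apply ccont_inv; [|apply Cmult_neq_0; auto].
        apply ccont_mult; auto. apply ccont_const. }
  revert Q. apply cderiv_ext_loc. revert A. apply filter_imp. intros w Hw.
  dem E; auto.
  rewrite E, Cmod_0 in Hw. generalize (Cmod_ge_0 (f z)); lra.
Qed.

Lemma cderiv_comp (f g : C -> C) (z a b : C) :
  cderiv g z b -> cderiv f (g z) a -> cderiv (fun w => f (g w)) z (a * b)%C.
Proof.
  intros Hg Hf. assert (Cg := cderiv_cont _ _ _ Hg). revert Hf Hg.
  intros [p [P1 [P2 P3]]] [q [Q1 [Q2 Q3]]].
  exists (fun w => p (g w) * q w)%C. split; [|split].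
  - intros w. rewrite P1, Q1. ring.
  - rewrite P2, Q2. auto.
  - apply ccont_mult; auto. apply (ccont_comp p g); auto.
Qed.

Lemma cderiv_pow (n : nat) (z : C) : cderiv (fun w => w ^ n)%C z (RtoC (INR n) * z ^ (pred n))%C.
Proof.
  induction n.
  - replace (RtoC (INR 0) * z ^ pred 0)%C with (RtoC 0) by (change (INR 0) with 0; ring).
    apply (cderiv_const 1%C).
  - replace (RtoC (INR (S n)) * z ^ pred (S n))%C
      with (1 * z ^ n + z * (RtoC (INR n) * z ^ (pred n)))%C.
    + apply (cderiv_mult (fun w => w) (fun w => w ^ n)%C); [apply cderiv_id|exact IHn].
    + rewrite S_INR, RtoC_plus. simpl pred. destruct n.
      * change (INR 0) with 0. ring.
      * simpl pred. rewrite !Cpow_S. ring.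
Qed.

Definition holo (U : C -> Prop) (f : C -> C) : Prop := forall z, U z -> exists l, cderiv f z l.

Lemma holo_cont U f z : holo U f -> U z -> ccont (U := C_UniformSpace) f z.
Proof. intros H Hz. destruct (H z Hz) as [l Hl]. apply (cderiv_cont _ _ _ Hl). Qed.

Lemma holo_deriv U f z : holo U f -> U z -> cderiv f z (C_derive f z).
Proof. intros H Hz. destruct (H z Hz) as [l Hl]. rewrite (cderiv_C_derive _ _ _ Hl). exact Hl. Qed.

Lemma holo_sub (U V : C -> Prop) f : (forall z, V z -> U z) -> holo U f -> holo V f.
Proof. intros H Hf z Hz. apply Hf, H, Hz. Qed.

Lemma holo_const U k : holo U (fun _ => k).
Proof. intros z _. eexists; apply cderiv_const. Qed.

Lemma holo_mult U f g : holo U f -> holo U g -> holo U (fun z => f z * g z)%C.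
Proof.
  intros Hf Hg z Hz. destruct (Hf z Hz), (Hg z Hz). eexists; apply cderiv_mult; eassumption.
Qed.

(** ** Curves *)

(** The same form for curves, so that [rderiv_comp] is again a product of
    quotients. *)
Definition rderiv (g : R -> C) (t : R) (l : C) : Prop :=
  exists q : R -> C, (forall s, g s - g t = RtoC (s - t) * q s)%C /\ q t = l /\
    ccont (U := R_UniformSpace) q t.

Lemma locally_R (x : R) (P : R -> Prop) :
  locally x P <-> exists d, 0 < d /\ forall y, Rabs (y - x) < d -> P y.
Proof.
  split.
  - intros [d Hd]. exists d; split; [apply cond_pos|]. exact Hd.
  - intros [d [d0 Hd]]. exists (mkposreal d d0). exact Hd.
Qed.

Lemma norm_CR (x : C) : norm (V := C_R_NormedModule) x = Cmod x.
Proof. symmetry. exact (Cmod_norm x). Qed.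

Lemma rderiv_is_derive (g : R -> C) (t : R) (l : C) :
  rderiv g t l -> is_derive (K := R_AbsRing) (V := C_R_NormedModule) g t l.
Proof.
  intros [q [H1 [H2 H3]]].
  split; [apply (is_linear_scal_l (K := R_AbsRing) (V := C_R_NormedModule))|].
  intros x Hx.
  replace x with t by (apply (is_filter_lim_locally_unique (V := AbsRing_NormedModule R_AbsRing) _ _ Hx)).
  intros e. generalize (H3 e (cond_pos e)). apply filter_imp. intros s Hs.
  rewrite H2 in Hs.
  rewrite norm_CR.
  change (Cmod (g s - g t - scal (K := R_AbsRing) (V := C_R_NormedModule) (s - t)%R l)%C
    <= e * Rabs (s - t)).
  replace (scal (K := R_AbsRing) (V := C_R_NormedModule) (s - t)%R l) with (RtoC (s - t) * l)%C.
  - rewrite H1. replace (RtoC (s - t) * q s - RtoC (s - t) * l)%C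
      with (RtoC (s - t) * (q s - l))%C by ring.
    rewrite Cmod_mult, Cmod_R, Rmult_comm.
    apply Rmult_le_compat_r; [apply Rabs_pos|]. lra.
  - unfold scal; simpl. unfold prod_scal, scal; simpl.
    unfold mult; simpl. unfold Cmult; simpl. f_equal; ring.
Qed.

Lemma rderiv_parts (g : R -> C) (t : R) (l : C) :
  is_derive (fun s => fst (g s)) t (fst l) -> is_derive (fun s => snd (g s)) t (snd l) ->
  rderiv g t l.
Proof.
  intros Ha Hb.
  exists (fun s => if excluded_middle_informative (s = t) then l else (g s - g t) / RtoC (s - t))%C.
  split; [|split].
  - intros s. dem E0.
    + rewrite E0. rewrite Rminus_diag. ring.
    + field. intros E. apply RtoC_inj in E. apply E0; lra.
  - destruct (excluded_middle_informative (t = t)); tauto.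
  - apply is_derive_Reals in Ha. apply is_derive_Reals in Hb. intros e He.
    destruct (Ha (e / 2)) as [d1 H1]; [lra|]. destruct (Hb (e / 2)) as [d2 H2]; [lra|].
    apply locally_R. exists (Rmin d1 d2). split; [apply Rmin_pos; apply cond_pos|].
    intros s Hs. cbv beta. destruct (excluded_middle_informative (t = t)) as [_|N0]; [|tauto].
    dem E0.
    + rewrite Cminus_diag, Cmod_0; auto.
    + assert (Nh : s - t <> 0) by (intros E; apply E0; lra).
      specialize (H1 (s - t) Nh (Rlt_le_trans _ _ _ Hs (Rmin_l _ _))).
      specialize (H2 (s - t) Nh (Rlt_le_trans _ _ _ Hs (Rmin_r _ _))).
      replace (t + (s - t)) with s in H1, H2 by ring.
      assert (Q : ((g s - g t) / RtoC (s - t) - l)%C =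
        (((fst (g s) - fst (g t)) / (s - t) - fst l)%R, ((snd (g s) - snd (g t)) / (s - t) - snd l)%R)).
      { unfold Cdiv, Cminus, Cplus, Copp, Cmult, Cinv, RtoC; simpl.
        f_equal; field; nra. }
      rewrite Q. set (x := (_ / _ - fst l)%R) in *. set (y := (_ / _ - snd l)%R) in *.
      apply Rle_lt_trans with (Rabs x + Rabs y); [|lra].
      replace ((x, y) : C) with (RtoC x + RtoC y * Ci)%C.
      * eapply Rle_trans; [apply Cmod_triangle|]. rewrite Cmod_mult, Cmod_Ci, !Cmod_R. lra.
      * unfold Cplus, Cmult, RtoC, Ci; simpl. f_equal; ring.
Qed.

Lemma rderiv_cont (g : R -> C) (t : R) (l : C) : rderiv g t l -> ccont (U := R_UniformSpace) g t.
Proof.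
  intros [q [H1 [H2 H3]]].
  apply ccont_ext with (fun s => RtoC (s - t) * q s + g t)%C.
  { intros s. rewrite <- H1. ring. }
  apply ccont_plus; [|apply ccont_const]. apply ccont_mult; auto.
  intros e He. apply locally_R. exists e; split; auto. intros y Hy.
  rewrite <- RtoC_minus, Cmod_R. replace (y - t - (t - t)) with (y - t) by ring. exact Hy.
Qed.

Lemma rderiv_comp (f : C -> C) (g : R -> C) (t : R) (a b : C) :
  rderiv g t b -> cderiv f (g t) a -> rderiv (fun s => f (g s)) t (a * b)%C.
Proof.
  intros Hg Hf. assert (Cg := rderiv_cont _ _ _ Hg). revert Hf Hg.
  intros [p [P1 [P2 P3]]] [q [Q1 [Q2 Q3]]].
  exists (fun s => p (g s) * q s)%C. split; [|split].
  - intros w. rewrite P1, Q1. ring.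
  - rewrite P2, Q2. auto.
  - apply ccont_mult; auto. apply (ccont_comp (U := R_UniformSpace) p g); auto.
Qed.

Lemma rderiv_fst (g : R -> C) (t : R) (l : C) :
  rderiv g t l -> is_derive (fun s => fst (g s)) t (fst l).
Proof.
  intros [q [H1 [H2 H3]]]. apply is_derive_Reals. intros e He.
  generalize (H3 e He). intros L. apply locally_R in L. destruct L as [d [d0 Hd]].
  exists (mkposreal d d0). intros h Nh Hh. simpl in Hh.
  specialize (Hd (t + h)). replace (t + h - t) with h in Hd by ring. specialize (Hd Hh).
  rewrite H2 in Hd. apply Rle_lt_trans with (2 := Hd).
  eapply Rle_trans; [|apply Re_le_Cmod]. apply Req_le. f_equal.
  generalize (f_equal fst (H1 (t + h))). simpl. intros E. field_simplify_eq; [|auto].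
  replace (t + h - t) with h in E by ring. simpl in *. nra.
Qed.

(** * Integrals of complex functions of a real variable *)

Definition CInt (f : R -> C) (a b : R) : C := RInt (V := C_R_CompleteNormedModule) f a b.

Definition cont_on (f : R -> C) (a b : R) : Prop :=
  forall t, a <= t <= b -> ccont (U := R_UniformSpace) f t.

Lemma CInt_correct (f : R -> C) a b : a <= b -> cont_on f a b ->
  is_RInt (V := C_R_CompleteNormedModule) f a b (CInt f a b).
Proof.
  intros Hab H. apply RInt_correct. apply (ex_RInt_continuous (V := C_R_CompleteNormedModule)).
  intros z Hz. rewrite Rmin_left, Rmax_right in Hz by auto. apply ccont_continuous, H, Hz.
Qed.

Lemma CInt_unique (f : R -> C) a b l :
  is_RInt (V := C_R_CompleteNormedModule) f a b l -> CInt f a b = l.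
Proof. apply (is_RInt_unique (V := C_R_CompleteNormedModule)). Qed.

Lemma CInt_ext (f g : R -> C) a b : a <= b -> (forall t, a <= t <= b -> f t = g t) ->
  CInt f a b = CInt g a b.
Proof.
  intros Hab H. apply (RInt_ext (V := C_R_CompleteNormedModule)). intros t Ht.
  rewrite Rmin_left, Rmax_right in Ht by auto. apply H; lra.
Qed.

Lemma CInt_plus (f g : R -> C) a b : a <= b -> cont_on f a b -> cont_on g a b ->
  CInt (fun t => f t + g t)%C a b = (CInt f a b + CInt g a b)%C.
Proof.
  intros Hab Hf Hg. apply CInt_unique.
  apply (is_RInt_plus (V := C_R_CompleteNormedModule)); apply CInt_correct; auto.
Qed.

Lemma CInt_minus (f g : R -> C) a b : a <= b -> cont_on f a b -> cont_on g a b ->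
  CInt (fun t => f t - g t)%C a b = (CInt f a b - CInt g a b)%C.
Proof.
  intros Hab Hf Hg. apply CInt_unique.
  apply (is_RInt_minus (V := C_R_CompleteNormedModule)); apply CInt_correct; auto.
Qed.

Lemma CInt_scal (k : C) (f : R -> C) a b : a <= b -> cont_on f a b ->
  CInt (fun t => k * f t)%C a b = (k * CInt f a b)%C.
Proof.
  intros Hab Hf. apply CInt_unique.
  assert (H := CInt_correct f a b Hab Hf).
  assert (H1 := is_RInt_fct_extend_fst (U := R_NormedModule) (V := R_NormedModule) _ _ _ _ H).
  assert (H2 := is_RInt_fct_extend_snd (U := R_NormedModule) (V := R_NormedModule) _ _ _ _ H).
  destruct k as [x y]. set (I := CInt f a b) in *.
  change (x, y) with ((x, y) : C). unfold Cmult.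
  apply (is_RInt_fct_extend_pair (U := R_NormedModule) (V := R_NormedModule)); cbn [fst snd].
  - apply (is_RInt_minus (V := R_NormedModule)); apply (is_RInt_scal (V := R_NormedModule)); auto.
  - apply (is_RInt_plus (V := R_NormedModule)); apply (is_RInt_scal (V := R_NormedModule)); auto.
Qed.

Lemma CInt_const (k : C) : CInt (fun _ => k) 0 1 = k.
Proof.
  apply CInt_unique.
  assert (H := is_RInt_const (V := C_R_CompleteNormedModule) 0 1 k).
  replace (1 - 0) with (@one R_AbsRing) in H by (unfold one; simpl; ring).
  rewrite (scal_one (V := C_R_ModuleSpace)) in H. exact H.
Qed.

Lemma CInt_Chasles (f : R -> C) a b c : a <= b -> b <= c -> cont_on f a c ->
  CInt f a c = (CInt f a b + CInt f b c)%C.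
Proof.
  intros H1 H2 Hf. symmetry. apply (RInt_Chasles (V := C_R_CompleteNormedModule)).
  - exists (CInt f a b). apply CInt_correct; auto. intros t Ht; apply Hf; lra.
  - exists (CInt f b c). apply CInt_correct; auto. intros t Ht; apply Hf; lra.
Qed.

Lemma CInt_bound (f : R -> C) a b M : a <= b -> cont_on f a b ->
  (forall t, a <= t <= b -> Cmod (f t) <= M) -> Cmod (CInt f a b) <= M * (b - a).
Proof.
  intros Hab Hf HM. rewrite <- norm_CR.
  apply (norm_RInt_le (V := C_R_NormedModule) f (fun _ => M) a b _ (M * (b - a)) Hab).
  - intros x Hx. rewrite norm_CR. auto.
  - apply CInt_correct; auto.
  - replace (M * (b - a)) with (scal (K := R_AbsRing) (V := R_NormedModule) (b - a) M).
    + apply (is_RInt_const (V := R_NormedModule)).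
    + unfold scal; simpl; unfold mult; simpl; ring.
Qed.

Lemma CInt_deriv (g dg : R -> C) a b : a <= b ->
  (forall t, a <= t <= b -> rderiv g t (dg t)) -> cont_on dg a b ->
  CInt dg a b = (g b - g a)%C.
Proof.
  intros Hab Hg Hd. apply CInt_unique.
  apply (is_RInt_derive (V := C_R_CompleteNormedModule) g dg).
  - intros t Ht. rewrite Rmin_left, Rmax_right in Ht by auto. apply rderiv_is_derive; auto.
  - intros t Ht. rewrite Rmin_left, Rmax_right in Ht by auto. apply ccont_continuous; auto.
Qed.

Lemma cont_on_mult f g a b : cont_on f a b -> cont_on g a b -> cont_on (fun t => f t * g t)%C a b.
Proof. intros Hf Hg t Ht. apply ccont_mult; auto. Qed.

Lemma cont_on_minus f g a b : cont_on f a b -> cont_on g a b -> cont_on (fun t => f t - g t)%C a b.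
Proof. intros Hf Hg t Ht. apply ccont_minus; auto. Qed.

(** The integral of the tail is at most the uniform bound of [geo_tail]. *)
Lemma CInt_csum (K t : R) (f : nat -> R -> C) (g : R -> C) : 0 <= t < 1 ->
  (forall n, cont_on (f n) 0 1) -> cont_on g 0 1 ->
  (forall n s, 0 <= s <= 1 -> Cmod (f n s) <= K * t ^ n) ->
  (forall s, 0 <= s <= 1 -> csum (fun n => f n s) (g s)) ->
  csum (fun n => CInt (f n) 0 1) (CInt g 0 1).
Proof.
  intros Ht Hf Hg HK Hs.
  assert (P : forall n, cont_on (fun s => Csum_n (fun k => f k s) n) 0 1 /\
     CInt (fun s => Csum_n (fun k => f k s) n) 0 1 = Csum_n (fun k => CInt (f k) 0 1) n).
  { induction n.
    - split.
      + intros s Hs'. apply ccont_ext with (f 0%nat); [|apply Hf; auto].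
        intros y; rewrite Csum_n_0; auto.
      + rewrite Csum_n_0. apply CInt_ext; [lra|]. intros y _; apply Csum_n_0.
    - destruct IHn as [I1 I2]. split.
      + intros s Hs'. apply ccont_ext with (fun s => Csum_n (fun k => f k s) n + f (S n) s)%C.
        { intros y; rewrite Csum_n_S; auto. }
        apply ccont_plus; [apply I1|apply Hf]; auto.
      + rewrite Csum_n_S, <- I2, <- CInt_plus by (auto; lra).
        apply CInt_ext; [lra|]. intros y _; rewrite Csum_n_S; auto. }
  apply csum_eps. intros e He.
  destruct (pow_small (K / (1 - t)) t e Ht He) as [N HN].
  exists N. intros n Hn. destruct (P n) as [P1 P2].
  rewrite <- P2, Cmod_sub_comm, <- CInt_minus by (auto; lra).
  apply Rle_lt_trans with (K * t ^ S n / (1 - t) * (1 - 0)).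
  - apply CInt_bound; [lra|apply cont_on_minus; auto|].
    intros s Hs'. rewrite <- (csum_CSeries _ _ (Hs s Hs')). apply (geo_tail K t); auto.
  - rewrite Rminus_0_r, Rmult_1_r.
    apply Rle_lt_trans with (2 := HN (S n) (Nat.le_trans _ _ _ Hn (Nat.le_succ_diag_r n))).
    apply Req_le. field. lra.
Qed.

(** * Goursat's theorem for homotopies *)

(** [Q] has the primitive [P], so its integral along the curve is the
    increment of [P]; the rest of the integral is that of [f - Q], which is
    small in modulus. *)
Lemma curve_integral_estimate (f P Q : C -> C) (g dg : R -> C) a b k M : a <= b ->
  (forall t, a <= t <= b -> rderiv g t (dg t)) -> cont_on dg a b ->
  cont_on (fun t => f (g t)) a b -> cont_on (fun t => Q (g t)) a b ->
  (forall t, a <= t <= b -> cderiv P (g t) (Q (g t))) ->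
  (forall t, a <= t <= b -> Cmod (f (g t) - Q (g t))%C <= k) ->
  (forall t, a <= t <= b -> Cmod (dg t) <= M) ->
  Cmod (CInt (fun t => f (g t) * dg t)%C a b - (P (g b) - P (g a)))%C <= k * M * (b - a).
Proof.
  intros Hab Hg Hdg Hf HQ HP Hk HM.
  rewrite <- (CInt_deriv (fun t => P (g t)) (fun t => Q (g t) * dg t)%C a b); auto.
  - rewrite <- CInt_minus; auto.
    + apply CInt_bound; auto.
      * apply cont_on_minus; apply cont_on_mult; auto.
      * intros t Ht. replace (f (g t) * dg t - Q (g t) * dg t)%C with ((f (g t) - Q (g t)) * dg t)%C by ring.
        rewrite Cmod_mult. apply Rmult_le_compat; try apply Cmod_ge_0; auto.
    + apply cont_on_mult; auto.
    + apply cont_on_mult; auto.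
  - intros t Ht. apply (rderiv_comp P g); auto.
  - apply cont_on_mult; auto.
Qed.

(** The partial velocities [ps] and [pt] of [p] enter the line integrals, and
    the Lipschitz bound controls the diameters of images of small squares. *)
Record homotopy (p ps pt : R -> R -> C) (M : R) : Prop := {
  hom_s : forall s t, rderiv (fun s => p s t) s (ps s t);
  hom_t : forall s t, rderiv (fun t => p s t) t (pt s t);
  hom_s_cont : forall s t, ccont (U := R_UniformSpace) (fun s => ps s t) s;
  hom_t_cont : forall s t, ccont (U := R_UniformSpace) (fun t => pt s t) t;
  hom_s_bound : forall s t, 0 <= s <= 1 -> 0 <= t <= 1 -> Cmod (ps s t) <= M;
  hom_t_bound : forall s t, 0 <= s <= 1 -> 0 <= t <= 1 -> Cmod (pt s t) <= M;
  hom_lip : forall s t s' t', 0 <= s <= 1 -> 0 <= t <= 1 -> 0 <= s' <= 1 -> 0 <= t' <= 1 ->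
    Cmod (p s t - p s' t')%C <= M * (Rabs (s - s') + Rabs (t - t')) }.

Definition bottom (f : C -> C) (p ps : R -> R -> C) (y a b : R) : C :=
  CInt (fun s => f (p s y) * ps s y)%C a b.
Definition side (f : C -> C) (p pt : R -> R -> C) (x a b : R) : C :=
  CInt (fun t => f (p x t) * pt x t)%C a b.

(** The integral of [f dz] along the image under [p] of the counterclockwise
    boundary of the square with lower left corner [(x, y)] and side [h]. *)
Definition square_int f p ps pt x y h : C :=
  (bottom f p ps y x (x + h) + side f p pt (x + h) y (y + h)
   - bottom f p ps (y + h) x (x + h) - side f p pt x y (y + h))%C.

Section Goursat.
Context (f : C -> C) (p ps pt : R -> R -> C) (M : R) (Hp : homotopy p ps pt M).
Context (Hf : forall s t, 0 <= s <= 1 -> 0 <= t <= 1 -> exists l, cderiv f (p s t) l).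

Let J := square_int f p ps pt.

Lemma edge_s_cont t a b : 0 <= a -> b <= 1 -> 0 <= t <= 1 -> cont_on (fun s => f (p s t)) a b.
Proof.
  intros Ha Hb Ht s Hs. destruct (Hf s t) as [l Hl]; try lra.
  apply (ccont_comp (U := R_UniformSpace) f (fun s => p s t)).
  - apply (rderiv_cont _ _ _ (hom_s _ _ _ _ Hp s t)).
  - apply (cderiv_cont _ _ _ Hl).
Qed.

Lemma edge_t_cont s a b : 0 <= a -> b <= 1 -> 0 <= s <= 1 -> cont_on (fun t => f (p s t)) a b.
Proof.
  intros Ha Hb Hs t Ht. destruct (Hf s t) as [l Hl]; try lra.
  apply (ccont_comp (U := R_UniformSpace) f (fun t => p s t)).
  - apply (rderiv_cont _ _ _ (hom_t _ _ _ _ Hp s t)).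
  - apply (cderiv_cont _ _ _ Hl).
Qed.

(** Every inner edge is run through in both directions and cancels. *)
Lemma square_int_split x y k : 0 <= x -> 0 <= y -> 0 <= k -> x + k + k <= 1 -> y + k + k <= 1 ->
  J x y (k + k) = (J x y k + J (x + k)%R y k + J x (y + k)%R k + J (x + k)%R (y + k)%R k)%C.
Proof.
  intros Hx Hy Hk X Y. unfold J, square_int.
  assert (B : forall t, 0 <= t <= 1 -> bottom f p ps t x (x + (k + k)) =
     (bottom f p ps t x (x + k) + bottom f p ps t (x + k) (x + k + k))%C).
  { intros t Ht. replace (x + (k + k)) with (x + k + k) by ring.
    apply CInt_Chasles; try lra. apply cont_on_mult; [apply edge_s_cont; lra|].
    intros s _; apply (hom_s_cont _ _ _ _ Hp). }
  assert (D : forall s, 0 <= s <= 1 -> side f p pt s y (y + (k + k)) =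
     (side f p pt s y (y + k) + side f p pt s (y + k) (y + k + k))%C).
  { intros s Hs. replace (y + (k + k)) with (y + k + k) by ring.
    apply CInt_Chasles; try lra. apply cont_on_mult; [apply edge_t_cont; lra|].
    intros t _; apply (hom_t_cont _ _ _ _ Hp). }
  rewrite (B y), (B (y + (k + k))), (D x), (D (x + (k + k))) by lra.
  replace (x + (k + k)) with (x + k + k) by ring.
  replace (y + (k + k)) with (y + k + k) by ring. ring.
Qed.

(** Near the image [z0] of the point, [f] differs from its affine part [Q] by
    at most [e' |z - z0|]. The affine part has a primitive and contributes
    nothing along a closed curve, so the integral is at most [e'] times the
    diameter times the perimeter, of order [e' h^2]. *)
Lemma square_int_local s0 t0 e : 0 <= s0 <= 1 -> 0 <= t0 <= 1 -> 0 < e ->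
  exists d, 0 < d /\ forall x y h, 0 <= x -> 0 <= y -> 0 <= h -> x + h <= 1 -> y + h <= 1 ->
    x <= s0 <= x + h -> y <= t0 <= y + h -> h < d -> Cmod (J x y h) <= e * (h * h).
Proof.
  intros Hs0 Ht0 He. destruct (Hf s0 t0 Hs0 Ht0) as [l Hl].
  assert (M0 : 0 <= M).
  { eapply Rle_trans; [apply Cmod_ge_0|]. apply (hom_s_bound _ _ _ _ Hp s0 t0); auto. }
  (* Each of the four edges has length at most [M h] and lies within [2 M h]
     of [z0]: the total error is at most [8 M^2 e' h^2]. *)
  set (e' := e / (8 * (M * M + 1))).
  assert (He' : 0 < e') by (apply Rdiv_lt_0_compat; nra).
  destruct (cderiv_eps _ _ _ Hl e' He') as [d [d0 Hd]].
  (* For such [h] the image of the square is within [2 M h < d] of [z0]. *)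
  exists (d / (2 * (M + 1))). split; [apply Rdiv_lt_0_compat; lra|].
  intros x y h Hx Hy Hh X Y S T Hhd.
  set (z0 := p s0 t0). set (Q := fun z : C => (f z0 + (z - z0) * l)%C).
  set (P := fun z : C => (f z0 * z + (z - z0) * (z - z0) * (l / 2))%C).
  assert (HP : forall z, cderiv P z (Q z)).
  { intros z. unfold P, Q.
    replace (f z0 + (z - z0) * l)%C with (f z0 * 1 + (((1 - 0) * (z - z0) + (z - z0) * (1 - 0)) * (l / 2) + (z - z0) * (z - z0) * 0))%C by field.
    apply cderiv_plus.
    - apply (cderiv_scal (f z0) (fun z => z)). apply cderiv_id.
    - assert (L : cderiv (fun z => z - z0)%C z (1 - 0)%C)
        by (apply cderiv_minus; [apply cderiv_id|apply cderiv_const]).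
      apply (cderiv_mult (fun z => (z - z0) * (z - z0))%C (fun _ => l / 2)%C).
      + apply (cderiv_mult _ _ _ _ _ L L).
      + apply cderiv_const. }
  assert (HQ : forall z, ccont (U := C_UniformSpace) Q z).
  { intros z. apply ccont_plus; [apply ccont_const|]. apply ccont_mult; [|apply ccont_const].
    apply ccont_minus; [apply ccont_id|apply ccont_const]. }
  assert (Near : forall s t, x <= s <= x + h -> y <= t <= y + h ->
     Cmod (f (p s t) - Q (p s t))%C <= e' * (M * (h + h))).
  { intros s t Hs Ht.
    assert (L : Cmod (p s t - z0)%C <= M * (h + h)).
    { eapply Rle_trans; [apply (hom_lip _ _ _ _ Hp); lra|].
      apply Rmult_le_compat_l; auto. apply Rplus_le_compat; apply Rabs_le; lra. }
    replace (f (p s t) - Q (p s t))%C with (f (p s t) - f z0 - (p s t - z0) * l)%C by (unfold Q; ring).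
    eapply Rle_trans; [apply Hd|].
    - fold z0. eapply Rle_lt_trans; [exact L|].
      apply Rle_lt_trans with ((M + 1) * (2 * h)); [nra|].
      apply Rlt_le_trans with ((M + 1) * (2 * (d / (2 * (M + 1))))).
      + apply Rmult_lt_compat_l; lra.
      + apply Req_le. field. lra.
    - apply Rmult_le_compat_l; [lra|exact L]. }
  (* The increments of [P] along the four edges cancel in [square_int]. *)
  assert (EB : forall t, y <= t <= y + h ->
     Cmod (bottom f p ps t x (x + h) - (P (p (x + h)%R t) - P (p x t)))%C
       <= e' * (M * (h + h)) * M * (x + h - x)).
  { intros t Ht. apply (curve_integral_estimate f P Q (fun s => p s t) (fun s => ps s t)).
    - lra.
    - intros s Hs. apply (hom_s _ _ _ _ Hp).
    - intros s Hs. apply (hom_s_cont _ _ _ _ Hp).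
    - apply edge_s_cont; lra.
    - intros s Hs. apply (ccont_comp (U := R_UniformSpace) Q (fun s => p s t)); auto.
      apply (rderiv_cont _ _ _ (hom_s _ _ _ _ Hp s t)).
    - intros; apply HP.
    - intros s Hs; apply Near; lra.
    - intros s Hs. apply (hom_s_bound _ _ _ _ Hp); lra. }
  assert (ES : forall s, x <= s <= x + h ->
     Cmod (side f p pt s y (y + h) - (P (p s (y + h)%R) - P (p s y)))%C
       <= e' * (M * (h + h)) * M * (y + h - y)).
  { intros s Hs. apply (curve_integral_estimate f P Q (fun t => p s t) (fun t => pt s t)).
    - lra.
    - intros t Ht. apply (hom_t _ _ _ _ Hp).
    - intros t Ht. apply (hom_t_cont _ _ _ _ Hp).
    - apply edge_t_cont; lra.
    - intros t Ht. apply (ccont_comp (U := R_UniformSpace) Q (fun t => p s t)); auto.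
      apply (rderiv_cont _ _ _ (hom_t _ _ _ _ Hp s t)).
    - intros; apply HP.
    - intros t Ht; apply Near; lra.
    - intros t Ht. apply (hom_t_bound _ _ _ _ Hp); lra. }
  assert (E1 := EB y ltac:(lra)). assert (E2 := EB (y + h)%R ltac:(lra)).
  assert (E3 := ES x ltac:(lra)). assert (E4 := ES (x + h)%R ltac:(lra)).
  unfold J, square_int.
  set (b1 := bottom f p ps y x (x + h)) in *. set (b2 := bottom f p ps (y + h) x (x + h)) in *.
  set (s1 := side f p pt x y (y + h)) in *. set (s2 := side f p pt (x + h) y (y + h)) in *.
  match type of E1 with Cmod ?u <= _ => set (u1 := u) in * end.
  match type of E2 with Cmod ?u <= _ => set (u2 := u) in * end.
  match type of E3 with Cmod ?u <= _ => set (u3 := u) in * end.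
  match type of E4 with Cmod ?u <= _ => set (u4 := u) in * end.
  replace (b1 + s2 - b2 - s1)%C with (u1 + u4 - u2 - u3)%C by (unfold u1, u2, u3, u4; ring).
  assert (T1 := Cmod_sub_le (u1 + u4 - u2) u3). assert (T2 := Cmod_sub_le (u1 + u4) u2).
  assert (T3 := Cmod_triangle u1 u4).
  replace (x + h - x) with h in * by ring. replace (y + h - y) with h in * by ring.
  assert (F : 4 * (e' * (M * (h + h)) * M * h) <= e * (h * h)).
  { replace (4 * (e' * (M * (h + h)) * M * h)) with (8 * (M * M) * e' * (h * h)) by ring.
    apply Rmult_le_compat_r; [nra|]. unfold e'.
    apply Rle_trans with (8 * (M * M + 1) * (e / (8 * (M * M + 1)))).
    - apply Rmult_le_compat_r; [apply Rlt_le; exact He'|nra].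
    - apply Req_le. field. nra. }
  lra.
Qed.

Definition good_square (n : nat) (c : R * R) : Prop :=
  0 <= fst c /\ 0 <= snd c /\ fst c + (/ 2) ^ n <= 1 /\ snd c + (/ 2) ^ n <= 1.

(** One of the four quarters carries at least a quarter of the integral. *)
Lemma square_int_bisect (n : nat) (c : R * R) : good_square n c ->
  exists c', good_square (S n) c' /\ fst c <= fst c' /\ snd c <= snd c' /\
    fst c' + (/ 2) ^ S n <= fst c + (/ 2) ^ n /\ snd c' + (/ 2) ^ S n <= snd c + (/ 2) ^ n /\
    Cmod (J (fst c) (snd c) ((/ 2) ^ n)) <= 4 * Cmod (J (fst c') (snd c') ((/ 2) ^ S n)).
Proof.
  destruct c as [x y]. unfold good_square; cbn [fst snd]. intros [Hx [Hy [X Y]]].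
  set (k := (/ 2) ^ S n).
  assert (k0 : 0 < k) by (apply pow_lt; lra).
  assert (Ek : (/ 2) ^ n = k + k) by (unfold k; simpl; field).
  rewrite Ek in *. rewrite square_int_split by lra.
  set (j1 := J x y k). set (j2 := J (x + k) y k). set (j3 := J x (y + k) k).
  set (j4 := J (x + k) (y + k) k).
  assert (T : Cmod (j1 + j2 + j3 + j4)%C <= Cmod j1 + Cmod j2 + Cmod j3 + Cmod j4).
  { eapply Rle_trans; [apply Cmod_triangle|]. apply Rplus_le_compat_r.
    eapply Rle_trans; [apply Cmod_triangle|]. apply Rplus_le_compat_r. apply Cmod_triangle. }
  set (q := Cmod (j1 + j2 + j3 + j4)%C) in *.
  destruct (Rle_lt_dec q (4 * Cmod j1)); [exists (x, y); cbn [fst snd]; fold j1; lra|].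
  destruct (Rle_lt_dec q (4 * Cmod j2)); [exists (x + k, y); cbn [fst snd]; fold j2; lra|].
  destruct (Rle_lt_dec q (4 * Cmod j3)); [exists (x, y + k); cbn [fst snd]; fold j3; lra|].
  exists (x + k, y + k); cbn [fst snd]; fold j4. lra.
Qed.

(** Goursat's argument: repeated bisection gives nested squares of side
    [2^(-n)] whose integrals are at least [4^(-n)] times the original one. At
    their common point [f] is differentiable, and by [square_int_local] the
    integrals are at most [e 4^(-n)] for any [e]. *)
Lemma goursat_square : J 0 0 1 = 0%C.
Proof.
  assert (St : forall nc : nat * (R * R), exists c', good_square (fst nc) (snd nc) ->
    let c := snd nc in let n := fst nc in
    good_square (S n) c' /\ fst c <= fst c' /\ snd c <= snd c' /\
    fst c' + (/ 2) ^ S n <= fst c + (/ 2) ^ n /\ snd c' + (/ 2) ^ S n <= snd c + (/ 2) ^ n /\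
    Cmod (J (fst c) (snd c) ((/ 2) ^ n)) <= 4 * Cmod (J (fst c') (snd c') ((/ 2) ^ S n))).
  { intros [n c]. cbn [fst snd]. destruct (classic (good_square n c)) as [G|G].
    - destruct (square_int_bisect n c G) as [c' Hc']. exists c'. intros _; exact Hc'.
    - exists c. tauto. }
  (* A choice of quarter for every square, iterated into a sequence of nested
     squares. *)
  set (step := fun n c => proj1_sig (constructive_indefinite_description _ (St (n, c)))).
  assert (Hstep := fun n c => proj2_sig (constructive_indefinite_description _ (St (n, c)))).
  cbn [fst snd] in Hstep. fold (step) in Hstep.
  set (u := fix u n := match n with O => (0, 0) | S k => step k (u k) end).
  assert (Gd : forall n, good_square n (u n)).
  { induction n; [unfold good_square; simpl; lra|]. apply (Hstep n (u n) IHn). }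
  assert (Hu := fun n => Hstep n (u n) (Gd n)). clear Hstep.
  change (forall n : nat, good_square (S n) (u (S n)) /\
       fst (u n) <= fst (u (S n)) /\ snd (u n) <= snd (u (S n)) /\
       fst (u (S n)) + (/ 2) ^ S n <= fst (u n) + (/ 2) ^ n /\
       snd (u (S n)) + (/ 2) ^ S n <= snd (u n) + (/ 2) ^ n /\
       Cmod (J (fst (u n)) (snd (u n)) ((/ 2) ^ n)) <=
       4 * Cmod (J (fst (u (S n))) (snd (u (S n))) ((/ 2) ^ S n))) in Hu.
  assert (Big : forall n, Cmod (J 0 0 1) <= 4 ^ n * Cmod (J (fst (u n)) (snd (u n)) ((/ 2) ^ n))).
  { induction n; [simpl; lra|]. eapply Rle_trans; [exact IHn|].
    replace (4 ^ S n) with (4 ^ n * 4) by (simpl; ring). rewrite Rmult_assoc.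
    apply Rmult_le_compat_l; [apply pow_le; lra|]. apply Hu. }
  (* Nested intervals: each coordinate of the corners converges. *)
  assert (Lim : forall v : nat -> R, (forall n, 0 <= v n) -> (forall n, v n <= v (S n)) ->
     (forall n, v (S n) + (/ 2) ^ S n <= v n + (/ 2) ^ n) ->
     exists l, forall n, v n <= l <= v n + (/ 2) ^ n).
  { intros v V0 V1 V2.
    assert (Up : forall n m, v n <= v (n + m)%nat).
    { intros n m; induction m; [rewrite Nat.add_0_r; lra|].
      replace (n + S m)%nat with (S (n + m)) by lia. specialize (V1 (n + m)%nat). lra. }
    assert (Dn : forall n m, v (n + m)%nat + (/ 2) ^ (n + m) <= v n + (/ 2) ^ n).
    { intros n m; induction m; [rewrite Nat.add_0_r; lra|].
      replace (n + S m)%nat with (S (n + m)) by lia. specialize (V2 (n + m)%nat). lra. }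
    assert (Pw : forall n, 0 < (/ 2) ^ n) by (intros; apply pow_lt; lra).
    assert (Cr : forall n m, v m <= v n + (/ 2) ^ n).
    { intros n m. destruct (Nat.le_ge_cases n m) as [L|L].
      - specialize (Dn n (m - n)%nat). replace (n + (m - n))%nat with m in Dn by lia.
        specialize (Pw m). lra.
      - specialize (Up m (n - m)%nat). replace (m + (n - m))%nat with n in Up by lia.
        specialize (Pw n). lra. }
    destruct (completeness (fun r => exists n, r = v n)) as [l [L1 L2]].
    - exists (v 0%nat + (/ 2) ^ 0). intros r [n ->]. apply Cr.
    - exists (v 0%nat), 0%nat; auto.
    - exists l. intros n. split; [apply L1; exists n; auto|].
      apply L2. intros r [m ->]. apply Cr. }
  destruct (Lim (fun n => fst (u n))) as [X HX].
  { intros n; apply (Gd n). } { intros n; apply (Hu n). } { intros n; apply (Hu n). }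
  destruct (Lim (fun n => snd (u n))) as [Y HY].
  { intros n; apply (Gd n). } { intros n; apply (Hu n). } { intros n; apply (Hu n). }
  apply Cmod_small_0. intros e He.
  assert (HX0 : 0 <= X <= 1) by (specialize (HX 0%nat); simpl in HX; lra).
  assert (HY0 : 0 <= Y <= 1) by (specialize (HY 0%nat); simpl in HY; lra).
  destruct (square_int_local X Y e HX0 HY0 He) as [d [d0 Hd]].
  destruct (pow_small 1 (/ 2) d ltac:(lra) d0) as [N HN].
  specialize (HN N (le_n N)). specialize (Gd N). destruct Gd as [G1 [G2 [G3 G4]]].
  eapply Rle_trans; [apply (Big N)|].
  apply Rle_trans with (4 ^ N * (e * ((/ 2) ^ N * (/ 2) ^ N))).
  - apply Rmult_le_compat_l; [apply pow_le; lra|]. apply Hd; auto; try apply HX; try apply HY.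
    + apply pow_le; lra.
    + lra.
  - rewrite <- Rpow_mult_distr. replace (/ 2 * / 2) with (/ 4) by field.
    rewrite <- Rmult_assoc, (Rmult_comm (4 ^ N)), Rmult_assoc, <- Rpow_mult_distr.
    replace (4 * / 4) with 1 by field. rewrite pow1. lra.
Qed.

(** For closed curves the two edges at [t = 0] and [t = 1] have the same image
    and cancel in [square_int], leaving the difference of the two integrals. *)
Theorem homotopy_invariance :
  (forall s, p s 0 = p s 1) -> (forall s, ps s 0 = ps s 1) ->
  side f p pt 0 0 1 = side f p pt 1 0 1.
Proof.
  intros H1 H2. assert (G := goursat_square). unfold J, square_int in G.
  rewrite !Rplus_0_l in G.
  assert (E : bottom f p ps 0 0 1 = bottom f p ps 1 0 1).
  { apply CInt_ext; [lra|]. intros t _. rewrite H1, H2. auto. }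
  rewrite E in G. set (b := bottom f p ps 1 0 1) in *.
  replace (side f p pt 1 0 1) with (side f p pt 0 0 1 + (b + side f p pt 1 0 1 - b - side f p pt 0 0 1))%C by ring.
  rewrite G. ring.
Qed.
End Goursat.

(** * Contour integrals over circles *)

(** The unit circle, run through once by [0 <= t <= 1]. *)
Definition cis (t : R) : C := (cos (2 * PI * t), sin (2 * PI * t)).

Lemma Cmod_cis t : Cmod (cis t) = 1.
Proof.
  unfold Cmod, cis; cbn [fst snd]. rewrite <- sqrt_1. f_equal.
  rewrite <- (sin2_cos2 (2 * PI * t)). unfold Rsqr; ring.
Qed.

Lemma cis_neq_0 t : cis t <> 0%C.
Proof. apply Cmod_pos_neq. rewrite Cmod_cis; lra. Qed.

Lemma cis_0 : cis 0 = 1%C.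
Proof. unfold cis. rewrite Rmult_0_r, cos_0, sin_0. reflexivity. Qed.

Lemma cis_1 : cis 1 = 1%C.
Proof. unfold cis. rewrite Rmult_1_r, cos_2PI, sin_2PI. reflexivity. Qed.

Lemma rderiv_cis t : rderiv cis t (RtoC (2 * PI) * Ci * cis t)%C.
Proof.
  apply rderiv_parts; unfold cis, RtoC, Ci, Cmult; cbn [fst snd]; auto_derive; auto; ring.
Qed.

Lemma ccont_cis t : ccont (U := R_UniformSpace) cis t.
Proof. apply (rderiv_cont _ _ _ (rderiv_cis t)). Qed.

(** The velocity of [cis] has modulus [2 pi]. *)
Lemma cis_lip t t' : Cmod (cis t - cis t')%C <= 2 * PI * Rabs (t - t').
Proof.
  assert (W : forall a b, a <= b -> Cmod (cis b - cis a)%C <= 2 * PI * (b - a)).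
  { intros a b Hab. rewrite <- (CInt_deriv cis (fun t => RtoC (2 * PI) * Ci * cis t)%C a b Hab).
    - apply CInt_bound; auto.
      + intros s _. apply ccont_mult; [apply ccont_const|apply ccont_cis].
      + intros s _. rewrite !Cmod_mult, Cmod_Ci, Cmod_cis, Cmod_R, Rabs_pos_eq; [lra|].
        generalize PI_RGT_0; lra.
    - intros s _; apply rderiv_cis.
    - intros s _. apply ccont_mult; [apply ccont_const|apply ccont_cis]. }
  destruct (Rle_lt_dec t' t).
  - rewrite Rabs_pos_eq by lra. apply W; auto.
  - rewrite Cmod_sub_comm, Rabs_minus_sym, Rabs_pos_eq by lra. apply W; lra.
Qed.

Definition circ (c : C) (r t : R) : C := (c + RtoC r * cis t)%C.

Lemma ccont_circ c r t : ccont (U := R_UniformSpace) (circ c r) t.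
Proof.
  apply ccont_plus; [apply ccont_const|]. apply ccont_mult; [apply ccont_const|apply ccont_cis].
Qed.

Lemma Cmod_circ c r t : 0 <= r -> Cmod (circ c r t - c)%C = r.
Proof.
  intros Hr. unfold circ. replace (c + RtoC r * cis t - c)%C with (RtoC r * cis t)%C by ring.
  rewrite Cmod_mult, Cmod_cis, Cmod_RtoC_pos by auto. ring.
Qed.

Lemma Cmod_circ0 r t : 0 <= r -> Cmod (circ 0%C r t) = r.
Proof. intros Hr. transitivity (Cmod (circ 0%C r t - 0)%C); [f_equal; ring|apply Cmod_circ, Hr]. Qed.

(** With [w = circ c r t] one has [dw = 2 pi i (w - c) dt]: this is the
    contour integral of [f] over the circle divided by [2 pi i]. *)
Definition contour (f : C -> C) (c : C) (r : R) : C :=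
  CInt (fun t => f (circ c r t) * (circ c r t - c))%C 0 1.

Lemma cont_on_circ f c r : 0 <= r -> (forall w, Cmod (w - c)%C = r -> ccont (U := C_UniformSpace) f w) ->
  cont_on (fun t => f (circ c r t)) 0 1.
Proof.
  intros Hr H t _. apply (ccont_comp (U := R_UniformSpace) f (circ c r)).
  - apply ccont_circ.
  - apply H, Cmod_circ, Hr.
Qed.

Lemma cont_on_contour f c r : 0 <= r -> (forall w, Cmod (w - c)%C = r -> ccont (U := C_UniformSpace) f w) ->
  cont_on (fun t => f (circ c r t) * (circ c r t - c))%C 0 1.
Proof.
  intros Hr H. apply cont_on_mult; [apply cont_on_circ; auto|].
  intros t _. apply ccont_minus; [apply ccont_circ|apply ccont_const].
Qed.

Lemma circle_homotopy (c0 c1 : C) (r0 r1 : R) :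
  homotopy (fun s t => c0 + RtoC s * (c1 - c0) + RtoC (r0 + s * (r1 - r0)) * cis t)%C
    (fun s t => (c1 - c0) + RtoC (r1 - r0) * cis t)%C
    (fun s t => RtoC (r0 + s * (r1 - r0)) * (RtoC (2 * PI) * Ci * cis t))%C
    (Cmod (c1 - c0)%C + Rabs (r1 - r0) + (Rabs r0 + Rabs (r1 - r0)) * (2 * PI)).
Proof.
  assert (P := PI_RGT_0).
  assert (A0 := Cmod_ge_0 (c1 - c0)%C). assert (A1 := Rabs_pos (r1 - r0)). assert (A2 := Rabs_pos r0).
  assert (Rb : forall s, 0 <= s <= 1 -> Rabs (r0 + s * (r1 - r0)) <= Rabs r0 + Rabs (r1 - r0)).
  { intros s Hs. eapply Rle_trans; [apply Rabs_triang|]. apply Rplus_le_compat_l.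
    rewrite Rabs_mult, (Rabs_pos_eq s) by lra. nra. }
  assert (Q : 0 <= (Rabs r0 + Rabs (r1 - r0)) * (2 * PI)) by (apply Rmult_le_pos; lra).
  constructor.
  - intros s t. exists (fun _ => (c1 - c0) + RtoC (r1 - r0) * cis t)%C.
    split; [|split; [auto|apply ccont_const]].
    intros s'. rewrite !RtoC_plus, !RtoC_mult, !RtoC_minus. ring.
  - intros s t. destruct (rderiv_cis t) as [q [Q1 [Q2 Q3]]].
    exists (fun t' => RtoC (r0 + s * (r1 - r0)) * q t')%C. split; [|split].
    + intros t'. transitivity (RtoC (r0 + s * (r1 - r0)) * (cis t' - cis t))%C; [ring|].
      rewrite Q1. ring.
    + rewrite Q2; auto.
    + apply ccont_mult; auto. apply ccont_const.
  - intros s t. apply ccont_const.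
  - intros s t. apply ccont_mult; [apply ccont_const|].
    apply ccont_mult; [apply ccont_const|apply ccont_cis].
  - intros s t Hs Ht. eapply Rle_trans; [apply Cmod_triangle|].
    rewrite Cmod_mult, Cmod_cis, Cmod_R. lra.
  - intros s t Hs Ht. rewrite !Cmod_mult, Cmod_Ci, Cmod_cis, !Cmod_R, (Rabs_pos_eq (2 * PI)) by lra.
    specialize (Rb s Hs). assert (Rabs (r0 + s * (r1 - r0)) * (2 * PI) <= (Rabs r0 + Rabs (r1 - r0)) * (2 * PI)).
    { apply Rmult_le_compat_r; lra. } lra.
  - intros s t s' t' Hs Ht Hs' Ht'.
    replace (c0 + RtoC s * (c1 - c0) + RtoC (r0 + s * (r1 - r0)) * cis t -
       (c0 + RtoC s' * (c1 - c0) + RtoC (r0 + s' * (r1 - r0)) * cis t'))%C with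
      (RtoC (s - s') * (c1 - c0) + RtoC (s - s') * (RtoC (r1 - r0) * cis t)
        + RtoC (r0 + s' * (r1 - r0)) * (cis t - cis t'))%C
      by (rewrite !RtoC_plus, !RtoC_mult, !RtoC_minus; ring).
    eapply Rle_trans; [apply Cmod_triangle|].
    eapply Rle_trans; [apply Rplus_le_compat_r, Cmod_triangle|].
    rewrite !Cmod_mult, Cmod_cis, !Cmod_R. specialize (Rb s' Hs').
    assert (L := cis_lip t t'). assert (S0 := Rabs_pos (s - s')). assert (T0 := Rabs_pos (t - t')).
    assert (T1 : Rabs (r0 + s' * (r1 - r0)) * Cmod (cis t - cis t')%C <=
       (Rabs r0 + Rabs (r1 - r0)) * (2 * PI * Rabs (t - t'))).
    { apply Rmult_le_compat; auto. apply Rabs_pos. apply Cmod_ge_0. }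
    set (Z := (Rabs r0 + Rabs (r1 - r0)) * (2 * PI)) in *.
    replace ((Rabs r0 + Rabs (r1 - r0)) * (2 * PI * Rabs (t - t'))) with (Z * Rabs (t - t')) in T1 by (unfold Z; ring).
    nra.
Qed.

Lemma contour_invariance (f : C -> C) (c0 c1 : C) (r0 r1 : R) :
  (forall s t, 0 <= s <= 1 -> 0 <= t <= 1 ->
     exists l, cderiv f (c0 + RtoC s * (c1 - c0) + RtoC (r0 + s * (r1 - r0)) * cis t)%C l) ->
  0 <= r0 -> 0 <= r1 -> contour f c0 r0 = contour f c1 r1.
Proof.
  intros Hf R0 R1.
  assert (H := homotopy_invariance f _ _ _ _ (circle_homotopy c0 c1 r0 r1) Hf).
  cbn beta in H. rewrite cis_0, cis_1 in H. specialize (H (fun _ => eq_refl) (fun _ => eq_refl)).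
  assert (K : forall c r, 0 <= r -> (forall t, 0 <= t <= 1 -> exists l, cderiv f (circ c r t) l) ->
     CInt (fun t => f (circ c r t) * (RtoC r * (RtoC (2 * PI) * Ci * cis t)))%C 0 1 =
     (RtoC (2 * PI) * Ci * contour f c r)%C).
  { intros c r Hr Hc. unfold contour. rewrite <- CInt_scal.
    - apply CInt_ext; [lra|]. intros t _. unfold circ. ring.
    - lra.
    - intros t Ht. destruct (Hc t Ht) as [l Hl].
      apply ccont_mult.
      + apply (ccont_comp (U := R_UniformSpace) f (circ c r)); [apply ccont_circ|].
        apply (cderiv_cont _ _ _ Hl).
      + apply ccont_minus; [apply ccont_circ|apply ccont_const]. }
  assert (P0 : forall t, (c0 + RtoC 0 * (c1 - c0) + RtoC (r0 + 0 * (r1 - r0)) * cis t)%C = circ c0 r0 t).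
  { intros t. unfold circ. replace (r0 + 0 * (r1 - r0)) with r0 by ring. ring. }
  assert (P1 : forall t, (c0 + RtoC 1 * (c1 - c0) + RtoC (r0 + 1 * (r1 - r0)) * cis t)%C = circ c1 r1 t).
  { intros t. unfold circ. replace (r0 + 1 * (r1 - r0)) with r1 by ring. ring. }
  assert (Nz : (RtoC (2 * PI) * Ci)%C <> 0%C).
  { apply Cmod_pos_neq. rewrite Cmod_mult, Cmod_Ci, Cmod_R, Rabs_pos_eq; generalize PI_RGT_0; lra. }
  assert (H' : (RtoC (2 * PI) * Ci * contour f c0 r0)%C = (RtoC (2 * PI) * Ci * contour f c1 r1)%C).
  { rewrite <- !K; auto.
    - etransitivity; [|etransitivity; [exact H|]]; unfold side; apply CInt_ext; try lra; intros t _.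
      + rewrite P0. replace (r0 + 0 * (r1 - r0)) with r0 by ring. auto.
      + rewrite P1. replace (r0 + 1 * (r1 - r0)) with r1 by ring. auto.
    - intros t Ht. rewrite <- P1. apply Hf; lra.
    - intros t Ht. rewrite <- P0. apply Hf; lra. }
  clear K H P0 P1. set (k := (RtoC (2 * PI) * Ci)%C) in *. clearbody k.
  apply (f_equal (fun z => / k * z)%C) in H'.
  rewrite !Cmult_assoc, !Cinv_l, !Cmult_1_l in H' by auto. exact H'.
Qed.

Lemma contour_concentric (f : C -> C) (r0 r1 : R) : 0 <= r0 -> 0 <= r1 ->
  (forall w, Rmin r0 r1 <= Cmod w -> exists l, cderiv f w l) ->
  contour f 0%C r0 = contour f 0%C r1.
Proof.
  intros H0 H1 Hf. apply contour_invariance; auto. intros s t Hs Ht. apply Hf.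
  replace (0 + RtoC s * (0 - 0) + RtoC (r0 + s * (r1 - r0)) * cis t)%C
    with (circ 0%C (r0 + s * (r1 - r0)) t) by (unfold circ; ring).
  assert (M0 := Rmin_l r0 r1). assert (M1 := Rmin_r r0 r1).
  rewrite Cmod_circ0; nra.
Qed.

(** ** Cauchy's formula *)

(** Moving the circle linearly to a small circle around [a] avoids [a], where
    the integrand is singular; on the small circle the integral is the mean
    value of [f], which tends to [f a]. *)
Lemma contour_cauchy (f : C -> C) (z0 a : C) (r : R) :
  (forall w, Cmod (w - z0)%C <= r -> exists l, cderiv f w l) -> Cmod (a - z0)%C < r ->
  contour (fun w => f w / (w - a))%C z0 r = f a.
Proof.
  intros Hf Ha. assert (A0 := Cmod_ge_0 (a - z0)%C).
  replace (contour (fun w => f w / (w - a))%C z0 r)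
    with (f a + (contour (fun w => f w / (w - a)) z0 r - f a))%C by ring.
  rewrite (Cmod_small_0 (contour _ _ _ - f a)%C); [ring|]. intros e He.
  destruct (Hf a) as [l Hl]; [lra|].
  destruct (proj1 (ccont_C _ _) (cderiv_cont _ _ _ Hl) e He) as [d [d0 Hd]].
  (* The small circle has radius less than [d], where [f] is [e]-close to
     [f a], and is contained in the open disc. *)
  set (s := Rmin (d / 2) ((r - Cmod (a - z0)%C) / 2)).
  assert (s0 : 0 < s) by (apply Rmin_pos; lra).
  assert (s1 : s < d) by (unfold s; generalize (Rmin_l (d / 2) ((r - Cmod (a - z0)%C) / 2)); lra).
  assert (s2 : s + Cmod (a - z0)%C < r).
  { unfold s; generalize (Rmin_r (d / 2) ((r - Cmod (a - z0)%C) / 2)); lra. }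
  rewrite <- (contour_invariance (fun w => f w / (w - a))%C a z0 s r); try lra.
  - unfold contour. rewrite <- (CInt_const (f a)).
    assert (Cf : cont_on (fun t => f (circ a s t)) 0 1).
    { intros t _. apply (ccont_comp (U := R_UniformSpace) f (circ a s)); [apply ccont_circ|].
      destruct (Hf (circ a s t)) as [l' Hl']; [|apply (cderiv_cont _ _ _ Hl')].
      eapply Rle_trans; [apply (Cmod_sub_triangle _ a)|]. rewrite Cmod_circ by lra. lra. }
    rewrite (CInt_ext _ (fun t => f (circ a s t))); [|lra|].
    + rewrite <- CInt_minus; [|lra|exact Cf|intros t _; apply ccont_const].
      replace e with (e * (1 - 0)) by ring. apply CInt_bound; [lra| |].
      * apply cont_on_minus; auto. intros t _; apply ccont_const.
      * intros t _. apply Rlt_le, Hd. rewrite Cmod_circ; lra.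
    + intros t _. assert (N : (circ a s t - a)%C <> 0%C) by (apply Cmod_pos_neq; rewrite Cmod_circ; lra).
      field. exact N.
  (* On the intermediate circles [|w - a| >= s + u (r - s) - u |a - z0| > 0]
     and [|w - z0| <= (1 - u) |a - z0| + s + u (r - s) <= r]. *)
  - intros u t Hu Ht. set (w := (a + RtoC u * (z0 - a) + RtoC (s + u * (r - s)) * cis t)%C).
    assert (W1 : Cmod (RtoC (s + u * (r - s)) * cis t)%C = s + u * (r - s)).
    { rewrite Cmod_mult, Cmod_cis, Cmod_RtoC_pos by nra. ring. }
    assert (W2 : (w - a)%C <> 0%C).
    { apply Cmod_pos_neq. unfold w.
      replace (a + RtoC u * (z0 - a) + RtoC (s + u * (r - s)) * cis t - a)%C
        with (RtoC (s + u * (r - s)) * cis t - RtoC u * (a - z0))%C by ring.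
      eapply Rlt_le_trans; [|apply Cmod_sub_ge]. rewrite W1, Cmod_mult, Cmod_RtoC_pos by lra. nra. }
    assert (W3 : Cmod (w - z0)%C <= r).
    { replace (w - z0)%C with (RtoC (1 - u) * (a - z0) + RtoC (s + u * (r - s)) * cis t)%C
        by (unfold w; rewrite RtoC_minus; ring).
      eapply Rle_trans; [apply Cmod_triangle|]. rewrite W1, Cmod_mult, Cmod_RtoC_pos by lra. nra. }
    destruct (Hf w W3) as [lw Hlw]. eexists. apply cderiv_mult; [exact Hlw|].
    apply cderiv_inv; [|exact W2]. apply cderiv_minus; [apply cderiv_id|apply cderiv_const].
Qed.

(** A first order expansion of the integrand whose remainder is quadratic
    uniformly on the circle may be integrated. *)
Lemma contour_param_deriv (K0 : C -> C -> C) (K1 : C -> C) (z0 a : C) (r d B : R) :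
  0 < d -> 0 <= r ->
  (forall b w, Cmod (b - a)%C < d -> Cmod (w - z0)%C = r ->
     ccont (U := C_UniformSpace) (fun w => K0 w b) w /\
     Cmod (K0 w b - K0 w a - (b - a) * K1 w)%C <= B * (Cmod (b - a)%C * Cmod (b - a)%C)) ->
  (forall w, Cmod (w - z0)%C = r -> ccont (U := C_UniformSpace) K1 w) ->
  cderiv (fun b => contour (fun w => K0 w b) z0 r) a (contour K1 z0 r).
Proof.
  intros d0 r0 HK H1. apply cderiv_is_derive, eps_cderiv. intros e He.
  set (B' := Rabs B * r + 1).
  assert (B0 : 0 < B') by (unfold B'; generalize (Rabs_pos B); nra).
  exists (Rmin d (e / B')). split; [apply Rmin_pos; auto; apply Rdiv_lt_0_compat; auto|].
  intros b Hb.
  assert (Hb1 : Cmod (b - a)%C < d) by (eapply Rlt_le_trans; [exact Hb|apply Rmin_l]).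
  assert (Hb2 : Cmod (b - a)%C < e / B') by (eapply Rlt_le_trans; [exact Hb|apply Rmin_r]).
  assert (Ha1 : Cmod (a - a)%C < d) by (rewrite Cminus_diag, Cmod_0; auto).
  assert (C0 : forall b, Cmod (b - a)%C < d -> cont_on (fun t => K0 (circ z0 r t) b * (circ z0 r t - z0))%C 0 1).
  { intros b' Hb'. apply (cont_on_contour (fun w => K0 w b')); auto. intros w Hw. apply (HK b' w Hb' Hw). }
  assert (C1 : cont_on (fun t => K1 (circ z0 r t) * (circ z0 r t - z0))%C 0 1).
  { apply cont_on_contour; auto. }
  assert (C2 : cont_on (fun t => (b - a) * (K1 (circ z0 r t) * (circ z0 r t - z0)))%C 0 1).
  { apply cont_on_mult; auto. intros t _; apply ccont_const. }
  unfold contour. rewrite <- CInt_scal by (auto; lra).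
  rewrite <- CInt_minus by (auto; lra). rewrite <- CInt_minus; [|lra|apply cont_on_minus; auto|auto].
  apply Rle_trans with (Rabs B * (Cmod (b - a)%C * Cmod (b - a)%C) * r * (1 - 0)).
  - apply CInt_bound; [lra| |].
    + repeat apply cont_on_minus; auto.
    + intros t _.
      replace (K0 (circ z0 r t) b * (circ z0 r t - z0) - K0 (circ z0 r t) a * (circ z0 r t - z0) -
        (b - a) * (K1 (circ z0 r t) * (circ z0 r t - z0)))%C with
        ((K0 (circ z0 r t) b - K0 (circ z0 r t) a - (b - a) * K1 (circ z0 r t)) * (circ z0 r t - z0))%C by ring.
      rewrite Cmod_mult, Cmod_circ by auto. apply Rmult_le_compat_r; auto.
      eapply Rle_trans; [apply HK; auto; apply Cmod_circ; auto|].
      apply Rmult_le_compat_r; [|apply Rle_abs]. apply Rmult_le_pos; apply Cmod_ge_0.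
  - assert (D0 := Cmod_ge_0 (b - a)%C). set (h := Cmod (b - a)%C) in *.
    assert (h * B' <= e).
    { apply Rmult_le_reg_r with (/ B'); [apply Rinv_0_lt_compat; auto|].
      rewrite Rmult_assoc, Rinv_r by lra. unfold Rdiv in Hb2. lra. }
    apply Rle_trans with (h * B' * h); [unfold B'; nra|]. apply Rmult_le_compat_r; auto.
Qed.

Lemma inv_sub_bound (u h : C) (eta : R) : 0 < eta -> eta <= Cmod u -> Cmod h < eta / 2 ->
  u <> 0%C /\ (u - h)%C <> 0%C /\ Cmod (/ u) <= / eta /\ Cmod (/ (u - h))%C <= 2 / eta.
Proof.
  intros e0 Hu Hh. assert (V : eta / 2 <= Cmod (u - h)%C) by (generalize (Cmod_sub_ge u h); lra).
  assert (N1 : u <> 0%C) by (apply Cmod_pos_neq; lra).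
  assert (N2 : (u - h)%C <> 0%C) by (apply Cmod_pos_neq; lra).
  rewrite !Cmod_inv by auto. repeat split; auto.
  - apply Rinv_le_contravar; lra.
  - replace (2 / eta) with (/ (eta / 2)) by (field; lra). apply Rinv_le_contravar; lra.
Qed.

(** Cauchy's formula gives [f a] as a contour integral of [f w / (w - a)], and
    differentiating the kernel twice with respect to [a] shows that [f'] is
    differentiable at the centre. *)
Theorem holo_derive (U : C -> Prop) (f : C -> C) : open U -> holo U f -> holo U (C_derive f).
Proof.
  intros HU Hf z0 Hz0. destruct (proj1 (locally_Cmod _ _) (HU z0 Hz0)) as [R [R0 HR]].
  set (r := R / 2). assert (r0 : 0 < r) by (unfold r; lra).
  assert (Hd : forall w, Cmod (w - z0)%C <= r -> exists l, cderiv f w l).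
  { intros w Hw. apply Hf, HR. unfold r in Hw; lra. }
  assert (Fc : forall w, Cmod (w - z0)%C = r -> ccont (U := C_UniformSpace) f w).
  { intros w Hw. destruct (Hd w) as [l Hl]; [lra|apply (cderiv_cont _ _ _ Hl)]. }
  destruct (circle_bounded f z0 r Fc) as [K [K0 HK]].
  assert (Sep : forall a w, Cmod (a - z0)%C < r -> Cmod (w - z0)%C = r ->
     r - Cmod (a - z0)%C <= Cmod (w - a)%C).
  { intros a w Ha Hw. replace (w - a)%C with ((w - z0) - (a - z0))%C by ring.
    rewrite <- Hw at 1. apply Cmod_sub_ge. }
  assert (Kc : forall a w n, Cmod (a - z0)%C < r -> Cmod (w - z0)%C = r ->
     ccont (U := C_UniformSpace) (fun w => f w * (/ (w - a)) ^ n)%C w).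
  { intros a w n Ha Hw. apply ccont_mult; auto. apply ccont_pow. apply ccont_inv.
    - apply ccont_minus; [apply ccont_id|apply ccont_const].
    - apply Cmod_pos_neq. specialize (Sep a w Ha Hw). lra. }
  set (f1 := fun a => contour (fun w => f w * (/ (w - a)) ^ 2)%C z0 r).
  assert (D1 : forall a, Cmod (a - z0)%C < r -> cderiv f a (f1 a)).
  { intros a Ha. set (eta := r - Cmod (a - z0)%C). assert (e0 : 0 < eta) by (unfold eta; lra).
    apply cderiv_ext_loc with (fun b => contour (fun w => f w * (/ (w - b)) ^ 1)%C z0 r).
    - apply locally_Cmod. exists eta; split; auto. intros b Hb.
      rewrite <- (contour_cauchy f z0 b r Hd).
      + apply CInt_ext; [lra|]. intros t _. unfold Cdiv. rewrite Cpow_1_r. auto.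
      + replace (b - z0)%C with ((b - a) + (a - z0))%C by ring.
        eapply Rle_lt_trans; [apply Cmod_triangle|]. unfold eta in Hb; lra.
    - unfold f1. apply (contour_param_deriv (fun w b => f w * (/ (w - b)) ^ 1)%C
        (fun w => f w * (/ (w - a)) ^ 2)%C z0 a r (eta / 2) (K * (2 / eta * (/ eta * / eta)))); try lra.
      + intros b w Hb Hw. split.
        * apply Kc; auto. replace (b - z0)%C with ((b - a) + (a - z0))%C by ring.
          eapply Rle_lt_trans; [apply Cmod_triangle|]. unfold eta in Hb; lra.
        * destruct (inv_sub_bound (w - a) (b - a) eta e0 (Sep a w Ha Hw) Hb) as [N1 [N2 [I1 I2]]].
          replace (w - a - (b - a))%C with (w - b)%C in N2, I2 by ring.
          replace (f w * (/ (w - b)) ^ 1 - f w * (/ (w - a)) ^ 1 - (b - a) * (f w * (/ (w - a)) ^ 2))%C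
            with (f w * (/ (w - b) * (/ (w - a) * / (w - a))) * ((b - a) * (b - a)))%C
            by (simpl; field; auto).
          rewrite !Cmod_mult. apply Rmult_le_compat_r; [apply Rmult_le_pos; apply Cmod_ge_0|].
          repeat (apply Rmult_le_compat; [repeat apply Rmult_le_pos; apply Cmod_ge_0|repeat apply Rmult_le_pos; apply Cmod_ge_0|auto|]); auto.
      + intros w Hw. apply Kc; auto. }
  (* With [v = w - z0] and [h = b - z0], the remainder is [(v - h)^(-2) -
     v^(-2) - 2 h v^(-3) = (3 v - 2 h) h^2 / ((v - h)^2 v^3)]. *)
  exists (contour (fun w => RtoC 2 * (f w * (/ (w - z0)) ^ 3))%C z0 r).
  assert (Z0 : Cmod (z0 - z0)%C < r) by (rewrite Cminus_diag, Cmod_0; auto).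
  apply cderiv_ext_loc with f1.
  - apply locally_Cmod. exists r; split; auto. intros b Hb. symmetry. apply cderiv_C_derive, D1, Hb.
  - unfold f1. apply (contour_param_deriv (fun w b => f w * (/ (w - b)) ^ 2)%C
      (fun w => RtoC 2 * (f w * (/ (w - z0)) ^ 3))%C z0 z0 r (r / 2)
      (K * ((3 * r + 2 * r) * ((2 / r * (2 / r)) * (/ r * (/ r * / r)))))); try lra.
    + intros b w Hb Hw. split; [apply Kc; auto; lra|].
      assert (Hw' : r <= Cmod (w - z0)%C) by lra.
      destruct (inv_sub_bound (w - z0) (b - z0) r r0 Hw' Hb) as [N1 [N2 [I1 I2]]].
      replace (w - z0 - (b - z0))%C with (w - b)%C in N2, I2 by ring.
      replace (f w * (/ (w - b)) ^ 2 - f w * (/ (w - z0)) ^ 2 - (b - z0) * (RtoC 2 * (f w * (/ (w - z0)) ^ 3)))%C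
        with (f w * ((RtoC 3 * (w - z0) - RtoC 2 * (b - z0)) * ((/ (w - b) * / (w - b)) * (/ (w - z0) * (/ (w - z0) * / (w - z0)))))
              * ((b - z0) * (b - z0)))%C
        by (simpl; field; auto).
      assert (L : Cmod (RtoC 3 * (w - z0) - RtoC 2 * (b - z0))%C <= 3 * r + 2 * r).
      { eapply Rle_trans; [apply Cmod_sub_le|]. rewrite !Cmod_mult, !Cmod_RtoC_pos by lra. lra. }
      assert (P4 := Cmod_ge_0 (RtoC 3 * (w - z0) - RtoC 2 * (b - z0))%C).
      set (dd := (RtoC 3 * (w - z0) - RtoC 2 * (b - z0))%C) in *. rewrite !Cmod_mult.
      apply Rmult_le_compat_r; [apply Rmult_le_pos; apply Cmod_ge_0|].
      assert (P1 := Cmod_ge_0 (/ (w - b))%C). assert (P2 := Cmod_ge_0 (/ (w - z0))%C).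
      assert (P3 := Cmod_ge_0 (f w)).
      assert (HKw := HK w Hw).
      repeat (apply Rmult_le_compat; try assumption; repeat apply Rmult_le_pos; try assumption).
    + intros w Hw. apply ccont_mult; [apply ccont_const|]. apply Kc; auto.
Qed.

(** ** Laurent coefficients *)

Lemma csum_bounded (a : nat -> C) (l : C) : csum a l -> exists K, forall n, Cmod (a n) <= K.
Proof.
  intros H.
  destruct (filterlim_bounded (V := C_NormedModule) (Csum_n a)) as [M HM]; [exists l; exact H|].
  assert (HM' : forall n, Cmod (Csum_n a n) <= M) by exact HM.
  exists (2 * M). intros [|n].
  - specialize (HM' 0%nat). rewrite Csum_n_0 in HM'. generalize (Cmod_ge_0 (a 0%nat)). lra.
  - replace (a (S n)) with (Csum_n a (S n) - Csum_n a n)%C by (rewrite Csum_n_S; ring).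
    eapply Rle_trans; [apply Cmod_sub_le|]. generalize (HM' n), (HM' (S n)). lra.
Qed.

(** [k] times the integral is the increment of [g] over the period. *)
Lemma CInt_exp (g : R -> C) (k : C) : k <> 0%C -> (forall t, rderiv g t (k * g t)%C) ->
  g 0 = g 1 -> CInt g 0 1 = 0%C.
Proof.
  intros Nk Hg E01.
  assert (Cg : cont_on g 0 1) by (intros t _; apply (rderiv_cont _ _ _ (Hg t))).
  assert (H : (k * CInt g 0 1)%C = 0%C).
  { rewrite <- CInt_scal by (auto; lra). rewrite (CInt_deriv g (fun t => k * g t)%C).
    - rewrite E01; ring.
    - lra.
    - intros t _; apply Hg.
    - apply cont_on_mult; auto. intros t _; apply ccont_const. }
  replace (CInt g 0 1) with (/ k * (k * CInt g 0 1))%C by (field; auto).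
  rewrite H; ring.
Qed.

Lemma CInt_cis_pow n : (0 < n)%nat -> CInt (fun t => cis t ^ n)%C 0 1 = 0%C.
Proof.
  intros Hn. apply CInt_exp with (RtoC (INR n) * (RtoC (2 * PI) * Ci))%C.
  - apply Cmod_pos_neq. rewrite !Cmod_mult, Cmod_Ci, !Cmod_R, !Rabs_pos_eq.
    + assert (0 < INR n) by (apply lt_0_INR; auto). assert (P := PI_RGT_0). nra.
    + generalize PI_RGT_0; lra.
    + apply pos_INR.
  - intros t. destruct n; [lia|].
    replace (RtoC (INR (S n)) * (RtoC (2 * PI) * Ci) * cis t ^ S n)%C
      with (RtoC (INR (S n)) * cis t ^ (pred (S n)) * (RtoC (2 * PI) * Ci * cis t))%C
      by (simpl pred; rewrite Cpow_S; ring).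
    apply (rderiv_comp (fun z => z ^ S n)%C cis); [apply rderiv_cis|apply cderiv_pow].
  - rewrite cis_0, cis_1; auto.
Qed.

Lemma CInt_cis_inv_pow n : (0 < n)%nat -> CInt (fun t => (/ cis t) ^ n)%C 0 1 = 0%C.
Proof.
  intros Hn. apply CInt_exp with (- (RtoC (INR n) * (RtoC (2 * PI) * Ci)))%C.
  - apply Cmod_pos_neq. rewrite Cmod_opp, !Cmod_mult, Cmod_Ci, !Cmod_R, !Rabs_pos_eq.
    + assert (0 < INR n) by (apply lt_0_INR; auto). assert (P := PI_RGT_0). nra.
    + generalize PI_RGT_0; lra.
    + apply pos_INR.
  - intros t. destruct n; [lia|]. assert (N := cis_neq_0 t).
    replace (- (RtoC (INR (S n)) * (RtoC (2 * PI) * Ci)) * (/ cis t) ^ S n)%C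
      with (RtoC (INR (S n)) * (/ cis t) ^ (pred (S n)) * (- (1) / (cis t * cis t)) * (RtoC (2 * PI) * Ci * cis t))%C
      by (simpl pred; rewrite Cpow_S; field; auto).
    apply (rderiv_comp (fun z => (/ z) ^ S n)%C cis); [apply rderiv_cis|].
    apply (cderiv_comp (fun z => z ^ S n)%C (fun z => / z)%C).
    + apply (cderiv_inv (fun z => z)); auto. apply cderiv_id.
    + apply cderiv_pow.
  - rewrite cis_0, cis_1; auto.
Qed.

(** For [m <> n] the integrand is a multiple of a nonzero power of [cis] or of
    its inverse, whose mean value is [0] by [CInt_exp]. *)
Lemma CInt_circ_orth (r : R) m n : 0 < r ->
  CInt (fun t => (/ circ 0 r t) ^ n * circ 0 r t ^ m)%C 0 1 = if Nat.eq_dec n m then 1%C else 0%C.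
Proof.
  intros r0.
  assert (Nr : RtoC r <> 0%C) by (intros H; apply RtoC_inj in H; lra).
  assert (Ez : forall t, circ 0 r t = (RtoC r * cis t)%C) by (intros; unfold circ; ring).
  destruct (Nat.eq_dec n m) as [->|N].
  - rewrite <- (CInt_const 1%C). apply CInt_ext; [lra|]. intros t _.
    rewrite <- Cpow_mult_l, Ez, Cinv_l, Cpow_1_l; auto.
    apply Cmult_neq_0; auto. apply cis_neq_0.
  - destruct (Nat.lt_ge_cases n m) as [L|L].
    + rewrite (CInt_ext _ (fun t => RtoC r ^ (m - n) * cis t ^ (m - n))%C); [|lra|].
      * rewrite CInt_scal, CInt_cis_pow; [ring|lia|lra|].
        intros t _. apply ccont_pow, ccont_cis.
      * intros t _. rewrite Ez. assert (Ne := cis_neq_0 t).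
        replace m with (n + (m - n))%nat at 1 by lia.
        rewrite Cpow_add_r, Cmult_assoc, <- Cpow_mult_l, Cinv_l, Cpow_1_l, Cpow_mult_l; [ring|].
        apply Cmult_neq_0; auto.
    + rewrite (CInt_ext _ (fun t => (/ RtoC r) ^ (n - m) * (/ cis t) ^ (n - m))%C); [|lra|].
      * rewrite CInt_scal, CInt_cis_inv_pow; [ring|lia|lra|].
        intros t _. apply ccont_pow, ccont_inv; [apply ccont_cis|apply cis_neq_0].
      * intros t _. rewrite Ez. assert (Ne := cis_neq_0 t).
        replace n with ((n - m) + m)%nat at 1 by lia.
        rewrite Cpow_add_r, <- Cmult_assoc, <- Cpow_mult_l, Cinv_l, Cpow_1_l by (apply Cmult_neq_0; auto).
        rewrite Cmult_1_r, <- Cpow_mult_l. f_equal. field; auto.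
Qed.

(** Multiplication by [w^m] and termwise integration isolate the [m]-th
    coefficient by orthogonality. *)
Lemma laurent_coef (g : C -> C) (a : nat -> C) (R0 R : R) : 0 <= R0 -> R0 < R ->
  (forall w, R0 < Cmod w -> csum (fun n => a n * (/ w) ^ n)%C (g w)) ->
  (forall w, Cmod w = R -> ccont (U := C_UniformSpace) g w) ->
  forall m, CInt (fun t => g (circ 0 R t) * circ 0 R t ^ m)%C 0 1 = a m.
Proof.
  (* Convergence at the intermediate radius [R1] makes the series geometric,
     with ratio [R1 / R], on the circle of radius [R]. *)
  intros H0 HR Hs Hc m. set (R1 := (R0 + R) / 2).
  assert (B1 : R0 < R1 < R) by (unfold R1; lra).
  assert (N1 : RtoC R1 <> 0%C) by (intros H; apply RtoC_inj in H; lra).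
  destruct (csum_bounded _ _ (Hs (RtoC R1) ltac:(rewrite Cmod_RtoC_pos; lra))) as [K HK].
  assert (Kb : forall n, Cmod (a n) <= K * R1 ^ n).
  { intros n. specialize (HK n). rewrite Cmod_mult, Cmod_pow, Cmod_inv, Cmod_RtoC_pos in HK by (auto; lra).
    rewrite pow_inv in HK. assert (P : 0 < R1 ^ n) by (apply pow_lt; lra).
    apply Rmult_le_reg_r with (/ R1 ^ n); [apply Rinv_0_lt_compat; auto|].
    rewrite Rmult_assoc, Rinv_r by lra. lra. }
  assert (Cz : forall t, Cmod (circ 0 R t) = R) by (intros; apply Cmod_circ0; lra).
  assert (Nz : forall t, circ 0 R t <> 0%C) by (intros; apply Cmod_pos_neq; rewrite Cz; lra).
  assert (S1 : csum (fun n => CInt (fun t => a n * ((/ circ 0 R t) ^ n * circ 0 R t ^ m))%C 0 1)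
     (CInt (fun t => g (circ 0 R t) * circ 0 R t ^ m)%C 0 1)).
  { assert (Ht : 0 <= R1 / R < 1).
    { split; [apply Rle_div_r; lra|]. apply Rlt_div_l; lra. }
    apply (CInt_csum (K * R ^ m) (R1 / R)); auto.
    - intros n t _. apply ccont_mult; [apply ccont_const|]. apply ccont_mult; apply ccont_pow.
      + apply ccont_inv; [apply ccont_circ|apply Nz].
      + apply ccont_circ.
    - apply cont_on_mult.
      + apply cont_on_circ; [lra|]. intros w Hw. apply Hc. rewrite <- Hw. f_equal; ring.
      + intros t _. apply ccont_pow, ccont_circ.
    - intros n t _. rewrite !Cmod_mult, !Cmod_pow, Cmod_inv, Cz by auto.
      replace (K * R ^ m * (R1 / R) ^ n) with (K * R1 ^ n * (/ R) ^ n * R ^ m).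
      + rewrite <- Rmult_assoc. apply Rmult_le_compat_r; [apply pow_le; lra|].
        apply Rmult_le_compat_r; [apply pow_le; apply Rlt_le, Rinv_0_lt_compat; lra|]. apply Kb.
      + unfold Rdiv. rewrite Rpow_mult_distr. ring.
    - intros t _. apply csum_ext with (fun n => a n * (/ circ 0 R t) ^ n * circ 0 R t ^ m)%C.
      + intros n; ring.
      + apply csum_scal_r, Hs. rewrite Cz; lra. }
  apply (csum_unique _ _ _ S1).
  assert (Ev : forall n, CInt (fun t => a n * ((/ circ 0 R t) ^ n * circ 0 R t ^ m))%C 0 1
     = if Nat.eq_dec n m then a m else 0%C).
  { intros n. rewrite CInt_scal; [rewrite CInt_circ_orth by lra|lra|].
    - destruct (Nat.eq_dec n m) as [->|]; ring.
    - intros t _. apply ccont_mult; apply ccont_pow; [apply ccont_inv; [apply ccont_circ|apply Nz]|apply ccont_circ]. }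
  apply csum_ext with (fun n => if Nat.eq_dec n m then a m else 0%C); [intros; symmetry; apply Ev|].
  assert (Q := csum_single (fun n => if Nat.eq_dec n m then a m else 0%C) m). cbv beta in Q.
  destruct (Nat.eq_dec m m) as [_|]; [|tauto]. apply Q.
  intros k Hk. destruct (Nat.eq_dec k m); tauto.
Qed.

(** The integral for the coefficient may be moved to any smaller circle
    outside of which [g] remains differentiable, even where the series is not
    known to converge. *)
Lemma laurent_coef_inside (g : C -> C) (a : nat -> C) (R0 s : R) : 0 < s -> 0 <= R0 ->
  (forall w, R0 < Cmod w -> csum (fun n => a n * (/ w) ^ n)%C (g w)) ->
  (forall w, s <= Cmod w -> exists l, cderiv g w l) ->
  forall n, CInt (fun t => g (circ 0 s t) * circ 0 s t ^ n)%C 0 1 = a n.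
Proof.
  intros s0 H0 Hs Hg n. set (R := Rmax R0 s + 1).
  assert (HR : R0 < R) by (unfold R; generalize (Rmax_l R0 s); lra).
  assert (HR' : s < R) by (unfold R; generalize (Rmax_r R0 s); lra).
  assert (Cg : forall w, s <= Cmod w -> ccont (U := C_UniformSpace) g w).
  { intros w Hw. destruct (Hg w Hw) as [l Hl]. apply (cderiv_cont _ _ _ Hl). }
  assert (K : forall r, 0 < r -> CInt (fun t => g (circ 0 r t) * circ 0 r t ^ n)%C 0 1
     = contour (fun w => g w * w ^ n * / w)%C 0 r).
  { intros r r0. apply CInt_ext; [lra|]. intros t _.
    assert (N : circ 0 r t <> 0%C) by (apply Cmod_pos_neq; rewrite Cmod_circ0; lra). field; auto. }
  rewrite <- (laurent_coef g a R0 R H0 HR Hs) by (intros w Hw; apply Cg; lra).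
  rewrite !K by lra. apply contour_concentric; try lra.
  intros w Hw. rewrite Rmin_left in Hw by lra. destruct (Hg w Hw) as [l Hl].
  eexists. apply cderiv_mult; [apply cderiv_mult; [exact Hl|apply cderiv_pow]|].
  apply (cderiv_inv (fun w => w)); [apply cderiv_id|]. apply Cmod_pos_neq; lra.
Qed.

(** Cauchy's estimate on the inner circle of [laurent_coef_inside]: the
    further [g] extends inwards, the smaller the coefficients. *)
Lemma laurent_coef_bound (g : C -> C) (a : nat -> C) (R0 s M : R) : 0 < s -> 0 <= R0 ->
  (forall w, R0 < Cmod w -> csum (fun n => a n * (/ w) ^ n)%C (g w)) ->
  (forall w, s <= Cmod w -> exists l, cderiv g w l) ->
  (forall w, Cmod w = s -> Cmod (g w) <= M) ->
  forall n, Cmod (a n) <= M * s ^ n.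
Proof.
  intros s0 H0 Hs Hg HM n. rewrite <- (laurent_coef_inside g a R0 s s0 H0 Hs Hg).
  replace (M * s ^ n) with (M * s ^ n * (1 - 0)) by ring. apply CInt_bound; [lra| |].
  - apply cont_on_mult.
    + apply cont_on_circ; [lra|]. intros w Hw. replace (w - 0)%C with w in Hw by ring.
      destruct (Hg w) as [l Hl]; [lra|apply (cderiv_cont _ _ _ Hl)].
    + intros t _. apply ccont_pow, ccont_circ.
  - intros t _. rewrite Cmod_mult, Cmod_pow, Cmod_circ0 by lra.
    apply Rmult_le_compat_r; [apply pow_le; lra|]. apply HM. apply Cmod_circ0; lra.
Qed.

(** * Sums of differentiable functions *)

(** Derivative and remainder are integrals of [f] against Cauchy kernels. The
    quadratic remainder, with a constant that depends only on the bound [K],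
    is what survives summation in [csum_deriv]. *)
Lemma cauchy_estimates (f : C -> C) (z0 : C) (r K : R) : 0 < r ->
  (forall w, Cmod (w - z0)%C <= r -> exists l, cderiv f w l) ->
  (forall w, Cmod (w - z0)%C = r -> Cmod (f w) <= K) ->
  Cmod (C_derive f z0) <= K / r /\
  forall z, Cmod (z - z0)%C < r / 2 ->
    Cmod (f z - f z0 - (z - z0) * C_derive f z0)%C <= 2 * K / (r * r) * (Cmod (z - z0)%C * Cmod (z - z0)%C).
Proof.
  intros r0 Hf HK.
  assert (K0 : 0 <= K).
  { eapply Rle_trans; [apply Cmod_ge_0|]. apply (HK (circ z0 r 0)). apply Cmod_circ; lra. }
  assert (Cf : forall w, Cmod (w - z0)%C = r -> ccont (U := C_UniformSpace) f w).
  { intros w Hw. destruct (Hf w) as [l Hl]; [lra|apply (cderiv_cont _ _ _ Hl)]. }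
  assert (Kc : forall a w n, Cmod (a - z0)%C < r -> Cmod (w - z0)%C = r ->
     ccont (U := C_UniformSpace) (fun w => f w * (/ (w - a)) ^ n)%C w).
  { intros a w n Ha Hw. apply ccont_mult; auto. apply ccont_pow. apply ccont_inv.
    - apply ccont_minus; [apply ccont_id|apply ccont_const].
    - apply Cmod_pos_neq. replace (w - a)%C with ((w - z0) - (a - z0))%C by ring.
      generalize (Cmod_sub_ge (w - z0) (a - z0)). lra. }
  assert (Z0 : Cmod (z0 - z0)%C < r) by (rewrite Cminus_diag, Cmod_0; auto).
  set (f1 := contour (fun w => f w * (/ (w - z0)) ^ 2)%C z0 r).
  assert (Second : forall z, Cmod (z - z0)%C < r / 2 ->
    Cmod (f z - f z0 - (z - z0) * f1)%C <= 2 * K / (r * r) * (Cmod (z - z0)%C * Cmod (z - z0)%C)).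
  { intros z Hz. assert (Hz' : Cmod (z - z0)%C < r) by lra.
    assert (Fz : forall b, Cmod (b - z0)%C < r ->
       f b = CInt (fun t => f (circ z0 r t) * (/ (circ z0 r t - b)) ^ 1 * (circ z0 r t - z0))%C 0 1).
    { intros b Hb. rewrite <- (contour_cauchy f z0 b r Hf Hb). apply CInt_ext; [lra|].
      intros t _. rewrite Cpow_1_r. auto. }
    assert (Cc : forall b n, Cmod (b - z0)%C < r ->
       cont_on (fun t => f (circ z0 r t) * (/ (circ z0 r t - b)) ^ n * (circ z0 r t - z0))%C 0 1).
    { intros b n Hb. apply (cont_on_contour (fun w => f w * (/ (w - b)) ^ n)%C); [lra|].
      intros w Hw. apply Kc; auto. }
    rewrite (Fz z Hz'), (Fz z0 Z0). unfold f1, contour.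
    rewrite <- CInt_scal by (auto; lra). rewrite <- CInt_minus by (auto; lra).
    assert (C2 : cont_on (fun t => (z - z0) * (f (circ z0 r t) * (/ (circ z0 r t - z0)) ^ 2 * (circ z0 r t - z0)))%C 0 1).
    { apply cont_on_mult; auto. intros t _; apply ccont_const. }
    rewrite <- CInt_minus; [|lra|apply cont_on_minus; auto|auto].
    set (h := Cmod (z - z0)%C) in *.
    apply Rle_trans with (2 * K / (r * r) * (h * h) * (1 - 0)); [|lra].
    apply CInt_bound; [lra|repeat apply cont_on_minus; auto|].
    intros t _. set (w := circ z0 r t). assert (Hw : Cmod (w - z0)%C = r) by (apply Cmod_circ; lra).
    assert (Hw' : r <= Cmod (w - z0)%C) by lra.
    destruct (inv_sub_bound (w - z0) (z - z0) r r0 Hw' Hz) as [N1 [N2 [I1 I2]]].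
    replace (w - z0 - (z - z0))%C with (w - z)%C in N2, I2 by ring.
    (* [1 / (w - z) - 1 / (w - z0) - (z - z0) / (w - z0)^2 = (z - z0)^2 / ((w
       - z) (w - z0)^2)], times the factor [w - z0] of [contour]. *)
    replace (f w * (/ (w - z)) ^ 1 * (w - z0) - f w * (/ (w - z0)) ^ 1 * (w - z0) -
       (z - z0) * (f w * (/ (w - z0)) ^ 2 * (w - z0)))%C
      with (f w * (/ (w - z)) * (/ (w - z0)) * ((z - z0) * (z - z0)))%C by (simpl; field; auto).
    rewrite !Cmod_mult. fold h. replace (2 * K / (r * r)) with (K * (2 / r) * / r) by (field; lra).
    assert (H0 : 0 <= h) by apply Cmod_ge_0. assert (HKw := HK w Hw).
    assert (P1 := Cmod_ge_0 (/ (w - z))%C). assert (P2 := Cmod_ge_0 (/ (w - z0))%C).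
    assert (P3 := Cmod_ge_0 (f w)).
    repeat (apply Rmult_le_compat; try apply Rle_refl; try assumption; repeat apply Rmult_le_pos; try assumption). }
  assert (D : cderiv f z0 f1).
  { apply cderiv_is_derive, eps_cderiv. intros e He.
    set (A := 2 * K / (r * r)). assert (A0 : 0 <= A).
    { apply Rmult_le_pos; [lra|]. apply Rlt_le, Rinv_0_lt_compat; nra. }
    exists (Rmin (r / 2) (e / (A + 1))). split; [apply Rmin_pos; [lra|apply Rdiv_lt_0_compat; lra]|].
    intros z Hz. assert (Hz1 := Rlt_le_trans _ _ _ Hz (Rmin_l _ _)).
    assert (Hz2 := Rlt_le_trans _ _ _ Hz (Rmin_r _ _)).
    eapply Rle_trans; [apply Second, Hz1|]. fold A. set (h := Cmod (z - z0)%C) in *.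
    assert (H0 : 0 <= h) by apply Cmod_ge_0. rewrite <- Rmult_assoc. apply Rmult_le_compat_r; auto.
    apply Rlt_div_r in Hz2; lra. }
  rewrite (cderiv_C_derive _ _ _ D). split; auto.
  replace (K / r) with (K * / r * (1 - 0)) by (unfold Rdiv; ring).
  apply CInt_bound; [lra| |].
  - apply (cont_on_contour (fun w => f w * (/ (w - z0)) ^ 2)%C); [lra|]. intros w Hw. apply Kc; auto.
  - intros t _. set (w := circ z0 r t). assert (Hw : Cmod (w - z0)%C = r) by (apply Cmod_circ; lra).
    assert (N1 : (w - z0)%C <> 0%C) by (apply Cmod_pos_neq; lra).
    replace (f w * (/ (w - z0)) ^ 2 * (w - z0))%C with (f w * / (w - z0))%C by (simpl; field; auto).
    rewrite Cmod_mult, Cmod_inv, Hw by auto. apply Rmult_le_compat_r; auto.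
    apply Rlt_le, Rinv_0_lt_compat; auto.
Qed.

(** Weierstrass's theorem: the quadratic remainders of [cauchy_estimates] for
    the single terms add up to a quadratic remainder for the sum. *)
Theorem csum_deriv (f : nat -> C -> C) (z0 : C) (r K t : R) : 0 < r -> 0 <= t < 1 ->
  (forall n w, Cmod (w - z0)%C <= r -> exists l, cderiv (f n) w l) ->
  (forall n w, Cmod (w - z0)%C <= r -> Cmod (f n w) <= K * t ^ n) ->
  csum (fun n => C_derive (f n) z0) (CSeries (fun n => C_derive (f n) z0)) /\
  cderiv (fun w => CSeries (fun n => f n w)) z0 (CSeries (fun n => C_derive (f n) z0)).
Proof.
  intros r0 Ht Hf HK.
  assert (CE := fun n => cauchy_estimates (f n) z0 r (K * t ^ n) r0 (Hf n)
     (fun w Hw => HK n w (Req_le _ _ Hw))).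
  assert (S1 : csum (fun n => C_derive (f n) z0) (CSeries (fun n => C_derive (f n) z0))).
  { apply (csum_geo t); auto. exists (K / r). intros n.
    replace (K / r * t ^ n) with (K * t ^ n / r) by (field; lra). apply CE. }
  split; auto.
  assert (S0 : forall w, Cmod (w - z0)%C <= r -> csum (fun n => f n w) (CSeries (fun n => f n w))).
  { intros w Hw. apply (csum_geo t); auto. exists K. intros n. apply HK; auto. }
  assert (Z0 : Cmod (z0 - z0)%C <= r) by (rewrite Cminus_diag, Cmod_0; lra).
  assert (K0 : 0 <= K) by (apply (geo_K_pos K t (fun n => f n z0)); intros n; apply HK; auto).
  set (A := 2 * K / (r * r) / (1 - t)).
  assert (A0 : 0 <= A).
  { unfold A, Rdiv. repeat apply Rmult_le_pos; try lra; apply Rlt_le, Rinv_0_lt_compat; nra. }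
  apply cderiv_is_derive, eps_cderiv. intros e He.
  exists (Rmin (r / 2) (e / (A + 1))). split; [apply Rmin_pos; [lra|apply Rdiv_lt_0_compat; lra]|].
  intros z Hz. assert (Hz1 := Rlt_le_trans _ _ _ Hz (Rmin_l _ _)).
  assert (Hz2 := Rlt_le_trans _ _ _ Hz (Rmin_r _ _)).
  assert (S2 := csum_minus _ _ _ _ (csum_minus _ _ _ _ (S0 z ltac:(lra)) (S0 z0 Z0)) (csum_scal (z - z0)%C _ _ S1)).
  set (h := Cmod (z - z0)%C) in *. assert (H0 : 0 <= h) by apply Cmod_ge_0.
  destruct (csum_geo_bound (2 * K / (r * r) * (h * h)) t
    (fun n => f n z - f n z0 - (z - z0) * C_derive (f n) z0)%C Ht) as [_ B].
  { intros n. eapply Rle_trans; [apply CE; exact Hz1|]. fold h. apply Req_le. field. lra. }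
  rewrite (csum_CSeries _ _ S2) in B. eapply Rle_trans; [exact B|].
  replace (2 * K / (r * r) * (h * h) / (1 - t)) with (h * (A * h)) by (unfold A; field; lra).
  rewrite Rmult_comm. apply Rmult_le_compat_r; auto. apply Rlt_div_r in Hz2; lra.
Qed.

(** ** Power series *)

Definition pser (a : nat -> C) (x : C) : C := CSeries (fun n => a n * x ^ n)%C.

Lemma pser_csum (a : nat -> C) (K t : R) (x : C) : 0 <= t ->
  (forall n, Cmod (a n) <= K * t ^ n) -> t * Cmod x < 1 ->
  csum (fun n => a n * x ^ n)%C (pser a x) /\ Cmod (pser a x) <= K / (1 - t * Cmod x).
Proof.
  intros Ht Ha Hx. assert (X0 := Cmod_ge_0 x).
  apply (csum_geo_bound K (t * Cmod x)); [nra|]. intros n.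
  rewrite Cmod_mult, Cmod_pow, Rpow_mult_distr, <- Rmult_assoc.
  apply Rmult_le_compat_r; [apply pow_le; auto|]. apply Ha.
Qed.

(** The terms stay dominated by a geometric sequence on a disc around [x] that
    is small compared with [1 - t |x|]. *)
Lemma pser_deriv (a : nat -> C) (K t : R) (x : C) : 0 <= t ->
  (forall n, Cmod (a n) <= K * t ^ n) -> t * Cmod x < 1 ->
  exists l, csum (fun n => a n * (RtoC (INR n) * x ^ (pred n)))%C l /\ cderiv (pser a) x l.
Proof.
  intros Ht Ha Hx. assert (X0 := Cmod_ge_0 x).
  set (r := (1 - t * Cmod x) / (2 * (t + 1))).
  assert (r0 : 0 < r) by (apply Rdiv_lt_0_compat; lra).
  assert (Hr : t * (Cmod x + r) < 1).
  { assert (t * r <= (1 - t * Cmod x) / 2).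
    { unfold r. replace (t * ((1 - t * Cmod x) / (2 * (t + 1)))) with ((1 - t * Cmod x) / 2 * (t / (t + 1))) by (field; lra).
      rewrite <- (Rmult_1_r ((1 - t * Cmod x) / 2)) at 2. apply Rmult_le_compat_l; [lra|].
      apply Rle_div_l; lra. }
    lra. }
  assert (D : forall n w, cderiv (fun x => a n * x ^ n)%C w (a n * (RtoC (INR n) * w ^ (pred n)))%C).
  { intros n w. apply cderiv_scal, cderiv_pow. }
  destruct (csum_deriv (fun n x => a n * x ^ n)%C x r K (t * (Cmod x + r)) r0) as [S1 S2].
  - split; [apply Rmult_le_pos; lra|auto].
  - intros n w _. eexists; apply D.
  - intros n w Hw. rewrite Cmod_mult, Cmod_pow, Rpow_mult_distr, <- Rmult_assoc.
    apply Rmult_le_compat; try apply Cmod_ge_0; auto.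
    + apply pow_le, Cmod_ge_0.
    + apply pow_incr. split; [apply Cmod_ge_0|]. generalize (Cmod_sub_ge w x). lra.
  - eexists; split; [|exact S2].
    apply csum_ext with (2 := S1). intros n. apply cderiv_C_derive, D.
Qed.

Lemma polynomial_deriv (P : C -> C) : is_polynomial P -> forall z, exists l, cderiv P z l.
Proof.
  intros [d [p Hp]] z.
  assert (D : forall d, exists l, cderiv (fun z => Csum_n (fun k => p k * z ^ k)%C d) z l).
  { clear. intros d; induction d as [|d [l IH]].
    - eexists. apply cderiv_ext with (fun z => p 0%nat * z ^ 0)%C; [intros; rewrite Csum_n_0; auto|].
      apply cderiv_scal, cderiv_pow.
    - eexists. apply cderiv_ext with (fun z => Csum_n (fun k => p k * z ^ k) d + p (S d) * z ^ (S d))%C.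
      { intros; rewrite Csum_n_S; auto. }
      apply cderiv_plus; [exact IH|]. apply cderiv_scal, cderiv_pow. }
  destruct (D d) as [l Hl]. exists l. apply cderiv_ext with (2 := Hl). intros w. symmetry. apply Hp.
Qed.

(** ** Local inverses *)

(** If [f w' - f w = q w' (w' - w)], then substituting [g z] for [w'] shows
    that [1 / q (g z)] is the difference quotient of [g]; it is continuous
    because [g] is. *)
Lemma cderiv_inverse (f g : C -> C) (w l : C) : cderiv f w l -> l <> 0%C ->
  ccont (U := C_UniformSpace) g (f w) -> g (f w) = w ->
  locally (f w) (fun z => f (g z) = z) -> cderiv g (f w) (/ l)%C.
Proof.
  intros [q [Q1 [Q2 Q3]]] Nl Cg Gw Hl.
  exists (fun z => if excluded_middle_informative (z = f w) then / l else (g z - w) / (z - f w))%C.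
  split; [|split].
  - intros z. rewrite Gw. dem E0; [rewrite E0, Gw; ring|]. field.
    intros E1. apply E0. replace z with ((z - f w) + f w)%C by ring. rewrite E1; ring.
  - dem E0; tauto.
  - assert (Cq : ccont (U := C_UniformSpace) (fun z => / q (g z))%C (f w)).
    { apply ccont_inv; [|rewrite Gw, Q2; auto].
      apply (ccont_comp (U := C_UniformSpace) q g); auto. rewrite Gw; auto. }
    revert Cq. apply ccont_ext_loc.
    assert (Nq : locally (f w) (fun z => Cmod (q (g (f w))) / 2 < Cmod (q (g z)))).
    { apply (ccont_away (U := C_UniformSpace) (fun z => q (g z))).
      - apply (ccont_comp (U := C_UniformSpace) q g); auto. rewrite Gw; auto.
      - rewrite Gw, Q2; auto. }
    generalize (filter_and _ _ Hl Nq). apply filter_imp. intros z [Hz Nz].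
    dem E0; [rewrite E0, Gw, Q2; auto|].
    assert (Nz' : q (g z) <> 0%C).
    { apply Cmod_pos_neq. eapply Rle_lt_trans; [|exact Nz]. generalize (Cmod_ge_0 (q (g (f w)))); lra. }
    assert (E1 := Q1 (g z)). rewrite Hz in E1. rewrite E1. field. split; auto.
    intros E2. apply E0. replace z with ((z - f w) + f w)%C by ring. rewrite E1, E2. ring.
Qed.

(** * Real parts of differentiable functions are harmonic *)

Lemma Cmod_horizontal x t y : Cmod ((t, y) - (x, y))%C = Rabs (t - x).
Proof.
  replace ((t, y) - (x, y))%C with (RtoC (t - x)); [apply Cmod_R|].
  unfold Cminus, Cplus, Copp, RtoC; cbn [fst snd]. f_equal; ring.
Qed.

Lemma Cmod_vertical x t y : Cmod ((x, t) - (x, y))%C = Rabs (t - y).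
Proof.
  replace ((x, t) - (x, y))%C with (Ci * RtoC (t - y))%C.
  - rewrite Cmod_mult, Cmod_Ci, Cmod_R. ring.
  - unfold Cminus, Cplus, Copp, RtoC, Cmult, Ci; cbn [fst snd]. f_equal; ring.
Qed.

Lemma locally_horizontal (P : C -> Prop) x y : locally (T := C_UniformSpace) ((x, y) : C) P -> locally x (fun t => P (t, y)).
Proof.
  intros H. apply locally_Cmod in H. destruct H as [d [d0 Hd]]. apply locally_R.
  exists d; split; auto. intros t Ht. apply Hd. rewrite Cmod_horizontal. exact Ht.
Qed.

Lemma locally_vertical (P : C -> Prop) x y : locally (T := C_UniformSpace) ((x, y) : C) P -> locally y (fun t => P (x, t)).
Proof.
  intros H. apply locally_Cmod in H. destruct H as [d [d0 Hd]]. apply locally_R.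
  exists d; split; auto. intros t Ht. apply Hd. rewrite Cmod_vertical. exact Ht.
Qed.

Lemma rderiv_horizontal x y : rderiv (fun t => (t, y)) x 1%C.
Proof. apply rderiv_parts; cbn [fst snd RtoC]; auto_derive; auto. Qed.

Lemma rderiv_vertical x y : rderiv (fun t => (x, t)) y Ci.
Proof. apply rderiv_parts; cbn [fst snd Ci]; auto_derive; auto. Qed.

Lemma cderiv_dx (g : C -> C) x y l : cderiv g (x, y) l -> is_derive (fun t => fst (g (t, y))) x (fst l).
Proof.
  intros H. replace l with (l * 1)%C by ring.
  apply (rderiv_fst (fun t => g (t, y))). apply (rderiv_comp g (fun t => (t, y))); auto.
  apply rderiv_horizontal.
Qed.

Lemma cderiv_dy (g : C -> C) x y l : cderiv g (x, y) l ->
  is_derive (fun t => fst (g (x, t))) y (fst (Ci * l)%C).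
Proof.
  intros H. rewrite Cmult_comm.
  apply (rderiv_fst (fun t => g (x, t))). apply (rderiv_comp g (fun t => (x, t))); auto.
  apply rderiv_vertical.
Qed.

Lemma holo_i_deriv (U : C -> Prop) g : open U -> holo U g -> holo U (fun z => Ci * C_derive g z)%C.
Proof. intros HU Hg. apply holo_mult; [apply holo_const|]. apply holo_derive; auto. Qed.

Lemma open_locally (U : C -> Prop) (z : C) (P : C -> Prop) : open U -> U z -> (forall w, U w -> P w) ->
  locally (T := C_UniformSpace) z P.
Proof. intros HU Hz HP. generalize (HU z Hz). apply filter_imp. exact HP. Qed.

Lemma Re_Derive_x (U : C -> Prop) g x y : holo U g -> U (x, y) ->
  Derive (fun t => fst (g (t, y))) x = fst (C_derive g (x, y)).
Proof. intros Hg Hz. apply is_derive_unique, cderiv_dx, (holo_deriv U); auto. Qed.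

Lemma Re_Derive_y (U : C -> Prop) g x y : holo U g -> U (x, y) ->
  Derive (fun t => fst (g (x, t))) y = fst (Ci * C_derive g (x, y))%C.
Proof. intros Hg Hz. apply is_derive_unique, cderiv_dy, (holo_deriv U); auto. Qed.

Lemma Re_continuity_2d (U : C -> Prop) g x y : holo U g -> U (x, y) ->
  continuity_2d_pt (fun x y => fst (g (x, y))) x y.
Proof.
  intros Hg Hz e. apply locally_2d_locally.
  assert (H := holo_cont U g _ Hg Hz). specialize (H e (cond_pos e)).
  revert H. apply filter_imp. intros [u v] H. cbn [fst snd] in *.
  eapply Rle_lt_trans; [|exact H]. apply (Re_le_Cmod (g (u, v) - g (x, y))).
Qed.

(** The partial derivatives of [Re g] are [Re g'] and [Re (i g')], which are
    real parts of differentiable functions by [holo_derive]. *)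
Lemma Re_ex_diff_n (U : C -> Prop) n : open U -> forall g, holo U g -> forall x y, U (x, y) ->
  ex_diff_n (fun x y => fst (g (x, y))) n x y.
Proof.
  intros HU. induction n; intros g Hg x y Hz.
  - split; auto. apply (Re_continuity_2d U); auto.
  - assert (D := holo_deriv U g _ Hg Hz).
    split; [apply (Re_continuity_2d U); auto|]. split; [eexists; apply cderiv_dx; exact D|].
    split; [eexists; apply cderiv_dy; exact D|]. split.
    + apply ex_diff_n_ext_loc with (fun x y => fst (C_derive g (x, y))).
      * apply locally_2d_locally. apply (open_locally U); auto. intros [u v] Hw. cbn [fst snd].
        symmetry. apply (Re_Derive_x U); auto.
      * apply IHn; auto. apply holo_derive; auto.
    + apply ex_diff_n_ext_loc with (fun x y => fst (Ci * C_derive g (x, y))%C).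
      * apply locally_2d_locally. apply (open_locally U); auto. intros [u v] Hw. cbn [fst snd].
        symmetry. apply (Re_Derive_y U); auto.
      * apply (IHn (fun z => Ci * C_derive g z)%C); auto. apply holo_i_deriv; auto.
Qed.

Section RealPart.
Context (U : C -> Prop) (g : C -> C) (u : C -> R) (HU : open U) (Hg : holo U g)
  (Hu : forall z, U z -> u z = fst (g z)).

Lemma Re_partial_10 z : U z -> partial 1 0 u z = fst (C_derive g z).
Proof.
  destruct z as [x y]. intros Hz. unfold partial, partial_derive; cbn [fst snd].
  change (Derive (fun t => u (t, y)) x = fst (C_derive g (x, y))).
  rewrite <- (Re_Derive_x U); auto. apply Derive_ext_loc.
  apply (locally_horizontal (fun w => u w = fst (g w))). apply (open_locally U); auto.
Qed.

Lemma Re_partial_01 z : U z -> partial 0 1 u z = fst (Ci * C_derive g z)%C.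
Proof.
  destruct z as [x y]. intros Hz. unfold partial, partial_derive; cbn [fst snd].
  change (Derive (fun t => u (x, t)) y = fst (Ci * C_derive g (x, y))%C).
  rewrite <- (Re_Derive_y U); auto. apply Derive_ext_loc.
  apply (locally_vertical (fun w => u w = fst (g w))). apply (open_locally U); auto.
Qed.

(** The two second derivatives are [Re g''] and [Re (i (i g'')) = - Re g'']. *)
Lemma Re_harmonic z : U z -> harmonic_at u z.
Proof.
  intros Hz. split.
  - destruct z as [x y]; cbn [fst snd].
    apply ex_diff_n_ext_loc with (fun x y => fst (g (x, y))).
    + apply locally_2d_locally. apply (open_locally U); auto. intros [a b] Hw. cbn [fst snd].
      symmetry; auto.
    + apply (Re_ex_diff_n U); auto.
  - destruct z as [x y]. unfold partial, partial_derive; cbn [fst snd].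
    change (Derive (fun t => Derive (fun s => u (s, y)) t) x
      + Derive (fun t => Derive (fun s => u (x, s)) t) y = 0).
    assert (H1 := holo_derive U g HU Hg). assert (H2 := holo_i_deriv U g HU Hg).
    rewrite (Derive_ext_loc (fun t => Derive (fun s => u (s, y)) t) (fun t => fst (C_derive g (t, y)))).
    + rewrite (Derive_ext_loc (fun t => Derive (fun s => u (x, s)) t) (fun t => fst (Ci * C_derive g (x, t))%C)).
      * transitivity (fst (C_derive (C_derive g) (x, y)) + fst (Ci * C_derive (fun z => Ci * C_derive g z) (x, y))%C).
        { f_equal; [apply (Re_Derive_x U _ x y H1 Hz)|apply (Re_Derive_y U _ x y H2 Hz)]. }
        assert (D := cderiv_scal Ci _ _ _ (holo_deriv U _ _ H1 Hz)).
        rewrite (cderiv_C_derive _ _ _ D).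
        unfold Cmult, Ci; cbn [fst snd]. ring.
      * apply (locally_vertical (fun w => Derive (fun s => u (fst w, s)) (snd w) = fst (Ci * C_derive g w)%C)).
        apply (open_locally U); auto. intros [a b] Hw. apply (Re_partial_01 (a, b) Hw).
    + apply (locally_horizontal (fun w => Derive (fun s => u (s, snd w)) (fst w) = fst (C_derive g w))).
      apply (open_locally U); auto. intros [a b] Hw. apply (Re_partial_10 (a, b) Hw).
Qed.

Lemma Re_directional (nu z : C) : U z -> directional_derivative u nu z = fst (nu * C_derive g z)%C.
Proof.
  intros Hz. unfold directional_derivative. rewrite Re_partial_10, Re_partial_01 by auto.
  unfold Cmult, Ci; cbn [fst snd]. ring.
Qed.
End RealPart.

(** * The exterior map *)

Lemma open_Cmod_gt (r : R) : open (T := C_UniformSpace) (fun w : C => r < Cmod w).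
Proof.
  intros w Hw. apply locally_Cmod. exists (Cmod w - r). split; [lra|].
  intros v Hv. rewrite Cmod_sub_comm in Hv. generalize (Cmod_sub_ge w v). lra.
Qed.

Lemma open_Cmod_lt (r : R) : open (T := C_UniformSpace) (fun w : C => Cmod w < r).
Proof.
  intros w Hw. apply locally_Cmod. exists (r - Cmod w). split; [lra|].
  intros v Hv. generalize (Cmod_sub_ge v w). lra.
Qed.

Section Exterior.
Context (Omega0 : C -> Prop) (gamma : R) (Psi : C -> C) (a : nat -> C).
Context (HPsi : exterior_conformal_map Omega0 gamma Psi a).

Lemma gamma_pos : 0 < gamma.
Proof. apply HPsi. Qed.

Lemma ext_iff z : ~ closure Omega0 z <-> exists w, gamma < Cmod w /\ z = Psi w.
Proof. apply HPsi. Qed.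

Lemma Psi_csum w : gamma < Cmod w -> csum (fun n => a n * (/ w) ^ n)%C (Psi w - w)%C.
Proof. apply HPsi. Qed.

(** Restricting the extension to an exterior of a circle of positive radius
    keeps [w = 0] out of its domain. *)
Lemma Psi_extension : exists rho, 0 < rho /\ rho < gamma /\
  holo (fun w => rho < Cmod w) Psi /\
  forall w1 w2, rho < Cmod w1 -> rho < Cmod w2 -> Psi w1 = Psi w2 -> w1 = w2.
Proof.
  destruct HPsi as [g0 [_ [_ [[d [d0 [D1 D2]]] _]]]].
  exists (Rmax (gamma - d) (gamma / 2)).
  assert (M1 := Rmax_l (gamma - d) (gamma / 2)). assert (M2 := Rmax_r (gamma - d) (gamma / 2)).
  split; [lra|]. split; [apply Rmax_lub_lt; lra|]. split.
  - intros w Hw. destruct (D1 w) as [l Hl]; [lra|]. exists l. apply is_derive_cderiv, Hl.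
  - intros w1 w2 H1 H2. apply D2; lra.
Qed.

Lemma Psi_inj_ext w1 w2 : gamma <= Cmod w1 -> gamma <= Cmod w2 -> Psi w1 = Psi w2 -> w1 = w2.
Proof. destruct Psi_extension as [rho [_ [H1 [_ H2]]]]. intros A B. apply H2; lra. Qed.

Lemma Psi_holo : holo (fun w => gamma <= Cmod w) Psi.
Proof.
  destruct Psi_extension as [rho [_ [H1 [H2 _]]]]. apply holo_sub with (2 := H2). intros z Hz; lra.
Qed.

Lemma Psi_deriv w : gamma <= Cmod w -> cderiv Psi w (C_derive Psi w).
Proof. apply (holo_deriv _ _ _ Psi_holo). Qed.

Lemma Psi_cont w : gamma <= Cmod w -> ccont (U := C_UniformSpace) Psi w.
Proof. apply (holo_cont _ _ _ Psi_holo). Qed.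

Lemma Psi_derive_holo : holo (fun w => gamma <= Cmod w) (C_derive Psi).
Proof.
  destruct Psi_extension as [rho [_ [H1 [H2 _]]]].
  apply holo_sub with (2 := holo_derive _ _ (open_Cmod_gt rho) H2). intros z Hz; lra.
Qed.

(** By injectivity such points cannot be among the values of [Psi] on
    [|w| > gamma], which fill the complement of the closed core. *)
Lemma Psi_inside rho z : rho < gamma ->
  (forall w1 w2, rho < Cmod w1 -> rho < Cmod w2 -> Psi w1 = Psi w2 -> w1 = w2) ->
  rho < Cmod z -> Cmod z <= gamma -> closure Omega0 (Psi z).
Proof.
  intros Hr Hi H1 H2. apply NNPP. intros N. apply ext_iff in N. destruct N as [w [W1 W2]].
  apply Hi in W2; try lra. subst z. lra.
Qed.

Lemma closure_or_ext z : closure Omega0 z \/ exists w, gamma < Cmod w /\ z = Psi w.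
Proof. destruct (classic (closure Omega0 z)); auto. right. apply ext_iff; auto. Qed.

Lemma ext_not_closure w : gamma < Cmod w -> ~ closure Omega0 (Psi w).
Proof. intros H. apply ext_iff. exists w; auto. Qed.

Lemma ext_open : open (T := C_UniformSpace) (fun z => ~ closure Omega0 z).
Proof.
  intros z Hz. apply NNPP in Hz. apply locally_Cmod in Hz. destruct Hz as [d [d0 Hd]].
  apply locally_Cmod. exists (d / 2). split; [lra|]. intros w Hw Hc.
  destruct (proj1 (closure_Cmod _ _) Hc (d / 2)) as [v [V1 V2]]; [lra|].
  apply (Hd v); auto. eapply Rle_lt_trans; [apply (Cmod_sub_triangle v w z)|]. lra.
Qed.

(** Convergence at a single radius, here [gamma + 1], bounds the coefficients
    geometrically. *)
Lemma a_bound : exists K t, 0 < t /\ forall n, Cmod (a n) <= K * t ^ n.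
Proof.
  assert (g0 := gamma_pos). set (t := gamma + 1).
  assert (Nt : RtoC t <> 0%C) by (intros H; apply RtoC_inj in H; unfold t in H; lra).
  destruct (csum_bounded _ _ (Psi_csum (RtoC t) ltac:(rewrite Cmod_RtoC_pos; unfold t; lra))) as [K HK].
  exists K, t. split; [unfold t; lra|]. intros n. specialize (HK n).
  rewrite Cmod_mult, Cmod_pow, Cmod_inv, Cmod_RtoC_pos in HK by (auto; unfold t; lra).
  rewrite pow_inv in HK. assert (P : 0 < t ^ n) by (apply pow_lt; unfold t; lra).
  apply Rmult_le_reg_r with (/ t ^ n); [apply Rinv_0_lt_compat; auto|].
  rewrite Rmult_assoc, Rinv_r by lra. lra.
Qed.

(** For [|w| > 2 t], with [t] from [a_bound], the series of [Psi w - w] is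
    dominated by [2^(-n)]. *)
Lemma Psi_growth : exists B R0, gamma < R0 /\ 0 <= B /\ forall w, R0 < Cmod w -> Cmod (Psi w - w)%C <= B.
Proof.
  assert (g0 := gamma_pos). destruct a_bound as [K [t [t0 HK]]].
  exists (K / (1 - 1 / 2)), (gamma + 2 * t). split; [lra|]. split.
  { apply geo_K_pos in HK. apply Rmult_le_pos; auto. apply Rlt_le, Rinv_0_lt_compat; lra. }
  intros w Hw. assert (Nw : w <> 0%C) by (apply Cmod_pos_neq; lra).
  rewrite <- (csum_CSeries _ _ (Psi_csum w ltac:(lra))).
  apply (csum_geo_bound K (1 / 2)); [lra|]. intros n.
  rewrite Cmod_mult, Cmod_pow, Cmod_inv by auto.
  assert (Q : / Cmod w <= / t * (1 / 2)).
  { replace (/ t * (1 / 2)) with (/ (2 * t)) by (field; lra). apply Rinv_le_contravar; lra. }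
  assert (Q0 : 0 < / Cmod w) by (apply Rinv_0_lt_compat; lra).
  assert (T0 : 0 < t ^ n) by (apply pow_lt; auto).
  assert (K0 := geo_K_pos _ _ _ HK).
  apply Rle_trans with (K * t ^ n * (/ t * (1 / 2)) ^ n).
  - apply Rmult_le_compat; auto; [apply Cmod_ge_0|apply pow_le; lra|apply pow_incr; lra].
  - rewrite Rpow_mult_distr, pow_inv. apply Req_le. field. lra.
Qed.

(** Outside of a large disc [Psi w] is far from [Psi w0] by [Psi_growth]. On
    the disc, compactness applied to the injective function [Psi] on
    [|w| >= gamma] bounds [|Psi w - Psi w0|] from below on the set
    [|w - w0| >= e]. *)
Lemma Psi_inverse_cont w0 e : gamma <= Cmod w0 -> 0 < e ->
  exists d, 0 < d /\ forall w, gamma <= Cmod w -> Cmod (Psi w - Psi w0)%C < d -> Cmod (w - w0)%C < e.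
Proof.
  intros H0 He. assert (g0 := gamma_pos). destruct Psi_growth as [B [R0 [HR [HB Hg]]]].
  (* If [|w| > M] then [|Psi w - Psi w0| >= |w| - B - |Psi w0| > 1]. *)
  set (M := R0 + B + Cmod (Psi w0) + 1).
  destruct (local_uniform (fun w d => gamma <= Cmod w -> e <= Cmod (w - w0)%C -> d <= Cmod (Psi w - Psi w0)%C))
    with (M := M) as [d [d0 Hd]].
  - intros w d d' H _ Hd W1 W2. eapply Rle_trans; [exact Hd|]. auto.
  - intros p. destruct (Rlt_le_dec (Cmod p) gamma) as [L|L].
    { exists (gamma - Cmod p). split; [lra|]. intros w Hw W1 _. exfalso.
      generalize (Cmod_sub_ge w p). lra. }
    destruct (classic (p = w0)) as [->|N].
    { exists e. split; auto. intros w Hw _ W2. lra. }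
    assert (NP : 0 < Cmod (Psi p - Psi w0)%C).
    { apply Cmod_gt_0. intros E0. apply N. apply Psi_inj_ext; auto. apply Ceq_minus; auto. }
    set (q := Cmod (Psi p - Psi w0)%C) in *.
    destruct (proj1 (ccont_C _ _) (Psi_cont p L) (q / 2)) as [d [d0 Hd]]; [lra|].
    exists (Rmin d (q / 2)). split; [apply Rmin_pos; lra|]. intros w Hw _ _.
    specialize (Hd w (Rlt_le_trans _ _ _ Hw (Rmin_l _ _))).
    assert (T := Cmod_sub_triangle (Psi p) (Psi w) (Psi w0)). fold q in T.
    rewrite (Cmod_sub_comm (Psi p)) in T. generalize (Rmin_r d (q / 2)). lra.
  - exists (Rmin d 1). split; [apply Rmin_pos; lra|]. intros w W1 W2.
    destruct (Rlt_le_dec M (Cmod w)) as [L|L].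
    + exfalso. assert (A1 := Cmod_ge_0 (Psi w0)).
      assert (A2 := Hg w ltac:(unfold M in L; lra)).
      assert (A3 := Cmod_sub_triangle w (Psi w) (Psi w0)). rewrite (Cmod_sub_comm w (Psi w)) in A3.
      assert (A4 := Cmod_sub_ge w (Psi w0)). generalize (Rmin_r d 1). unfold M in L. lra.
    + apply Rnot_le_lt. intros N. specialize (Hd w L W1 N).
      generalize (Rmin_l d 1). lra.
Qed.

Definition PsiInv (z : C) : C := epsilon (inhabits (RtoC 0)) (fun w => gamma < Cmod w /\ z = Psi w).

Lemma PsiInv_Psi w : gamma < Cmod w -> PsiInv (Psi w) = w.
Proof.
  intros H. unfold PsiInv.
  destruct (epsilon_spec (inhabits (RtoC 0)) (fun v => gamma < Cmod v /\ Psi w = Psi v)) as [H1 H2].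
  { exists w; auto. }
  apply Psi_inj_ext; auto; lra.
Qed.

Lemma PsiInv_limit w0 e : gamma <= Cmod w0 -> 0 < e -> exists d, 0 < d /\
  forall z, ~ closure Omega0 z -> Cmod (z - Psi w0)%C < d ->
    gamma < Cmod (PsiInv z) /\ Psi (PsiInv z) = z /\ Cmod (PsiInv z - w0)%C < e.
Proof.
  intros H He. destruct (Psi_inverse_cont w0 e H He) as [d [d0 Hd]]. exists d; split; auto.
  intros z Hz Hzd. apply ext_iff in Hz. destruct Hz as [w [W1 ->]].
  rewrite PsiInv_Psi by auto. repeat split; auto. apply Hd; auto. lra.
Qed.
End Exterior.

(** * Faber polynomials and Grunsky coefficients *)

(** Used to carry identities from [|w| > gamma] over to the circle
    [|w| = gamma], and from [x <> 0] to [x = 0]. *)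
Lemma cont_zero (h : C -> C) (p : C) : ccont (U := C_UniformSpace) h p ->
  (forall d, 0 < d -> exists v, Cmod (v - p)%C < d /\ h v = 0%C) -> h p = 0%C.
Proof.
  intros H Hv. apply Cmod_small_0. intros e He.
  destruct (proj1 (ccont_C _ _) H e He) as [d [d0 Hd]]. destruct (Hv d d0) as [v [V1 V2]].
  specialize (Hd v V1). rewrite V2, Cmod_sub_comm in Hd.
  replace (h p - 0)%C with (h p) in Hd by ring. lra.
Qed.

Lemma radial_point (w : C) (d : R) : 0 < Cmod w -> 0 < d ->
  exists v, Cmod w < Cmod v /\ Cmod (v - w)%C < d.
Proof.
  intros Hw Hd. set (k := d / (2 * Cmod w)).
  assert (k0 : 0 < k) by (apply Rdiv_lt_0_compat; lra).
  exists (RtoC (1 + k) * w)%C. split.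
  - rewrite Cmod_mult, Cmod_RtoC_pos by lra. nra.
  - replace (RtoC (1 + k) * w - w)%C with (RtoC k * w)%C by (rewrite RtoC_plus; ring).
    rewrite Cmod_mult, Cmod_RtoC_pos by lra. unfold k.
    replace (d / (2 * Cmod w) * Cmod w) with (d / 2) by (field; lra). lra.
Qed.

Lemma pser_0 (b : nat -> C) : pser b 0%C = b 0%nat.
Proof.
  apply csum_CSeries. replace (b 0%nat) with (b 0%nat * 0 ^ 0)%C by (simpl; ring).
  apply (csum_single (fun n => b n * 0 ^ n)%C). intros k Hk. destruct k; [lia|]. simpl; ring.
Qed.

Lemma lt_inv_mult (r x : R) : 0 < r -> x < / r -> r * x < 1.
Proof. intros Hr Hx. rewrite <- (Rinv_r r) by lra. apply Rmult_lt_compat_l; auto. Qed.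

Section Faber.
Context (Omega0 : C -> Prop) (gamma : R) (Psi : C -> C) (a : nat -> C).
Context (HPsi : exterior_conformal_map Omega0 gamma Psi a).
Context (F : nat -> C -> C) (HF : faber_polynomials Omega0 gamma Psi F).
Context (c : mat) (Hc : grunsky_matrix gamma Psi F c).

(** The generating function of the Faber polynomials. *)
Definition kernel (z w : C) : C := (w * C_derive Psi w / (Psi w - z))%C.

Lemma faber_csum z w : closure Omega0 z -> gamma < Cmod w ->
  csum (fun m => F m z * (/ w) ^ m)%C (kernel z w).
Proof. intros Hz Hw. apply HF; auto. Qed.

Lemma faber_deriv m z : exists l, cderiv (F m) z l.
Proof. apply polynomial_deriv, HF. Qed.

(** [F_m z] is a Laurent coefficient of [kernel z], which is differentiable on
    [|w| >= s] as long as [Psi] does not take the value [z] there. By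
    compactness of the circle [|w| = s] the denominators [Psi w - z] are
    bounded below uniformly in [z], and [laurent_coef_bound] applies. *)
Lemma faber_bound_gen (S : C -> Prop) (rho s : R) : 0 < rho -> rho < s ->
  holo (fun w => rho < Cmod w) Psi -> (forall z, S z -> closure Omega0 z) ->
  (forall w, Cmod w = s -> exists d, 0 < d /\ forall z, S z -> d <= Cmod (Psi w - z)%C) ->
  (forall z w, S z -> s <= Cmod w -> Psi w <> z) ->
  exists K, 0 <= K /\ forall m z, S z -> Cmod (F m z) <= K * s ^ m.
Proof.
  intros r0 rs HP HS Hd HN.
  assert (HP' := holo_derive _ _ (open_Cmod_gt rho) HP).
  destruct (circle_separated Psi s S) as [d [d0 Hsep]]; auto.
  { intros w Hw. apply (holo_cont _ _ _ HP). lra. }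
  destruct (circle_bounded (fun w => w * C_derive Psi w)%C 0%C s) as [K [K0 HK]].
  { intros w Hw. replace (w - 0)%C with w in Hw by ring. apply ccont_mult; [apply ccont_id|].
    apply (holo_cont _ _ _ HP'). lra. }
  exists (K / d). split; [apply Rlt_le, Rdiv_lt_0_compat; auto|]. intros m z Hz.
  apply (laurent_coef_bound (kernel z) (fun m => F m z) gamma s); try lra.
  - apply Rlt_le, (gamma_pos _ _ _ _ HPsi).
  - intros w Hw. apply faber_csum; auto.
  - intros w Hw. destruct (HP w) as [l1 H1]; [lra|]. destruct (HP' w) as [l2 H2]; [lra|].
    eexists. apply cderiv_mult; [apply cderiv_mult; [apply cderiv_id|exact H2]|].
    apply cderiv_inv; [apply cderiv_minus; [exact H1|apply cderiv_const]|].
    intros E0. apply (HN z w Hz Hw). apply Ceq_minus, E0.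
  - intros w Hw. unfold kernel.
    assert (D := Hsep w z Hw Hz).
    rewrite Cmod_div by (apply Cmod_pos_neq; lra).
    apply Rmult_le_compat; [apply Cmod_ge_0|apply Rlt_le, Rinv_0_lt_compat; lra| |].
    + apply HK. rewrite <- Hw. f_equal. ring.
    + apply Rinv_le_contravar; auto.
Qed.

(** On the closed core one may take any [s > gamma]. *)
Lemma faber_closure_bound (g1 : R) : gamma < g1 ->
  exists K, 0 <= K /\ forall m z, closure Omega0 z -> Cmod (F m z) <= K * g1 ^ m.
Proof.
  intros H1. destruct (Psi_extension _ _ _ _ HPsi) as [rho [R0 [R1 [HP _]]]].
  apply (faber_bound_gen (closure Omega0) rho g1); auto; try lra.
  - intros w Hw. assert (N : ~ closure Omega0 (Psi w)).
    { apply (ext_not_closure _ _ _ _ HPsi). lra. }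
    assert (L := ext_open Omega0 _ N). apply locally_Cmod in L. destruct L as [d [d0 Hd]].
    exists d; split; auto. intros z Hz. apply Rnot_lt_le. intros Hlt.
    apply (Hd z); auto. rewrite Cmod_sub_comm; auto.
  - intros z w Hz Hw E0. subst z. revert Hz. apply (ext_not_closure _ _ _ _ HPsi). lra.
Qed.

(** On the image of [|w| = rho] the values [F_m (Psi w)] grow more slowly than
    [gamma ^ m]: these points are taken by the extension of [Psi] only on the
    circle [|w| = rho] itself, so that their kernels extend inwards to
    [|w| >= th] for any [th > rho]. *)
Lemma faber_circle_bound : exists rho th K, 0 < rho /\ rho < th /\ th < gamma /\ 0 <= K /\
  holo (fun w => rho <= Cmod w) Psi /\
  (forall w1 w2, rho <= Cmod w1 -> rho <= Cmod w2 -> Psi w1 = Psi w2 -> w1 = w2) /\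
  (forall w, Cmod w = rho -> closure Omega0 (Psi w)) /\
  (forall m w, Cmod w = rho -> Cmod (F m (Psi w)) <= K * th ^ m).
Proof.
  destruct (Psi_extension _ _ _ _ HPsi) as [r0 [R0 [R1 [HP HI]]]].
  (* [Psi] extends to [|w| > r0], and [r0 < rho < th < gamma] are equally
     spaced. *)
  set (rho := (2 * r0 + gamma) / 3). set (th := (r0 + 2 * gamma) / 3).
  assert (A : r0 < rho < th /\ th < gamma) by (unfold rho, th; lra).
  assert (HCl : forall w, Cmod w = rho -> closure Omega0 (Psi w)).
  { intros w Hw. apply (Psi_inside _ _ _ _ HPsi r0); auto; lra. }
  destruct (faber_bound_gen (fun z => exists v, Cmod v = rho /\ z = Psi v) r0 th) as [K [K0 HK]]; auto; try lra.
  - intros z [v [V1 ->]]; auto.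
  - intros w Hw. destruct (circle_separated Psi rho (fun z => z = Psi w)) as [d [d0 Hd]].
    + intros v Hv. apply (holo_cont _ _ _ HP). lra.
    + intros v Hv. exists (Cmod (Psi v - Psi w)%C). split.
      * apply Cmod_gt_0. intros E0. apply Ceq_minus, HI in E0; try lra. subst v; lra.
      * intros z ->; lra.
    + exists d; split; auto. intros z [v [V1 ->]]. rewrite Cmod_sub_comm. apply Hd; auto.
  - intros z w [v [V1 ->]] Hw E0. apply HI in E0; try lra. subst v; lra.
  - exists rho, th, K. repeat split; auto; try lra.
    + apply holo_sub with (2 := HP). intros z Hz; lra.
    + intros w1 w2 H1 H2. apply HI; lra.
    + intros m w Hw. apply HK. exists w; auto.
Qed.

Lemma grunsky_csum m w : (1 <= m)%nat -> gamma < Cmod w ->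
  csum (fun n => (if Nat.eq_dec n 0 then 0%C else c m n) * (/ w) ^ n)%C (F m (Psi w) - w ^ m)%C.
Proof.
  intros Hm Hw. apply (proj2 (csum_shift _ _)). simpl Nat.eq_dec. cbv iota beta.
  replace (F m (Psi w) - w ^ m - 0%R * (/ w) ^ 0)%C with (F m (Psi w) - w ^ m)%C by ring.
  apply Hc; auto.
Qed.

(** [F_m (Psi w) - w^m] is differentiable for [|w| >= rho], and of size
    [K th^m + rho^m] on [|w| = rho]: Cauchy's estimate gives the decay of
    [c m n] in [n] and in [m]. Its constant coefficient vanishes, so the mean
    of [F_m] over the image of [|w| = rho] is [0] for [m >= 1]. *)
Lemma grunsky_bound : exists rho th K, 0 < rho /\ rho < th /\ th < gamma /\ 0 <= K /\
  holo (fun w => rho <= Cmod w) Psi /\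
  (forall w1 w2, rho <= Cmod w1 -> rho <= Cmod w2 -> Psi w1 = Psi w2 -> w1 = w2) /\
  (forall w, Cmod w = rho -> closure Omega0 (Psi w)) /\
  (forall m w, Cmod w = rho -> Cmod (F m (Psi w)) <= K * th ^ m) /\
  (forall m n, (1 <= m)%nat -> (1 <= n)%nat -> Cmod (c m n) <= K * th ^ m * th ^ n) /\
  (forall m, (1 <= m)%nat -> CInt (fun t => F m (Psi (circ 0 rho t))) 0 1 = 0%C).
Proof.
  destruct faber_circle_bound as [rho [th [K [R0 [R1 [R2 [K0 [HP [HI [HCl HK]]]]]]]]]].
  assert (g0 := gamma_pos _ _ _ _ HPsi).
  assert (Hg : forall m w, rho <= Cmod w -> exists l, cderiv (fun w => F m (Psi w) - w ^ m)%C w l).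
  { intros m w Hw. destruct (HP w Hw) as [l Hl]. destruct (faber_deriv m (Psi w)) as [l' Hl'].
    eexists. apply cderiv_minus; [apply (cderiv_comp (F m) Psi); eassumption|apply cderiv_pow]. }
  exists rho, th, (K + 1). repeat split; auto; try lra.
  - intros m w Hw. eapply Rle_trans; [apply HK; auto|]. apply Rmult_le_compat_r; [apply pow_le; lra|lra].
  - intros m n Hm Hn.
    assert (B := laurent_coef_bound _ _ gamma rho ((K + 1) * th ^ m) R0 (Rlt_le _ _ g0)
       (fun w Hw => grunsky_csum m w Hm Hw) (Hg m)).
    cbv beta in B. eapply Rle_trans; [|eapply Rle_trans; [apply (B) with (n := n)|]].
    + destruct (Nat.eq_dec n 0); [lia|lra].
    + intros w Hw. eapply Rle_trans; [apply Cmod_sub_le|].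
      rewrite Cmod_pow, Hw. rewrite Rmult_plus_distr_r, Rmult_1_l. apply Rplus_le_compat; auto.
      apply pow_incr; lra.
    + apply Rmult_le_compat_l; [apply Rmult_le_pos; [lra|apply pow_le; lra]|]. apply pow_incr; lra.
  - intros m Hm.
    assert (I := laurent_coef_inside _ _ gamma rho R0 (Rlt_le _ _ g0)
       (fun w Hw => grunsky_csum m w Hm Hw) (Hg m) 0%nat).
    cbv beta in I. destruct (Nat.eq_dec 0 0) as [_|]; [|tauto].
    assert (O := CInt_circ_orth rho m 0 R0). destruct (Nat.eq_dec 0 m) as [|_]; [lia|].
    assert (C1 : cont_on (fun t => F m (Psi (circ 0 rho t)) - circ 0 rho t ^ m)%C 0 1).
    { apply (cont_on_circ (fun w => F m (Psi w) - w ^ m)%C); [lra|]. intros w Hw.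
      replace (w - 0)%C with w in Hw by ring. destruct (Hg m w) as [l Hl]; [lra|].
      apply (cderiv_cont _ _ _ Hl). }
    assert (C2 : cont_on (fun t => circ 0 rho t ^ m)%C 0 1).
    { intros t _. apply ccont_pow, ccont_circ. }
    rewrite (CInt_ext _ (fun t => (F m (Psi (circ 0 rho t)) - circ 0 rho t ^ m) + circ 0 rho t ^ m)%C);
      [|lra|intros; ring].
    rewrite CInt_plus by (auto; lra).
    rewrite (CInt_ext (fun t => circ 0 rho t ^ m)%C (fun t => (/ circ 0 rho t) ^ 0 * circ 0 rho t ^ m)%C);
      [|lra|intros; simpl; ring].
    rewrite O. rewrite (CInt_ext _ (fun t => (F m (Psi (circ 0 rho t)) - circ 0 rho t ^ m) * circ 0 rho t ^ 0)%C);
      [|lra|intros; simpl; ring].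
    rewrite I. ring.
Qed.

(** With [x = 1 / w] and [Psi w = w + A x], the generating identity reads
    [G x (1 + x A x - x z) = 1 - x^2 A' x], where [G] is the power series with
    coefficients [F_m z]. Both sides are continuous at [x = 0], where it gives
    [F_0 z = 1]. *)
Lemma faber_0 z : closure Omega0 z -> F 0%nat z = 1%C.
Proof.
  intros Hz. assert (g0 := gamma_pos _ _ _ _ HPsi).
  destruct (faber_closure_bound (gamma + 1)) as [K [K0 HK]]; [lra|].
  destruct (a_bound _ _ _ _ HPsi) as [Ka [ta [ta0 Ha]]].
  set (G := pser (fun m => F m z)). set (A := pser a).
  assert (HG : holo (fun x => Cmod x < / (gamma + 1)) G).
  { intros x Hx. destruct (pser_deriv (fun m => F m z) K (gamma + 1) x) as [l [_ Hl]]; [lra|auto| |eauto].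
    apply lt_inv_mult; lra. }
  assert (HA : holo (fun x => Cmod x < / ta) A).
  { intros x Hx. destruct (pser_deriv a Ka ta x) as [l [_ Hl]]; [lra|auto| |eauto].
    apply lt_inv_mult; lra. }
  assert (HA' := holo_derive _ _ (open_Cmod_lt _) HA).
  assert (Zi : forall r, 0 < r -> Cmod 0%C < / r).
  { intros r Hr. rewrite Cmod_0. apply Rinv_0_lt_compat; auto. }
  set (h := fun x : C => (G x * (1 + x * A x - x * z) - (1 - x * x * C_derive A x))%C).
  assert (Hh : h 0%C = 0%C).
  { apply cont_zero.
    - assert (CG := holo_cont _ _ _ HG (Zi (gamma + 1) ltac:(lra))).
      assert (CA := holo_cont _ _ _ HA (Zi ta ta0)). assert (CA' := holo_cont _ _ _ HA' (Zi ta ta0)).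
      assert (CI := ccont_id 0%C).
      apply ccont_minus; [apply ccont_mult; auto; apply ccont_minus; [apply ccont_plus|]|apply ccont_minus];
        repeat first [apply ccont_const | assumption | apply ccont_mult].
    (* A point [x = 1 / v] as close to [0] as desired, at which all series
       converge. *)
    - intros d d0. set (m := Rmin d (Rmin (/ (gamma + 1)) (/ ta))).
      assert (I1 : 0 < / (gamma + 1)) by (apply Rinv_0_lt_compat; lra).
      assert (I2 : 0 < / ta) by (apply Rinv_0_lt_compat; lra).
      assert (m0 : 0 < m) by (repeat apply Rmin_pos; auto).
      assert (m1 : m <= d) by apply Rmin_l.
      assert (m2 : m <= / (gamma + 1)) by (eapply Rle_trans; [apply Rmin_r|apply Rmin_l]).
      assert (m3 : m <= / ta) by (eapply Rle_trans; [apply Rmin_r|apply Rmin_r]).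
      assert (Hx : Cmod (RtoC (m / 2)) = m / 2) by (apply Cmod_RtoC_pos; lra).
      set (x := RtoC (m / 2)) in *. exists x.
      replace (x - 0)%C with x by ring. split; [lra|].
      assert (Nx : x <> 0%C) by (apply Cmod_pos_neq; lra).
      assert (Hv : gamma + 1 < Cmod (/ x)%C).
      { rewrite Cmod_inv, Hx by auto. rewrite <- (Rinv_inv (gamma + 1)). apply Rinv_lt_contravar; [|lra].
        apply Rmult_lt_0_compat; lra. }
      assert (Nv : (/ x)%C <> 0%C) by (apply Cmod_pos_neq; lra).
      set (v := (/ x)%C) in *. assert (Ev : (/ v)%C = x) by (unfold v; field; auto).
      assert (PA' : forall v, gamma < Cmod v -> Psi v = (v + A (/ v))%C).
      { intros u Hu. replace (Psi u) with (u + (Psi u - u))%C by ring. f_equal. symmetry.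
        apply csum_CSeries. apply (Psi_csum _ _ _ _ HPsi); auto. }
      assert (D : C_derive Psi v = (1 - x * x * C_derive A x)%C).
      { apply cderiv_C_derive. apply cderiv_ext_loc with (fun v => v + A (/ v))%C.
        - apply (open_locally (fun v => gamma < Cmod v)); [apply open_Cmod_gt|lra|].
          intros u Hu. symmetry; apply PA', Hu.
        - replace (1 - x * x * C_derive A x)%C with (1 + C_derive A (/ v) * (- (1) / (v * v)))%C.
          + apply cderiv_plus; [apply cderiv_id|].
            apply (cderiv_comp A (fun v => / v)%C); [apply (cderiv_inv (fun v => v)); auto; apply cderiv_id|].
            rewrite Ev. apply (holo_deriv _ _ _ HA). lra.
          + rewrite Ev. unfold v. field. auto. }
      assert (S1 : G x = kernel z v).
      { unfold G, pser. apply csum_CSeries. rewrite <- Ev. apply faber_csum; auto. lra. }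
      assert (NP : (Psi v - z)%C <> 0%C).
      { intros E0. apply Ceq_minus in E0. subst z. revert Hz. apply (ext_not_closure _ _ _ _ HPsi). lra. }
      unfold h. rewrite S1. unfold kernel. rewrite <- D.
      replace (1 + x * A x - x * z)%C with (x * (Psi v - z))%C.
      + unfold v in *. field. auto.
      + rewrite PA' by lra. rewrite Ev. unfold v. field. auto. }
  unfold h in Hh. unfold G in Hh. rewrite pser_0 in Hh.
  replace (F 0%nat z) with ((F 0%nat z * (1 + 0 * A 0 - 0 * z) - (1 - 0 * 0 * C_derive A 0)) + 1)%C by ring.
  rewrite Hh. ring.
Qed.

(** Were the derivative to vanish at [w], the generating function
    [sum_m F_m(z) w^(-m)] would vanish at [w] for all [z] in the image of the
    circle [|v| = rho] inside the core. But its mean value over this image is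
    that of [F_0 = 1], the other means being [0]. *)
Theorem Psi_derive_neq_0 w : gamma <= Cmod w -> C_derive Psi w <> 0%C.
Proof.
  intros Hw E0. assert (g0 := gamma_pos _ _ _ _ HPsi).
  destruct grunsky_bound as [rho [th [K [R0 [R1 [R2 [K0 [HP [HI [HCl [HK [_ HM]]]]]]]]]]]].
  assert (Cv : forall v, gamma <= Cmod v -> th * Cmod (/ v)%C < 1).
  { intros v Hv. rewrite Cmod_inv by (apply Cmod_pos_neq; lra).
    apply Rmult_lt_reg_r with (Cmod v); [lra|]. rewrite Rmult_assoc, Rinv_l; lra. }
  assert (S0 : forall v, Cmod v = rho -> pser (fun m => F m (Psi v)) (/ w)%C = 0%C).
  { intros v Hv. set (G := pser (fun m => F m (Psi v))).
    assert (Nw : w <> 0%C) by (apply Cmod_pos_neq; lra).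
    assert (Np : (Psi w - Psi v)%C <> 0%C).
    { intros E1. apply Ceq_minus, HI in E1; try lra. subst w; lra. }
    (* If [|w| = gamma] the generating identity is only known at points
       outside of the circle; it extends to [w] by continuity. *)
    set (h := fun u : C => ((Psi u - Psi v) * G (/ u) - u * C_derive Psi u)%C).
    assert (Hh : h w = 0%C).
    { apply cont_zero.
      - assert (CP : ccont (U := C_UniformSpace) Psi w) by (apply (Psi_cont _ _ _ _ HPsi); auto).
        assert (CP' : ccont (U := C_UniformSpace) (C_derive Psi) w).
        { apply (holo_cont _ _ _ (Psi_derive_holo _ _ _ _ HPsi)); auto. }
        apply ccont_minus; [apply ccont_mult|apply ccont_mult; [apply ccont_id|exact CP']].
        + apply ccont_minus; [exact CP|apply ccont_const].
        + apply (ccont_comp (U := C_UniformSpace) G (fun u => / u)%C).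
          * apply ccont_inv; [apply ccont_id|auto].
          * destruct (pser_deriv (fun m => F m (Psi v)) K th (/ w)%C) as [l [_ Hl]]; auto; [lra|].
            apply (cderiv_cont _ _ _ Hl).
      - intros d d0. destruct (radial_point w d) as [u [U1 U2]]; [lra|auto|].
        exists u; split; auto. unfold h.
        assert (E1 : G (/ u)%C = kernel (Psi v) u).
        { apply csum_CSeries. apply faber_csum; auto. lra. }
        rewrite E1. unfold kernel. field. intros E2. apply Ceq_minus, HI in E2; try lra. subst u; lra. }
    unfold h in Hh. rewrite E0 in Hh.
    replace (G (/ w)%C) with (/ (Psi w - Psi v) * ((Psi w - Psi v) * G (/ w) - w * 0 + 0))%C by (field; auto).
    rewrite Hh. ring. }
  set (t := th * Cmod (/ w)%C). assert (Ht : 0 <= t < 1).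
  { split; [apply Rmult_le_pos; [lra|apply Cmod_ge_0]|apply Cv; auto]. }
  assert (CF : forall m, cont_on (fun t => F m (Psi (circ 0 rho t))) 0 1).
  { intros m. apply (cont_on_circ (fun w => F m (Psi w))); [lra|]. intros v Hv.
    replace (v - 0)%C with v in Hv by ring.
    apply (ccont_comp (U := C_UniformSpace) (F m) Psi); [apply (holo_cont _ _ _ HP); lra|].
    destruct (faber_deriv m (Psi v)) as [l Hl]. apply (cderiv_cont _ _ _ Hl). }
  assert (S1 : csum (fun m => CInt (fun s => (/ w) ^ m * F m (Psi (circ 0 rho s)))%C 0 1) (CInt (fun _ => 0%C) 0 1)).
  { apply (CInt_csum K t); auto.
    - intros m. apply cont_on_mult; auto. intros s _; apply ccont_const.
    - intros s _; apply ccont_const.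
    - intros m s _. rewrite Cmod_mult, Cmod_pow. unfold t. rewrite Rpow_mult_distr, <- Rmult_assoc, Rmult_comm.
      apply Rmult_le_compat_r; [apply pow_le, Cmod_ge_0|]. apply HK. apply Cmod_circ0; lra.
    - intros s _. assert (Hs : Cmod (circ 0 rho s) = rho) by (apply Cmod_circ0; lra).
      destruct (pser_csum (fun m => F m (Psi (circ 0 rho s))) K th (/ w)%C) as [P _];
        [lra|intros n; apply HK; auto|apply Cv; auto|].
      rewrite (S0 _ Hs) in P. apply csum_ext with (2 := P). intros n; ring. }
  rewrite CInt_const in S1.
  assert (Z : forall m, m <> 0%nat -> CInt (fun s => (/ w) ^ m * F m (Psi (circ 0 rho s)))%C 0 1 = 0%C).
  { intros m Hm. rewrite CInt_scal by (auto; lra). rewrite HM by lia. ring. }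
  assert (E1 := csum_unique _ _ _ S1 (csum_single _ 0%nat Z)).
  cbv beta in E1.
  rewrite (CInt_ext _ (fun _ => 1%C)), CInt_const in E1.
  - apply (f_equal Cmod) in E1. rewrite Cmod_0, Cmod_1 in E1. lra.
  - lra.
  - intros s _. rewrite faber_0; [simpl; ring|]. apply HCl, Cmod_circ0; lra.
Qed.
End Faber.

(** * Semi-infinite matrices with geometric bounds *)

Definition mmul (P Q : mat) : mat := fun i j => CSeries (fun k => P i k * Q k j)%C.
Definition madd (P Q : mat) : mat := fun i j => (P i j + Q i j)%C.
Definition rows (d : nat -> R) (P : mat) : mat := fun i j => (RtoC (d i) * P i j)%C.
Definition cols (P : mat) (d : nat -> R) : mat := fun i j => (P i j * RtoC (d j))%C.

Lemma mat_ext (P Q : mat) : (forall i j, P i j = Q i j) -> P = Q.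
Proof. intros H. do 2 (apply functional_extensionality; intro). apply H. Qed.

Lemma CSeries_scal_R (x : R) (f : nat -> C) : CSeries (fun n => RtoC x * f n)%C = (RtoC x * CSeries f)%C.
Proof.
  unfold CSeries, Cmult, RtoC; cbn [fst snd].
  rewrite (Series_ext (fun n => x * fst (f n) - 0 * snd (f n)) (fun n => x * fst (f n))) by (intros; ring).
  rewrite (Series_ext (fun n => x * snd (f n) + 0 * fst (f n)) (fun n => x * snd (f n))) by (intros; ring).
  rewrite !Series_scal_l. f_equal; ring.
Qed.

Lemma CSeries_conj (f : nat -> C) : CSeries (fun n => Cconj (f n)) = Cconj (CSeries f).
Proof.
  unfold CSeries, Cconj; cbn [fst snd]. f_equal. apply Series_opp.
Qed.

Lemma Cconj_RtoC (x : R) : Cconj (RtoC x) = RtoC x.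
Proof. unfold Cconj, RtoC; cbn [fst snd]. f_equal; ring. Qed.

Lemma rows_mul d P Q : mmul (rows d P) Q = rows d (mmul P Q).
Proof.
  apply mat_ext; intros i j. unfold mmul, rows. rewrite <- CSeries_scal_R.
  apply CSeries_ext; intros; ring.
Qed.

Lemma mul_cols P Q d : mmul P (cols Q d) = cols (mmul P Q) d.
Proof.
  apply mat_ext; intros i j. unfold mmul, cols. rewrite Cmult_comm, <- CSeries_scal_R.
  apply CSeries_ext; intros; ring.
Qed.

Lemma cols_mul P Q d : mmul (cols P d) Q = mmul P (rows d Q).
Proof.
  apply mat_ext; intros i j. unfold mmul, cols, rows. apply CSeries_ext; intros; ring.
Qed.

Lemma rows_rows d e P : rows d (rows e P) = rows (fun i => d i * e i) P.
Proof. apply mat_ext; intros i j. unfold rows. rewrite RtoC_mult. ring. Qed.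

Lemma rows_1 d P : (forall i, d i = 1) -> rows d P = P.
Proof. intros H. apply mat_ext; intros i j. unfold rows. rewrite H. ring. Qed.

Lemma rows_cols d P e : rows d (cols P e) = cols (rows d P) e.
Proof. apply mat_ext; intros i j. unfold rows, cols. ring. Qed.

Lemma conj_mul P Q : mat_conj (mmul P Q) = mmul (mat_conj P) (mat_conj Q).
Proof.
  apply mat_ext; intros i j. unfold mat_conj, mmul. rewrite <- CSeries_conj.
  apply CSeries_ext; intros; apply Cmult_conj.
Qed.

Lemma conj_rows d P : mat_conj (rows d P) = rows d (mat_conj P).
Proof.
  apply mat_ext; intros i j. unfold mat_conj, rows. rewrite Cmult_conj, Cconj_RtoC. auto.
Qed.

Lemma conj_cols d P : mat_conj (cols P d) = cols (mat_conj P) d.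
Proof.
  apply mat_ext; intros i j. unfold mat_conj, cols. rewrite Cmult_conj, Cconj_RtoC. auto.
Qed.

Lemma conj_add P Q : mat_conj (madd P Q) = madd (mat_conj P) (mat_conj Q).
Proof. apply mat_ext; intros i j. apply Cplus_conj. Qed.

Lemma conj_diag d : mat_conj (diag d) = diag d.
Proof.
  apply mat_ext; intros i j. unfold mat_conj, diag. destruct (Nat.eqb i j); apply Cconj_RtoC.
Qed.

Lemma conj_conj P : mat_conj (mat_conj P) = P.
Proof.
  apply mat_ext; intros i j. apply Cconj_conj.
Qed.

Lemma CSeries_single (f : nat -> C) m : (forall k, k <> m -> f k = 0%C) -> CSeries f = f m.
Proof. intros H. apply csum_CSeries, csum_single, H. Qed.

Lemma mul_diag P d : mmul P (diag d) = cols P d.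
Proof.
  apply mat_ext; intros i j. unfold mmul, cols.
  rewrite (CSeries_single _ j); unfold diag.
  - rewrite Nat.eqb_refl; auto.
  - intros k Hk. apply Nat.eqb_neq in Hk. rewrite Hk. ring.
Qed.

Lemma diag_mul P d : mmul (diag d) P = rows d P.
Proof.
  apply mat_ext; intros i j. unfold mmul, rows.
  rewrite (CSeries_single _ i); unfold diag.
  - rewrite Nat.eqb_refl; auto.
  - intros k Hk. apply Nat.neq_sym, Nat.eqb_neq in Hk. rewrite Hk. ring.
Qed.

Section Bounds.
Context (t : R) (Ht : 0 < t < 1).

(** The class [decays b1 b2] asks that the entry [(i, j)] be of order [t^i]
    when [b1] holds, times [t^j] when [b2] holds. A product converges as soon
    as one of its factors decays in the common index. *)
Definition profile (b : bool) (n : nat) : R := if b then t ^ n else 1.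
Definition decays (b1 b2 : bool) (P : mat) : Prop :=
  exists K, 0 <= K /\ forall i j, Cmod (P i j) <= K * profile b1 i * profile b2 j.
Definition bounded_seq (d : nat -> R) : Prop := exists K, 0 <= K /\ forall i, Rabs (d i) <= K.

Lemma profile_pos b n : 0 < profile b n.
Proof. destruct b; simpl; [apply pow_lt|]; lra. Qed.

Lemma profile_le b1 b2 n : orb b1 b2 = true -> profile b1 n * profile b2 n <= t ^ n.
Proof.
  intros H. assert (T0 : 0 < t ^ n) by (apply pow_lt; lra).
  assert (T1 : t ^ n <= 1) by (rewrite <- (pow1 n); apply pow_incr; lra).
  destruct b1, b2; simpl in *; try discriminate; nra.
Qed.

Lemma decays_mul_term b1 x y b2 P Q K1 K2 : orb x y = true -> 0 <= K1 -> 0 <= K2 ->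
  (forall i j, Cmod (P i j) <= K1 * profile b1 i * profile x j) ->
  (forall i j, Cmod (Q i j) <= K2 * profile y i * profile b2 j) ->
  forall i k j, Cmod (P i k * Q k j)%C <= K1 * profile b1 i * (K2 * profile b2 j) * t ^ k.
Proof.
  intros Hxy H1 H2 HP HQ i k j. rewrite Cmod_mult.
  assert (A1 := profile_pos b1 i). assert (A2 := profile_pos b2 j).
  assert (A3 := profile_pos x k). assert (A4 := profile_pos y k).
  eapply Rle_trans; [apply Rmult_le_compat; [apply Cmod_ge_0|apply Cmod_ge_0|apply HP|apply HQ]|].
  replace (K1 * profile b1 i * profile x k * (K2 * profile y k * profile b2 j))
    with (K1 * profile b1 i * (K2 * profile b2 j) * (profile x k * profile y k)) by ring.
  apply Rmult_le_compat_l; [|apply profile_le; auto].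
  repeat apply Rmult_le_pos; lra.
Qed.

Lemma decays_mul b1 x y b2 P Q : orb x y = true -> decays b1 x P -> decays y b2 Q ->
  decays b1 b2 (mmul P Q).
Proof.
  intros Hxy [K1 [P1 HP]] [K2 [P2 HQ]]. exists (K1 * K2 / (1 - t)). split.
  { apply Rmult_le_pos; [apply Rmult_le_pos; auto|]. apply Rlt_le, Rinv_0_lt_compat; lra. }
  intros i j.
  destruct (csum_geo_bound (K1 * profile b1 i * (K2 * profile b2 j)) t (fun k => P i k * Q k j)%C) as [_ B]; [lra| |].
  - intros k. apply (decays_mul_term b1 x y b2); auto.
  - eapply Rle_trans; [exact B|]. apply Req_le. field. lra.
Qed.

Lemma mul_csum b1 x y b2 P Q : orb x y = true -> decays b1 x P -> decays y b2 Q ->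
  forall i j, csum (fun k => P i k * Q k j)%C (mmul P Q i j).
Proof.
  intros Hxy [K1 [P1 HP]] [K2 [P2 HQ]] i j. apply (csum_geo t); [lra|].
  exists (K1 * profile b1 i * (K2 * profile b2 j)). intros k. apply (decays_mul_term b1 x y b2); auto.
Qed.

(** Both iterated sums are absolutely convergent double sums when each of the
    two inner indices has a decaying factor. *)
Lemma mul_assoc b1 x y z u b2 P Q S : orb x y = true -> orb z u = true ->
  decays b1 x P -> decays y z Q -> decays u b2 S ->
  mmul (mmul P Q) S = mmul P (mmul Q S).
Proof.
  intros Hxy Hzu DP DQ DS. apply mat_ext; intros i j.
  assert (PQ := mul_csum _ _ _ _ _ _ Hxy DP DQ). assert (QS := mul_csum _ _ _ _ _ _ Hzu DQ DS).
  destruct DP as [K1 [P1 HP]]. destruct DQ as [K2 [P2 HQ]]. destruct DS as [K3 [P3 HS]].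
  assert (Ex : csum (fun k => CSeries (fun l => P i k * Q k l * S l j)%C)
     (CSeries (fun l => CSeries (fun k => P i k * Q k l * S l j)%C))).
  { apply (csum_exchange (K1 * profile b1 i * K2 * (K3 * profile b2 j)) t); [lra|].
    intros k l. rewrite Cmod_mult.
    assert (T := decays_mul_term b1 x y z P Q K1 K2 Hxy P1 P2 HP HQ i k l).
    eapply Rle_trans; [apply Rmult_le_compat; [apply Cmod_ge_0|apply Cmod_ge_0|exact T|apply HS]|].
    replace (K1 * profile b1 i * (K2 * profile z l) * t ^ k * (K3 * profile u l * profile b2 j))
      with (K1 * profile b1 i * K2 * (K3 * profile b2 j) * t ^ k * (profile z l * profile u l)) by ring.
    apply Rmult_le_compat_l; [|apply profile_le; auto].
    assert (A1 := profile_pos b1 i). assert (A2 := profile_pos b2 j).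
    assert (A3 : 0 < t ^ k) by (apply pow_lt; lra). repeat apply Rmult_le_pos; lra. }
  unfold mmul at 1. rewrite (CSeries_ext _ (fun l => CSeries (fun k => P i k * Q k l * S l j)%C)).
  - rewrite <- (csum_CSeries _ _ Ex). unfold mmul at 1. apply CSeries_ext. intros k.
    apply csum_CSeries. apply csum_ext with (2 := csum_scal (P i k) _ _ (QS k j)). intros; ring.
  - intros l. symmetry. apply csum_CSeries. apply csum_scal_r, PQ.
Qed.

Lemma mul_add_r b1 x y b2 P Q S : orb x y = true -> decays b1 x P -> decays y b2 Q -> decays y b2 S ->
  mmul P (madd Q S) = madd (mmul P Q) (mmul P S).
Proof.
  intros Hxy DP DQ DS. apply mat_ext; intros i j. apply csum_CSeries.
  apply csum_ext with (2 := csum_plus _ _ _ _ (mul_csum _ _ _ _ _ _ Hxy DP DQ i j) (mul_csum _ _ _ _ _ _ Hxy DP DS i j)).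
  intros k. unfold madd. ring.
Qed.

Lemma mul_add_l b1 x y b2 P Q S : orb x y = true -> decays b1 x P -> decays b1 x Q -> decays y b2 S ->
  mmul (madd P Q) S = madd (mmul P S) (mmul Q S).
Proof.
  intros Hxy DP DQ DS. apply mat_ext; intros i j. apply csum_CSeries.
  apply csum_ext with (2 := csum_plus _ _ _ _ (mul_csum _ _ _ _ _ _ Hxy DP DS i j) (mul_csum _ _ _ _ _ _ Hxy DQ DS i j)).
  intros k. unfold madd. ring.
Qed.

Lemma decays_rows b1 b2 d P : bounded_seq d -> decays b1 b2 P -> decays b1 b2 (rows d P).
Proof.
  intros [K1 [P1 H1]] [K2 [P2 H2]]. exists (K1 * K2). split; [apply Rmult_le_pos; auto|].
  intros i j. unfold rows. rewrite Cmod_mult, Cmod_R, !Rmult_assoc, <- (Rmult_assoc K2).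
  apply Rmult_le_compat; auto; [apply Rabs_pos|apply Cmod_ge_0].
Qed.

Lemma decays_cols b1 b2 d P : bounded_seq d -> decays b1 b2 P -> decays b1 b2 (cols P d).
Proof.
  intros [K1 [P1 H1]] [K2 [P2 H2]]. exists (K1 * K2). split; [apply Rmult_le_pos; auto|].
  intros i j. unfold cols. rewrite Cmod_mult, Cmod_R, Rmult_comm, !Rmult_assoc, <- (Rmult_assoc K2).
  apply Rmult_le_compat; auto; [apply Rabs_pos|apply Cmod_ge_0].
Qed.

Lemma decays_conj b1 b2 P : decays b1 b2 P -> decays b1 b2 (mat_conj P).
Proof. intros [K [P0 H]]. exists K; split; auto. intros i j. unfold mat_conj. rewrite Cmod_conj. auto. Qed.

Lemma decays_add b1 b2 P Q : decays b1 b2 P -> decays b1 b2 Q -> decays b1 b2 (madd P Q).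
Proof.
  intros [K1 [P1 H1]] [K2 [P2 H2]]. exists (K1 + K2). split; [lra|]. intros i j.
  eapply Rle_trans; [apply Cmod_triangle|]. rewrite !Rmult_plus_distr_r. apply Rplus_le_compat; auto.
Qed.

Lemma decays_weaken b1 b2 b1' b2' P : (b1' = true -> b1 = true) -> (b2' = true -> b2 = true) ->
  decays b1 b2 P -> decays b1' b2' P.
Proof.
  intros W1 W2 [K [P0 H]]. exists K; split; auto. intros i j. eapply Rle_trans; [apply H|].
  assert (M : forall b b' n, (b' = true -> b = true) -> profile b n <= profile b' n).
  { intros b b' n W. assert (T1 : t ^ n <= 1) by (rewrite <- (pow1 n); apply pow_incr; lra).
    destruct b, b'; simpl; try lra; specialize (W eq_refl); discriminate. }
  apply Rmult_le_compat.
  - apply Rmult_le_pos; auto. apply Rlt_le, profile_pos.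
  - apply Rlt_le, profile_pos.
  - apply Rmult_le_compat_l; auto.
  - auto.
Qed.

Lemma decays_diag d : bounded_seq d -> decays false false (diag d).
Proof.
  intros [K [K0 H]]. exists K; split; auto. intros i j. simpl. rewrite !Rmult_1_r. unfold diag.
  destruct (Nat.eqb i j); [rewrite Cmod_R; auto|rewrite Cmod_0; auto].
Qed.

Lemma bounded_mul d e : bounded_seq d -> bounded_seq e -> bounded_seq (fun i => d i * e i).
Proof.
  intros [K1 [P1 H1]] [K2 [P2 H2]]. exists (K1 * K2). split; [apply Rmult_le_pos; auto|].
  intros i. rewrite Rabs_mult. apply Rmult_le_compat; auto; apply Rabs_pos.
Qed.

(** ** The push-through identities *)

(** [A] stands for the inverse of [D4 - D2 G] with [G = conj c J] and
    [J = D4^(-1) D2 c]; the hypotheses on [A] say this without a product whose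
    terms are only bounded. Formally
    [(D4 - D2 conj G) J = D2 c D4^(-1) (D4 - D2 G)], because both sides are
    [D2 c - D2 c conj J J]; multiplying by the inverses gives
    [J A = S D4^(-1)] with [S = conj A D2 c], and the two identities follow
    after multiplication by [c conj J] and [conj c]. *)
Lemma push_through (c A : mat) (d2 d4 i4 : nat -> R) :
  decays true true c -> decays false false A ->
  bounded_seq d2 -> bounded_seq d4 -> bounded_seq i4 -> (forall n, d4 n * i4 n = 1) ->
  let J := rows (fun n => i4 n * d2 n) c in
  let G := mmul (mat_conj c) J in
  let N := mmul G A in
  let H := mmul c A in
  rows d4 A = madd (diag (fun _ => 1)) (rows d2 N) ->
  cols A d4 = madd (diag (fun _ => 1)) (mmul A (rows d2 G)) ->
  madd c (mmul (mat_conj N) (rows d2 c)) = cols H d4 /\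
  mmul (mat_conj H) (rows d2 c) = cols N d4.
Proof.
  intros Dc DA B2 B4 Bi E4 J G N H I1 I2.
  set (e := fun n => i4 n * d2 n) in *.
  assert (Be : bounded_seq e) by (apply bounded_mul; auto).
  set (cb := mat_conj c) in *. set (Ab := mat_conj A).
  set (Jb := mat_conj J). set (Gb := mat_conj G).
  assert (Dcb : decays true true cb) by (apply decays_conj; auto).
  assert (DAb : decays false false Ab) by (apply decays_conj; auto).
  assert (DJ : decays true true J) by (apply decays_rows; auto).
  assert (DJb : decays true true Jb) by (apply decays_conj; auto).
  assert (DG : decays true true G) by (apply (decays_mul true true true true); auto).
  assert (DGb : decays true true Gb) by (apply decays_conj; auto).
  assert (DN : decays true false N) by (apply (decays_mul true true false false); auto).
  assert (DH : decays true false H) by (apply (decays_mul true true false false); auto).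
  assert (EJb : Jb = rows e cb) by (apply conj_rows).
  assert (EGb : Gb = mmul c Jb) by (unfold Gb, G; rewrite conj_mul; unfold cb; rewrite conj_conj; auto).
  set (S := mmul Ab (rows d2 c)).
  assert (D2c : decays true true (rows d2 c)) by (apply decays_rows; auto).
  assert (DS : decays false true S) by (apply (decays_mul false false true true); auto).
  (* The inverse relation [D4 A = 1 + D2 N], solved for [A]. *)
  assert (IA : A = madd (diag i4) (rows e N)).
  { apply mat_ext; intros i j. assert (X := f_equal (fun M : mat => M i j) I1).
    unfold rows, madd, diag in X |- *.
    replace (A i j) with (RtoC (i4 i) * (RtoC (d4 i) * A i j))%C.
    - rewrite X. unfold e. cbv beta. rewrite RtoC_mult.
      destruct (Nat.eqb_spec i j) as [->|]; ring.
    - rewrite Cmult_assoc, <- RtoC_mult, (Rmult_comm (i4 i)), E4. ring. }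
  assert (F1 : mmul cb (rows e H) = N).
  { unfold H. rewrite <- rows_mul. fold J. symmetry. apply (mul_assoc true true true true false false); auto. }
  (* The conjugate inverse relation [conj A D4 = 1 + conj A D2 conj G],
     multiplied by [J]. *)
  assert (SA : S = madd J (mmul S (rows e G))).
  { unfold S at 1.
    replace (rows d2 c) with (rows d4 J).
    2:{ unfold J. rewrite rows_rows. apply mat_ext; intros i j. unfold rows, e. f_equal. f_equal.
        rewrite <- Rmult_assoc, E4. ring. }
    rewrite <- cols_mul. unfold Ab. rewrite <- conj_cols, I2, conj_add, conj_diag, conj_mul, conj_rows.
    fold Ab Gb.
    assert (DW : decays false true (mmul Ab (rows d2 Gb))).
    { apply (decays_mul false false true true); auto. apply decays_rows; auto. }
    rewrite (mul_add_l false false true true); auto.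
    - rewrite diag_mul, rows_1 by auto. f_equal.
      rewrite (mul_assoc false false true true true true); auto; [|apply decays_rows; auto].
      rewrite rows_mul, EGb, (mul_assoc true true true true true true) by auto.
      rewrite EJb, rows_mul. fold G.
      unfold S. rewrite <- rows_mul.
      symmetry. apply (mul_assoc false false true true true true); auto. apply decays_rows; auto.
    - apply decays_diag. exists 1. split; [lra|]. intros _. rewrite Rabs_pos_eq; lra.
    - apply decays_weaken with (3 := DW); solve [auto|discriminate]. }
  (* [S A] computed from [SA] and from [IA]; the common summand
     [S D4^(-1) D2 N] cancels. *)
  assert (Star : cols S i4 = rows e H).
  { assert (X1 : mmul S A = madd (rows e H) (mmul S (rows e N))).
    { rewrite SA at 1. rewrite (mul_add_l false true false false); auto.
      - f_equal.
        + unfold J, H. apply rows_mul.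
        + rewrite (mul_assoc false true true true false false); auto.
          * rewrite rows_mul. auto.
          * apply decays_rows; auto.
      - apply decays_weaken with (3 := DJ); solve [auto|discriminate].
      - apply (decays_mul false true true true); auto. apply decays_rows; auto. }
    assert (X2 : mmul S A = madd (cols S i4) (mmul S (rows e N))).
    { rewrite IA at 1. rewrite (mul_add_r false true false false); auto.
      - rewrite mul_diag. auto.
      - apply decays_diag; auto.
      - apply decays_weaken with true false; [discriminate|auto|apply decays_rows; auto]. }
    apply mat_ext; intros i j. rewrite X1 in X2. assert (Y := f_equal (fun M : mat => M i j) X2).
    unfold madd in Y. replace (cols S i4 i j) with (cols S i4 i j + mmul S (rows e N) i j - mmul S (rows e N) i j)%C by ring.
    rewrite <- Y. ring. }
  assert (S4 : S = cols (rows e H) d4).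
  { rewrite <- Star. apply mat_ext; intros i j. unfold cols.
    rewrite <- Cmult_assoc, <- RtoC_mult, (Rmult_comm (i4 j)), E4. ring. }
  split.
  - unfold N. rewrite conj_mul. fold Gb Ab.
    rewrite (mul_assoc true true false false true true); auto. fold S.
    rewrite S4, mul_cols.
    replace (mmul Gb (rows e H)) with (mmul c (rows e N)).
    + unfold H. rewrite IA at 1. rewrite (mul_add_r true true false false); auto.
      * rewrite mul_diag. apply mat_ext; intros i j. unfold madd, cols.
        rewrite Cmult_plus_distr_r, <- Cmult_assoc, <- RtoC_mult, (Rmult_comm (i4 j)), E4. ring.
      * apply decays_diag; auto.
      * apply decays_weaken with true false; [discriminate|auto|apply decays_rows; auto].
    + rewrite EGb, (mul_assoc true true true true true false); auto.
      * rewrite EJb, rows_mul, F1. auto.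
      * apply decays_rows; auto.
  - unfold H. rewrite conj_mul. fold Ab. fold cb.
    rewrite (mul_assoc true true false false true true); auto. fold S.
    rewrite S4, mul_cols, F1. auto.
Qed.
End Bounds.

(** * The transfer matrices *)

Definition entry (M : matrix (T := R) 2 2) (i k : nat) : R := coeff_mat 0 M i k.

Lemma entry_Mmult (A B : matrix (T := R) 2 2) i k : (i < 2)%nat -> (k < 2)%nat ->
  entry (Mmult A B) i k = entry A i 0 * entry B 0 k + entry A i 1 * entry B 1 k.
Proof.
  intros Hi Hk. unfold entry, Mmult. rewrite coeff_mat_bij by auto.
  simpl pred. rewrite sum_Sn, sum_O. reflexivity.
Qed.

Section Transfer.
Context (gamma : R) (L : nat) (r sigma : nat -> R) (g0 : 0 < gamma).
Context (layers : coating gamma L r sigma).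

Lemma layers_sigma j : (j <= S L)%nat -> 0 < sigma j.
Proof. apply layers. Qed.

Lemma layers_r_0 : r 0%nat = gamma.
Proof. apply layers. Qed.

Lemma layers_r_le i j : (i <= j)%nat -> (j <= L)%nat -> r i <= r j.
Proof.
  intros Hij. induction Hij; intros HL; [lra|].
  destruct layers as [_ [H _]]. specialize (H m ltac:(lia)). specialize (IHHij ltac:(lia)). lra.
Qed.

Lemma layers_r_pos j : (j <= L)%nat -> gamma <= r j.
Proof. intros H. rewrite <- layers_r_0. apply layers_r_le; lia. Qed.

(** A single transfer matrix has determinant [sigma_(j+1) / sigma_j], and
    these quotients telescope. *)
Lemma transfer_det n j : (j <= L)%nat ->
  entry (transfer_product r sigma n j) 0 0 * entry (transfer_product r sigma n j) 1 1
  - entry (transfer_product r sigma n j) 0 1 * entry (transfer_product r sigma n j) 1 0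
  = sigma (S j) / sigma 0%nat.
Proof.
  assert (D : forall j, (j <= L)%nat ->
    entry (transfer r sigma n j) 0 0 * entry (transfer r sigma n j) 1 1
    - entry (transfer r sigma n j) 0 1 * entry (transfer r sigma n j) 1 0 = sigma (S j) / sigma j).
  { intros i Hi. unfold entry, transfer, coeff_mat; simpl.
    assert (R0 : 0 < r i) by (generalize (layers_r_pos i Hi); lra).
    assert (P : r i ^ (n + (n + 0)) <> 0) by (apply pow_nonzero; lra).
    assert (S0 := layers_sigma i ltac:(lia)). field. split; auto; lra. }
  induction j; intros Hj.
  - simpl transfer_product. rewrite D by auto. auto.
  - simpl transfer_product. rewrite !entry_Mmult by lia.
    set (P := transfer_product r sigma n j) in *. set (T := transfer r sigma n (S j)).
    transitivity ((entry P 0 0 * entry P 1 1 - entry P 0 1 * entry P 1 0) *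
      (entry T 0 0 * entry T 1 1 - entry T 0 1 * entry T 1 0)); [ring|].
    unfold T. rewrite IHj by lia. rewrite D by lia.
    assert (S0 := layers_sigma 0 ltac:(lia)). assert (S1 := layers_sigma (S j) ltac:(lia)).
    field. lra.
Qed.

(** The bound on [d2] makes [d2 gamma^(2n)] bounded. Induction needs the
    growth of [d1] along with it: the new upper right entry contains the upper
    left one divided by [r_(j+1)^(2n)], and [r_j <= r_(j+1)]. *)
Lemma transfer_bound j : (j <= L)%nat -> exists K, 0 <= K /\ forall n,
  Rabs (entry (transfer_product r sigma n j) 0 0) <= K * (r j / gamma) ^ (2 * n) /\
  Rabs (entry (transfer_product r sigma n j) 0 1) <= K * (/ gamma) ^ (2 * n).
Proof.
  induction j; intros Hj.
  - set (s := sigma 1%nat / sigma 0%nat).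
    exists (Rabs ((1 + s) / 2) + Rabs ((1 - s) / 2)).
    assert (A1 := Rabs_pos ((1 + s) / 2)). assert (A2 := Rabs_pos ((1 - s) / 2)).
    split; [lra|]. intros n. rewrite layers_r_0. unfold Rdiv at 3. rewrite Rinv_r, pow1 by lra.
    change (entry (transfer_product r sigma n 0) 0 0) with ((1 + s) / 2).
    change (entry (transfer_product r sigma n 0) 0 1) with ((1 - s) * / r 0%nat ^ (2 * n) / 2).
    rewrite layers_r_0, pow_inv. assert (P : 0 < / gamma ^ (2 * n)) by (apply Rinv_0_lt_compat, pow_lt; auto).
    split; [lra|].
    replace ((1 - s) * / gamma ^ (2 * n) / 2) with ((1 - s) / 2 * / gamma ^ (2 * n)) by (unfold Rdiv; ring).
    rewrite Rabs_mult, (Rabs_pos_eq (/ _)) by lra. apply Rmult_le_compat_r; lra.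
  - destruct IHj as [K [K0 HK]]; [lia|].
    set (s := sigma (S (S j)) / sigma (S j)).
    set (M := Rabs ((1 + s) / 2) + Rabs ((1 - s) / 2)).
    assert (A1 := Rabs_pos ((1 + s) / 2)). assert (A2 := Rabs_pos ((1 - s) / 2)).
    exists (K * M). split; [unfold M; apply Rmult_le_pos; lra|]. intros n.
    destruct (HK n) as [H1 H2]. simpl transfer_product. rewrite !entry_Mmult by lia.
    set (P := transfer_product r sigma n j) in *.
    change (entry (transfer r sigma n (S j)) 0 0) with ((1 + s) / 2).
    change (entry (transfer r sigma n (S j)) 1 1) with ((1 + s) / 2).
    change (entry (transfer r sigma n (S j)) 0 1) with ((1 - s) * / r (S j) ^ (2 * n) / 2).
    change (entry (transfer r sigma n (S j)) 1 0) with ((1 - s) * r (S j) ^ (2 * n) / 2).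
    assert (Rj := layers_r_pos j ltac:(lia)). assert (RS := layers_r_le j (S j) ltac:(lia) Hj).
    set (x := r (S j)) in *. set (y := r j) in *.
    assert (X0 : 0 < x ^ (2 * n)) by (apply pow_lt; lra).
    assert (Y0 : 0 < y ^ (2 * n)) by (apply pow_lt; lra).
    assert (G0 : 0 < (/ gamma) ^ (2 * n)) by (apply pow_lt, Rinv_0_lt_compat; auto).
    assert (YX : y ^ (2 * n) <= x ^ (2 * n)) by (apply pow_incr; lra).
    assert (Dv : forall y, (y / gamma) ^ (2 * n) = y ^ (2 * n) * (/ gamma) ^ (2 * n))
      by (intros; apply Rpow_mult_distr).
    rewrite Dv in H1 |- *.
    assert (U1 : Rabs (entry P 0 0) <= K * (x ^ (2 * n) * (/ gamma) ^ (2 * n))).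
    { eapply Rle_trans; [exact H1|]. apply Rmult_le_compat_l; auto. apply Rmult_le_compat_r; lra. }
    assert (U2 : Rabs (entry P 0 1 * x ^ (2 * n)) <= K * (x ^ (2 * n) * (/ gamma) ^ (2 * n))).
    { rewrite Rabs_mult, (Rabs_pos_eq (x ^ (2 * n))) by lra.
      apply Rle_trans with (K * (/ gamma) ^ (2 * n) * x ^ (2 * n)); [|lra]. apply Rmult_le_compat_r; lra. }
    assert (U3 : Rabs (entry P 0 0 * / x ^ (2 * n)) <= K * (/ gamma) ^ (2 * n)).
    { rewrite Rabs_mult, (Rabs_pos_eq (/ x ^ (2 * n))) by (apply Rlt_le, Rinv_0_lt_compat; auto).
      apply Rmult_le_reg_r with (1 := X0). rewrite Rmult_assoc, Rinv_l by lra. lra. }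
    assert (Comb : forall p q al be Z, Rabs p <= Z -> Rabs q <= Z ->
       Rabs (p * al + q * be) <= Z * (Rabs al + Rabs be)).
    { intros p q al be Z Hp Hq. eapply Rle_trans; [apply Rabs_triang|]. rewrite !Rabs_mult.
      assert (B1 := Rabs_pos al). assert (B2 := Rabs_pos be). nra. }
    split.
    + replace (entry P 0 1 * ((1 - s) * x ^ (2 * n) / 2)) with (entry P 0 1 * x ^ (2 * n) * ((1 - s) / 2)) by field.
      eapply Rle_trans; [apply (Comb _ _ _ _ _ U1 U2)|]. unfold M. lra.
    + replace (entry P 0 0 * ((1 - s) * / x ^ (2 * n) / 2)) with (entry P 0 0 * / x ^ (2 * n) * ((1 - s) / 2)) by (field; lra).
      rewrite Rplus_comm. eapply Rle_trans; [apply (Comb _ _ _ _ _ H2 U3)|]. unfold M. lra.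
Qed.
End Transfer.

(** * Entries of bounded operators *)

Lemma l2_single (gamma : R) (x : nat -> C) n : 0 < gamma -> (1 <= n)%nat ->
  (forall k, k <> n -> x k = 0%C) -> in_l2 gamma x /\ l2_norm gamma x = gamma ^ n * Cmod (x n).
Proof.
  intros g0 Hn Hx. destruct n as [|n]; [lia|].
  assert (H : is_series (l2_term gamma x) ((gamma ^ S n * Cmod (x (S n))) ^ 2)).
  { assert (S1 := csum_fst _ _ (csum_single (fun k => RtoC (l2_term gamma x k)) n
      ltac:(intros k Hk; unfold l2_term; rewrite Hx by lia; rewrite Cmod_0; f_equal; ring))).
    exact S1. }
  split; [eexists; exact H|]. unfold l2_norm. rewrite (is_series_unique _ _ H).
  apply sqrt_pow2. apply Rmult_le_pos; [apply pow_le; lra|apply Cmod_ge_0].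
Qed.

Lemma l2_norm_ge (gamma : R) (x : nat -> C) n : 0 < gamma -> (1 <= n)%nat -> in_l2 gamma x ->
  gamma ^ n * Cmod (x n) <= l2_norm gamma x.
Proof.
  intros g0 Hn Hx. destruct n as [|n]; [lia|].
  assert (P : 0 <= gamma ^ S n * Cmod (x (S n))) by (apply Rmult_le_pos; [apply pow_le; lra|apply Cmod_ge_0]).
  rewrite <- (sqrt_pow2 (gamma ^ S n * Cmod (x (S n)))) by auto. apply sqrt_le_1_alt.
  assert (T : forall k, 0 <= l2_term gamma x k) by (intros; apply pow2_ge_0).
  apply Rle_trans with (sum_n (l2_term gamma x) n).
  - destruct n; [rewrite sum_O; apply Rle_refl|]. rewrite sum_Sn. unfold plus; simpl plus.
    assert (Q : 0 <= sum_n (l2_term gamma x) n).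
    { clear - T. induction n; [rewrite sum_O; auto|]. rewrite sum_Sn. unfold plus; simpl. specialize (T (S n)). lra. }
    change ((gamma ^ S (S n) * Cmod (x (S (S n)))) ^ 2) with (l2_term gamma x (S n)).
    change (l2_term gamma x (S n) <= sum_n (l2_term gamma x) n + l2_term gamma x (S n)). lra.
  - apply (is_lim_seq_incr_compare (sum_n (l2_term gamma x))).
    + apply Series_correct; auto.
    + intros k. rewrite sum_Sn. unfold plus; simpl. specialize (T (S k)). lra.
Qed.

(** The operator is applied to the [n]-th unit sequence, of norm [gamma ^ n];
    its image has the [m]-th entry [A m n], which contributes
    [gamma ^ m |A m n|] to the norm. *)
Lemma bounded_operator_entries (gamma : R) (A : mat) : 0 < gamma -> bounded_operator gamma A ->
  exists K, 0 <= K /\ forall m n, (1 <= m)%nat -> (1 <= n)%nat -> gamma ^ m * Cmod (A m n) <= K * gamma ^ n.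
Proof.
  intros g0 [K HK]. exists (Rabs K). split; [apply Rabs_pos|]. intros m n Hm Hn.
  set (e := fun k => if Nat.eq_dec k n then RtoC 1 else RtoC 0).
  assert (En : e n = 1%C) by (unfold e; destruct (Nat.eq_dec n n); tauto).
  assert (Ek : forall k, k <> n -> e k = 0%C) by (intros k Hk; unfold e; destruct (Nat.eq_dec k n); tauto).
  destruct (l2_single gamma e n g0 Hn Ek) as [E1 E2].
  destruct (HK e E1) as [_ [H1 H2]]. rewrite E2, En, Cmod_1, Rmult_1_r in H2.
  assert (Ap : mat_apply A e m = A m n).
  { unfold mat_apply. destruct n as [|n]; [lia|]. rewrite (CSeries_single _ n).
    - rewrite En; ring.
    - intros k Hk. rewrite Ek by lia. ring. }
  assert (B := l2_norm_ge gamma _ m g0 Hm H1). rewrite Ap in B.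
  assert (P : 0 < gamma ^ n) by (apply pow_lt; auto).
  assert (Q := Rle_abs K). nra.
Qed.

(** * Solution of the matrix equations *)

(** Passes from the numbering from [1] of the statement to that of [mmul] from
    [0]. *)
Definition shift (P : mat) : mat := fun i j => P (S i) (S j).

(** Conjugation by the weights [u n = gamma^(n+1)] turns the hypotheses into
    those of [push_through] with [t = th / gamma]: [c0] is [c] divided by the
    weights on both sides, [A0] is [u A u^(-1)], and [d2n] is [d2] times the
    squared weights. The products [N'] and [H'] of that lemma are scaled like
    [c0]. *)
Section Rows.
Context (gamma th : R) (L : nat) (r sigma : nat -> R) (c D4inv Ainv : mat).
Context (g0 : 0 < gamma) (th0 : 0 < th < gamma) (layers : coating gamma L r sigma).
Context (c_bound : exists K, 0 <= K /\ forall m n, (1 <= m)%nat -> (1 <= n)%nat ->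
  Cmod (c m n) <= K * th ^ m * th ^ n).
Context (HD4 : is_inverse gamma (D4 r sigma L) D4inv).
Context (HA : is_inverse gamma
   (D4 r sigma L -- D2 r sigma L ** mat_conj c ** D4inv ** D2 r sigma L ** c)%C Ainv).

Let d1 n := d_entry r sigma L 0 0 (S n).
Let d2 n := d_entry r sigma L 0 1 (S n).
Let d3 n := d_entry r sigma L 1 0 (S n).
Let d4 n := d_entry r sigma L 1 1 (S n).
Let i4 n := / d4 n.
Let kappa := sigma (S L) / sigma 0%nat.
Let u n := gamma ^ S n.
Let v n := / u n.
Let eta := th / gamma.

Let c' := shift c.
Let A' := shift Ainv.
Let G' := mmul (mat_conj c') (rows (fun n => i4 n * d2 n) c').
Let N' := mmul G' A'.
Let H' := mmul c' A'.

Lemma u_pos n : 0 < u n.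
Proof. apply pow_lt; auto. Qed.

Lemma uv n : u n * v n = 1.
Proof. apply Rinv_r. generalize (u_pos n); lra. Qed.

Lemma eta_range : 0 < eta < 1.
Proof.
  unfold eta. split; [apply Rdiv_lt_0_compat; lra|]. apply Rlt_div_l; lra.
Qed.

Lemma D4inv_diag : (forall n, d4 n <> 0) /\ shift D4inv = diag i4.
Proof.
  assert (E : forall i j, (RtoC (d4 i) * D4inv (S i) (S j))%C = diag (fun _ => 1) i j).
  { intros i j. destruct HD4 as [_ [_ H]]. destruct (H (S i) (S j)) as [H1 _]; try lia.
    change ((D4 r sigma L ** D4inv) (S i) (S j)) with (mmul (diag d4) (shift D4inv) i j) in H1.
    rewrite diag_mul in H1. exact H1. }
  assert (N : forall n, d4 n <> 0).
  { intros n Z. specialize (E n n). rewrite Z in E. unfold diag in E. rewrite Nat.eqb_refl in E.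
    apply (f_equal Cmod) in E. rewrite Cmod_mult, Cmod_0, Cmod_1 in E. lra. }
  split; auto. apply mat_ext; intros i j. specialize (E i j). unfold shift.
  assert (NC : RtoC (d4 i) <> 0%C) by (intros Z; apply RtoC_inj in Z; apply (N i Z)).
  replace (D4inv (S i) (S j)) with (/ RtoC (d4 i) * (RtoC (d4 i) * D4inv (S i) (S j)))%C by (field; auto).
  rewrite E. unfold diag, i4. destruct (Nat.eqb_spec i j) as [->|]; [|ring].
  rewrite RtoC_inv by auto. ring.
Qed.

Lemma d4_bounded : bounded_seq d4 /\ bounded_seq i4.
Proof.
  assert (B : forall d M, bounded_operator gamma M -> shift M = diag d -> bounded_seq d).
  { intros d M HM E. destruct (bounded_operator_entries gamma M g0 HM) as [K [K0 HK]].
    exists K; split; auto. intros i. specialize (HK (S i) (S i) ltac:(lia) ltac:(lia)).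
    change (M (S i) (S i)) with (shift M i i) in HK. rewrite E in HK. unfold diag in HK.
    rewrite Nat.eqb_refl, Cmod_R in HK. assert (P : 0 < gamma ^ S i) by (apply pow_lt; auto). nra. }
  destruct HD4 as [H1 [H2 _]]. split.
  - apply (B d4 _ H1). reflexivity.
  - apply (B i4 _ H2). apply D4inv_diag.
Qed.

Lemma d4i4 n : d4 n * i4 n = 1.
Proof. apply Rinv_r, D4inv_diag. Qed.

Lemma d_det n : d1 n * d4 n - d2 n * d3 n = kappa.
Proof. apply (transfer_det gamma L); auto. Qed.

Let d2n n := d2 n * (u n * u n).

Lemma d2n_bounded : bounded_seq d2n.
Proof.
  destruct (transfer_bound gamma L r sigma g0 layers L (le_n L)) as [K [K0 HK]].
  exists K; split; auto. intros n. destruct (HK (S n)) as [_ H].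
  change (entry (transfer_product r sigma (S n) L) 0 1) with (d2 n) in H.
  unfold d2n. assert (P := u_pos n). rewrite Rabs_mult, (Rabs_pos_eq (u n * u n)) by nra.
  rewrite pow_inv in H. replace (2 * S n)%nat with (S n + S n)%nat in H by lia.
  rewrite pow_add in H. fold (u n) in H.
  apply Rle_trans with (K * / (u n * u n) * (u n * u n)).
  - apply Rmult_le_compat_r; auto. nra.
  - apply Req_le. field. lra.
Qed.

Let c0 := rows v (cols c' v).
Let A0 := rows u (cols A' v).

Lemma c0_decays : decays eta true true c0.
Proof.
  destruct c_bound as [K [K0 HK]]. exists (K * eta * eta).
  assert (E := eta_range). split; [apply Rmult_le_pos; [apply Rmult_le_pos; [exact K0|]|]; lra|]. intros i j.
  unfold c0, rows, cols, c', shift, v. rewrite !Cmod_mult, !Cmod_R.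
  assert (Pi := u_pos i). assert (Pj := u_pos j).
  rewrite !Rabs_pos_eq by (apply Rlt_le, Rinv_0_lt_compat; auto).
  apply Rle_trans with (/ u i * (K * th ^ S i * th ^ S j * / u j)).
  - apply Rmult_le_compat_l; [apply Rlt_le, Rinv_0_lt_compat; auto|].
    apply Rmult_le_compat_r; [apply Rlt_le, Rinv_0_lt_compat; auto|]. apply HK; lia.
  - apply Req_le. unfold profile, eta, u, Rdiv. rewrite !Rpow_mult_distr, !pow_inv. simpl. field.
    split; [|split]; try (apply pow_nonzero); lra.
Qed.

Lemma A0_decays : decays eta false false A0.
Proof.
  destruct HA as [_ [HB _]]. destruct (bounded_operator_entries gamma Ainv g0 HB) as [K [K0 HK]].
  exists K; split; auto. intros i j. simpl profile. rewrite !Rmult_1_r.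
  unfold A0, rows, cols, A', shift, v. rewrite !Cmod_mult, !Cmod_R.
  assert (Pi := u_pos i). assert (Pj := u_pos j).
  rewrite (Rabs_pos_eq (u i)), Rabs_pos_eq by (try apply Rlt_le, Rinv_0_lt_compat; lra).
  specialize (HK (S i) (S j) ltac:(lia) ltac:(lia)). fold (u i) (u j) in HK.
  apply Rmult_le_reg_r with (u j); auto. rewrite <- Rmult_assoc, Rmult_assoc, Rinv_l by lra. lra.
Qed.

Lemma A_shift : shift (D4 r sigma L -- D2 r sigma L ** mat_conj c ** D4inv ** D2 r sigma L ** c)%C
  = fun i j => (diag d4 i j - rows d2 G' i j)%C.
Proof.
  apply mat_ext; intros i j.
  change (diag d4 i j - mmul (mmul (mmul (mmul (diag d2) (mat_conj c')) (shift D4inv)) (diag d2)) c' i j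
    = diag d4 i j - rows d2 G' i j)%C.
  rewrite (proj2 D4inv_diag), diag_mul, !mul_diag, !cols_mul, rows_rows, !rows_mul. auto.
Qed.

Lemma scaled_conj d e P : mat_conj (rows d (cols P e)) = rows d (cols (mat_conj P) e).
Proof. rewrite conj_rows, conj_cols; auto. Qed.

Lemma scaled_mul d e f g P Q : (forall n, e n * f n = 1) ->
  mmul (rows d (cols P e)) (rows f (cols Q g)) = rows d (cols (mmul P Q) g).
Proof.
  intros H. rewrite rows_mul, cols_mul, rows_rows, (rows_1 (fun i => e i * f i)) by auto. rewrite mul_cols. auto.
Qed.

Lemma J0_eq : rows (fun n => i4 n * d2n n) c0 = rows u (cols (rows (fun n => i4 n * d2 n) c') v).
Proof.
  apply mat_ext; intros i j. unfold c0, rows, cols, d2n. rewrite !RtoC_mult.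
  replace (RtoC (u i) * (RtoC (i4 i) * RtoC (d2 i) * c' i j * RtoC (v j)))%C
    with (RtoC (u i * v i) * (RtoC (u i) * (RtoC (i4 i) * RtoC (d2 i) * c' i j * RtoC (v j))))%C.
  - rewrite RtoC_mult. ring.
  - rewrite uv. ring.
Qed.

Lemma G0_eq : mmul (mat_conj c0) (rows (fun n => i4 n * d2n n) c0) = rows v (cols G' v).
Proof.
  rewrite J0_eq. unfold c0. rewrite scaled_conj. apply scaled_mul.
  intros n; rewrite Rmult_comm; apply uv.
Qed.

Lemma N0_eq : mmul (rows v (cols G' v)) A0 = rows v (cols N' v).
Proof. apply scaled_mul. intros n; rewrite Rmult_comm; apply uv. Qed.

Lemma H0_eq : mmul c0 A0 = rows v (cols H' v).
Proof. apply scaled_mul. intros n; rewrite Rmult_comm; apply uv. Qed.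

Lemma d2n_rows P : rows d2n (rows v P) = rows u (rows d2 P).
Proof.
  apply mat_ext; intros i j. unfold rows, d2n. rewrite !RtoC_mult.
  replace (RtoC (u i) * (RtoC (d2 i) * P i j))%C
    with (RtoC (u i * v i) * (RtoC (u i) * (RtoC (d2 i) * P i j)))%C.
  - rewrite RtoC_mult. ring.
  - rewrite uv; ring.
Qed.

Lemma diag_scaled : rows u (cols (diag (fun _ => 1)) v) = diag (fun _ => 1).
Proof.
  apply mat_ext; intros i j. unfold rows, cols, diag. destruct (Nat.eqb_spec i j) as [->|]; [|ring].
  rewrite Cmult_1_l, <- RtoC_mult, uv. auto.
Qed.

Lemma GA_csum i j : csum (fun k => G' i k * A' k j)%C (N' i j).
Proof.
  assert (E := eta_range).
  assert (DG : decays eta true true (rows v (cols G' v))).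
  { rewrite <- G0_eq. apply (decays_mul eta E true true true true); auto.
    - apply decays_conj, c0_decays.
    - apply decays_rows; [apply bounded_mul; [apply d4_bounded|apply d2n_bounded]|apply c0_decays]. }
  assert (S1 := mul_csum eta E true true false false _ _ eq_refl DG A0_decays i j).
  rewrite N0_eq in S1. apply (csum_scal (RtoC (u i) * RtoC (u j))%C) in S1.
  replace (N' i j) with (RtoC (u i) * RtoC (u j) * rows v (cols N' v) i j)%C.
  - apply csum_ext with (2 := S1). intros k. unfold A0, rows, cols.
    transitivity (RtoC (u i * v i) * RtoC (u k * v k) * RtoC (u j * v j) * (G' i k * A' k j))%C.
    + rewrite !RtoC_mult. ring.
    + rewrite !uv. ring.
  - unfold rows, cols. transitivity (RtoC (u i * v i) * RtoC (u j * v j) * N' i j)%C.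
    + rewrite !RtoC_mult. ring.
    + rewrite !uv. ring.
Qed.

Lemma HG_csum i j : csum (fun k => A' i k * (RtoC (d2 k) * G' k j))%C (mmul A' (rows d2 G') i j).
Proof.
  assert (E := eta_range).
  assert (DG : decays eta true true (rows v (cols G' v))).
  { rewrite <- G0_eq. apply (decays_mul eta E true true true true); auto.
    - apply decays_conj, c0_decays.
    - apply decays_rows; [apply bounded_mul; [apply d4_bounded|apply d2n_bounded]|apply c0_decays]. }
  assert (S1 := mul_csum eta E false false true true _ _ eq_refl A0_decays (decays_rows eta _ _ _ _ d2n_bounded DG) i j).
  rewrite d2n_rows in S1. unfold A0 in S1. rewrite (rows_cols d2 G' v) in S1.
  rewrite (scaled_mul u v u v A' (rows d2 G')) in S1 by (intros n; rewrite Rmult_comm; apply uv).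
  apply (csum_scal (RtoC (v i) * RtoC (u j))%C) in S1.
  replace (mmul A' (rows d2 G') i j) with (RtoC (v i) * RtoC (u j) * rows u (cols (mmul A' (rows d2 G')) v) i j)%C.
  - apply csum_ext with (2 := S1). intros k. unfold rows, cols.
    transitivity (RtoC (u i * v i) * RtoC (u k * v k) * RtoC (u j * v j) * (A' i k * (RtoC (d2 k) * G' k j)))%C.
    + rewrite !RtoC_mult. ring.
    + rewrite !uv. ring.
  - unfold rows at 1, cols at 1.
    transitivity (RtoC (u i * v i) * RtoC (u j * v j) * mmul A' (rows d2 G') i j)%C.
    + rewrite !RtoC_mult. ring.
    + rewrite !uv. ring.
Qed.

(** The matrix [A] is a two-sided inverse entry by entry; splitting the series
    of [(D4 - D2 G) A] into two requires the convergence of that of [G A]. *)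
Lemma AA_left : rows d4 A' = madd (diag (fun _ => 1)) (rows d2 N').
Proof.
  apply mat_ext; intros i j. destruct HA as [_ [_ H]].
  destruct (H (S i) (S j)) as [H1 _]; try lia.
  match type of H1 with ?x = _ => change x with (mmul (shift (D4 r sigma L -- D2 r sigma L ** mat_conj c ** D4inv ** D2 r sigma L ** c)%C) A' i j) in H1 end.
  rewrite A_shift in H1. change (identity (S i) (S j)) with (diag (fun _ => 1) i j) in H1.
  assert (S1 := csum_minus _ _ _ _ (csum_single (fun k => diag d4 i k * A' k j)%C i
     ltac:(intros k Hk; unfold diag; apply Nat.neq_sym, Nat.eqb_neq in Hk; rewrite Hk; ring))
     (csum_scal (RtoC (d2 i)) _ _ (GA_csum i j))).
  unfold madd. rewrite <- H1. unfold mmul at 1.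
  rewrite (csum_CSeries _ (diag d4 i i * A' i j - RtoC (d2 i) * N' i j)%C).
  - unfold diag, rows. rewrite Nat.eqb_refl. ring.
  - apply csum_ext with (2 := S1). intros k. unfold rows. ring.
Qed.

Lemma AA_right : cols A' d4 = madd (diag (fun _ => 1)) (mmul A' (rows d2 G')).
Proof.
  apply mat_ext; intros i j. destruct HA as [_ [_ H]].
  destruct (H (S i) (S j)) as [_ H1]; try lia.
  match type of H1 with ?x = _ => change x with (mmul A' (shift (D4 r sigma L -- D2 r sigma L ** mat_conj c ** D4inv ** D2 r sigma L ** c)%C) i j) in H1 end.
  rewrite A_shift in H1. change (identity (S i) (S j)) with (diag (fun _ => 1) i j) in H1.
  assert (S1 := csum_minus _ _ _ _ (csum_single (fun k => A' i k * diag d4 k j)%C j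
     ltac:(intros k Hk; unfold diag; apply Nat.eqb_neq in Hk; rewrite Hk; ring))
     (HG_csum i j)).
  unfold madd. rewrite <- H1. unfold mmul at 1.
  rewrite (csum_CSeries _ (A' i j * diag d4 j j - mmul A' (rows d2 G') i j)%C).
  - unfold diag, cols. rewrite Nat.eqb_refl. ring.
  - apply csum_ext with (2 := S1). intros k. unfold rows. ring.
Qed.

Lemma push0 :
  madd c0 (mmul (mat_conj (rows v (cols N' v))) (rows d2n c0)) = cols (rows v (cols H' v)) d4 /\
  mmul (mat_conj (rows v (cols H' v))) (rows d2n c0) = cols (rows v (cols N' v)) d4.
Proof.
  destruct d4_bounded as [B1 B2].
  assert (P := push_through eta eta_range c0 A0 d2n d4 i4 c0_decays A0_decays d2n_bounded B1 B2 d4i4).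
  cbv zeta in P. rewrite G0_eq, N0_eq, H0_eq in P. apply P.
  - rewrite d2n_rows. unfold A0. transitivity (rows u (cols (rows d4 A') v)).
    + apply mat_ext; intros i j; unfold rows, cols; ring.
    + rewrite AA_left. rewrite <- diag_scaled at 2.
      apply mat_ext; intros i j; unfold madd, rows, cols; ring.
  - rewrite d2n_rows. unfold A0. rewrite (rows_cols d2 G' v), (scaled_mul u v u v A' (rows d2 G')) by (intros n; rewrite Rmult_comm; apply uv).
    transitivity (rows u (cols (cols A' d4) v)).
    + apply mat_ext; intros i j; unfold rows, cols; ring.
    + rewrite AA_right. rewrite <- diag_scaled at 2.
      apply mat_ext; intros i j; unfold madd, rows, cols; ring.
Qed.

Lemma N0_decays : decays eta true false (rows v (cols N' v)).
Proof.
  assert (E := eta_range). rewrite <- N0_eq, <- G0_eq.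
  apply (decays_mul eta E true true false false); auto; [|apply A0_decays].
  apply (decays_mul eta E true true true true); auto.
  - apply decays_conj, c0_decays.
  - apply decays_rows; [apply bounded_mul; [apply d4_bounded|apply d2n_bounded]|apply c0_decays].
Qed.

Lemma H0_decays : decays eta true false (rows v (cols H' v)).
Proof.
  assert (E := eta_range). rewrite <- H0_eq.
  apply (decays_mul eta E true true false false); auto; [apply c0_decays|apply A0_decays].
Qed.

Lemma unscale_csum (P : mat) (x : C) i j :
  csum (fun k => mat_conj (rows v (cols P v)) i k * rows d2n c0 k j)%C (RtoC (v i) * RtoC (v j) * x)%C ->
  csum (fun k => Cconj (P i k) * RtoC (d2 k) * c' k j)%C x.
Proof.
  intros S1. apply (csum_scal (RtoC (u i) * RtoC (u j))%C) in S1.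
  replace x with (RtoC (u i) * RtoC (u j) * (RtoC (v i) * RtoC (v j) * x))%C.
  - apply csum_ext with (2 := S1). intros k. unfold c0, rows, cols, mat_conj, d2n.
    rewrite !Cmult_conj, !Cconj_RtoC.
    transitivity (RtoC (u i * v i) * RtoC (u k * v k) * RtoC (u k * v k) * RtoC (u j * v j) * (Cconj (P i k) * RtoC (d2 k) * c' k j))%C.
    + rewrite !RtoC_mult. ring.
    + rewrite !uv. ring.
  - transitivity (RtoC (u i * v i) * RtoC (u j * v j) * x)%C.
    + rewrite !RtoC_mult. ring.
    + rewrite !uv. ring.
Qed.

Lemma N_conj_csum i j : csum (fun k => Cconj (N' i k) * RtoC (d2 k) * c' k j)%C (H' i j * RtoC (d4 j) - c' i j)%C.
Proof.
  assert (E := eta_range). apply unscale_csum.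
  assert (S1 := mul_csum eta E true false true true _ _ eq_refl (decays_conj eta _ _ _ N0_decays)
     (decays_rows eta _ _ _ _ d2n_bounded c0_decays) i j).
  assert (X := f_equal (fun M : mat => M i j) (proj1 push0)). unfold madd in X.
  replace (RtoC (v i) * RtoC (v j) * (H' i j * RtoC (d4 j) - c' i j))%C with
    (mmul (mat_conj (rows v (cols N' v))) (rows d2n c0) i j); [exact S1|].
  replace (mmul (mat_conj (rows v (cols N' v))) (rows d2n c0) i j) with
    (c0 i j + mmul (mat_conj (rows v (cols N' v))) (rows d2n c0) i j - c0 i j)%C by ring.
  rewrite X. unfold c0, rows, cols. ring.
Qed.

Lemma H_conj_csum i j : csum (fun k => Cconj (H' i k) * RtoC (d2 k) * c' k j)%C (N' i j * RtoC (d4 j))%C.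
Proof.
  assert (E := eta_range). apply unscale_csum.
  assert (S1 := mul_csum eta E true false true true _ _ eq_refl (decays_conj eta _ _ _ H0_decays)
     (decays_rows eta _ _ _ _ d2n_bounded c0_decays) i j).
  rewrite (proj2 push0) in S1.
  replace (RtoC (v i) * RtoC (v j) * (N' i j * RtoC (d4 j)))%C with
    (cols (rows v (cols N' v)) d4 i j); [exact S1|]. unfold rows, cols. ring.
Qed.

(** Undoing the weights turns decay of ratio [th / gamma] into [th ^ j]. *)
Lemma unscale_decay (P : mat) i : decays eta true true (rows v (cols P v)) ->
  exists K, forall j, Cmod (P i j) <= K * th ^ j.
Proof.
  intros [K [K0 HK]]. exists (u i * K * profile eta true i * gamma). intros j. specialize (HK i j).
  assert (Pi := u_pos i). assert (Pj := u_pos j).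
  replace (P i j) with (RtoC (u i) * RtoC (u j) * rows v (cols P v) i j)%C.
  - rewrite !Cmod_mult, !Cmod_RtoC_pos by lra.
    apply Rle_trans with (u i * u j * (K * profile eta true i * profile eta true j)).
    + apply Rmult_le_compat_l; auto. nra.
    + apply Req_le. change (profile eta true j) with (eta ^ j).
      change (u j) with (gamma * gamma ^ j). replace (th ^ j) with ((eta * gamma) ^ j) by (f_equal; unfold eta; field; lra).
      rewrite Rpow_mult_distr. ring.
  - unfold rows, cols. transitivity (RtoC (u i * v i) * RtoC (u j * v j) * P i j)%C.
    + rewrite !RtoC_mult. ring.
    + rewrite !uv. ring.
Qed.

(** [N' D4] is a product in which the last factor [c] decays along the rows,
    by the push-through identities; [H'] is treated in the same way. *)
Lemma N_decay i : exists K, forall j, Cmod (N' i j) <= K * th ^ j.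
Proof.
  assert (E := eta_range). apply unscale_decay.
  replace (rows v (cols N' v)) with (cols (cols (rows v (cols N' v)) d4) i4).
  - apply decays_cols; [apply d4_bounded|]. rewrite <- (proj2 push0).
    apply (decays_mul eta E true false true true); auto; [apply decays_conj, H0_decays|].
    apply decays_rows; [apply d2n_bounded|apply c0_decays].
  - apply mat_ext; intros a b. unfold cols. rewrite <- !Cmult_assoc, <- (RtoC_mult (d4 b)), d4i4. ring.
Qed.

Lemma H_decay i : exists K, forall j, Cmod (H' i j) <= K * th ^ j.
Proof.
  assert (E := eta_range). apply unscale_decay.
  replace (rows v (cols H' v)) with (cols (cols (rows v (cols H' v)) d4) i4).
  - apply decays_cols; [apply d4_bounded|]. rewrite <- (proj1 push0).
    apply decays_add; [apply c0_decays|].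
    apply (decays_mul eta E true false true true); auto; [apply decays_conj, N0_decays|].
    apply decays_rows; [apply d2n_bounded|apply c0_decays].
  - apply mat_ext; intros a b. unfold cols. rewrite <- !Cmult_assoc, <- (RtoC_mult (d4 b)), d4i4. ring.
Qed.

(** The solution [X], [Y] of the two matrix equations: the exterior field of
    the background [alpha F_m] has the coefficients
    [alpha X m n + Cconj alpha Y m n] at [w^(-n)], and the tensors will be
    [4 pi n (c - X)] and [- 4 pi n Y]. *)
Definition fieldX (m n : nat) : C := (RtoC kappa * (D4inv ** c ** Ainv) m n)%C.
Definition fieldY (m n : nat) : C :=
  (- ((D3 r sigma L -- D1 r sigma L ** mat_conj c ** D4inv ** D2 r sigma L ** c) ** Ainv) m n)%C.

Lemma fieldX_eq i j : fieldX (S i) (S j) = (RtoC (kappa * i4 i) * H' i j)%C.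
Proof.
  unfold fieldX.
  change ((D4inv ** c ** Ainv) (S i) (S j)) with (mmul (mmul (shift D4inv) c') A' i j).
  rewrite (proj2 D4inv_diag), diag_mul, rows_mul. unfold rows. rewrite RtoC_mult. fold H'. ring.
Qed.

(** By [AA_left], [A = D4^(-1) (1 + D2 N)], so that
    [(D3 - D1 G) A = D3 D4^(-1) - (D1 - D2 D3 D4^(-1)) N], and the last
    coefficient is [kappa / d4]. *)
Lemma fieldY_eq i j : fieldY (S i) (S j) =
  (RtoC (kappa * i4 i) * N' i j - diag (fun n => (d3 n * i4 n)%R) i j)%C.
Proof.
  unfold fieldY.
  change (((D3 r sigma L -- D1 r sigma L ** mat_conj c ** D4inv ** D2 r sigma L ** c) ** Ainv)%C (S i) (S j))
   with (mmul (fun i j => diag d3 i j - mmul (mmul (mmul (mmul (diag d1) (mat_conj c')) (shift D4inv)) (diag d2)) c' i j)%C A' i j).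
  rewrite (proj2 D4inv_diag), diag_mul, !mul_diag, !cols_mul, rows_rows, !rows_mul. fold G'.
  assert (S1 := csum_minus _ _ _ _ (csum_single (fun k => diag d3 i k * A' k j)%C i
     ltac:(intros k Hk; unfold diag; apply Nat.neq_sym, Nat.eqb_neq in Hk; rewrite Hk; ring))
     (csum_scal (RtoC (d1 i)) _ _ (GA_csum i j))).
  unfold mmul at 1.
  rewrite (csum_CSeries _ (diag d3 i i * A' i j - RtoC (d1 i) * N' i j)%C);
    [|apply csum_ext with (2 := S1); intros k; unfold rows; ring].
  assert (EA : A' i j = (RtoC (i4 i) * (diag (fun _ => 1) i j + RtoC (d2 i) * N' i j))%C).
  { assert (X := f_equal (fun M : mat => M i j) AA_left). unfold rows, madd in X. rewrite <- X.
    rewrite Cmult_assoc, <- RtoC_mult, (Rmult_comm (i4 i)), d4i4. ring. }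
  rewrite EA.
  assert (Ek : kappa * i4 i = d1 i - d2 i * d3 i * i4 i).
  { rewrite <- (d_det i). rewrite Rmult_minus_distr_r, Rmult_assoc, d4i4. ring. }
  rewrite Ek. unfold diag. rewrite Nat.eqb_refl, RtoC_minus, !RtoC_mult.
  destruct (Nat.eqb_spec i j) as [->|]; rewrite ?RtoC_mult; ring.
Qed.

(** In [fieldY_eq] the diagonal part has a single entry in each row. *)
Theorem field_decay m : (1 <= m)%nat -> exists K, forall n, (1 <= n)%nat ->
  Cmod (fieldX m n) <= K * th ^ n /\ Cmod (fieldY m n) <= K * th ^ n.
Proof.
  intros Hm. destruct m as [|i]; [lia|].
  destruct (N_decay i) as [K1 H1]. destruct (H_decay i) as [K2 H2].
  assert (P1 := geo_K_pos _ _ _ H1). assert (P2 := geo_K_pos _ _ _ H2).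
  set (k := Rabs (kappa * i4 i)). set (D := Rabs (d3 i * i4 i)).
  assert (k0 : 0 <= k) by apply Rabs_pos. assert (D0 : 0 <= D) by apply Rabs_pos.
  assert (ti : 0 < th ^ i) by (apply pow_lt; lra).
  exists ((k * (K1 + K2) + D / th ^ i) / th). intros n Hn. destruct n as [|j]; [lia|].
  rewrite fieldX_eq, fieldY_eq.
  assert (tj : 0 < th ^ j) by (apply pow_lt; lra).
  assert (Q : 0 <= D / th ^ i * th ^ j).
  { apply Rmult_le_pos; [|lra]. apply Rmult_le_pos; auto. apply Rlt_le, Rinv_0_lt_compat; auto. }
  replace ((k * (K1 + K2) + D / th ^ i) / th * th ^ S j) with (k * K1 * th ^ j + k * K2 * th ^ j + D / th ^ i * th ^ j)
    by (simpl; field; split; try lra; apply pow_nonzero; lra).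
  assert (T1 : k * Cmod (N' i j) <= k * (K1 * th ^ j)) by (apply Rmult_le_compat_l; auto).
  assert (T2 : k * Cmod (H' i j) <= k * (K2 * th ^ j)) by (apply Rmult_le_compat_l; auto).
  assert (T3 : Cmod (diag (fun n => d3 n * i4 n) i j) <= D / th ^ i * th ^ j).
  { unfold diag. destruct (Nat.eqb_spec i j) as [->|]; [|rewrite Cmod_0; auto].
    rewrite Cmod_R. fold D. unfold Rdiv. rewrite Rmult_assoc, Rinv_l by lra. lra. }
  assert (T4 : 0 <= k * K1 * th ^ j) by (repeat apply Rmult_le_pos; lra).
  assert (T5 : 0 <= k * K2 * th ^ j) by (repeat apply Rmult_le_pos; lra).
  split.
  - rewrite Cmod_mult, Cmod_R. fold k. lra.
  - eapply Rle_trans; [apply Cmod_sub_le|]. rewrite Cmod_mult, Cmod_R. fold k. lra.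
Qed.

(** The equation [X D4 = D1 c + conj Y D2 c]: by [fieldX_eq] and [fieldY_eq]
    it is a multiple of the first push-through identity, plus a diagonal term
    accounted for by the determinant. *)
Theorem field_X_identity m n : (1 <= m)%nat -> (1 <= n)%nat ->
  csum (fun k => Cconj (fieldY m (S k)) * RtoC (d_entry r sigma L 0 1 (S k)) * c (S k) n)%C
    (fieldX m n * RtoC (d_entry r sigma L 1 1 n) - RtoC (d_entry r sigma L 0 0 m) * c m n)%C.
Proof.
  intros Hm Hn. destruct m as [|i]; [lia|]. destruct n as [|j]; [lia|].
  rewrite fieldX_eq. fold (d4 j) (d1 i). change (c (S i) (S j)) with (c' i j).
  assert (S1 := csum_minus _ _ _ _ (csum_scal (RtoC (kappa * i4 i)) _ _ (N_conj_csum i j))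
    (csum_single (fun k => diag (fun n => (d3 n * i4 n)%R) i k * (RtoC (d2 k) * c' k j))%C i
     ltac:(intros k Hk; unfold diag; apply Nat.neq_sym, Nat.eqb_neq in Hk; rewrite Hk; ring))).
  match type of S1 with csum _ ?x => replace (RtoC (kappa * i4 i) * H' i j * RtoC (d4 j) - RtoC (d1 i) * c' i j)%C with x end.
  - apply csum_ext with (2 := S1). intros k. rewrite fieldY_eq. fold (d2 k). change (c (S k) (S j)) with (c' k j).
    rewrite Cminus_conj, Cmult_conj, Cconj_RtoC.
    change (Cconj (diag (fun n => (d3 n * i4 n)%R) i k)) with (mat_conj (diag (fun n => (d3 n * i4 n)%R)) i k).
    rewrite conj_diag. ring.
  - unfold diag. rewrite Nat.eqb_refl.
    assert (Ek : kappa * i4 i = d1 i - d2 i * d3 i * i4 i).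
    { rewrite <- (d_det i). rewrite Rmult_minus_distr_r, Rmult_assoc, d4i4. ring. }
    rewrite Ek, RtoC_minus, !RtoC_mult. ring.
Qed.

(** The equation [Y D4 = conj X D2 c - D3], from the second push-through
    identity. *)
Theorem field_Y_identity m n : (1 <= m)%nat -> (1 <= n)%nat ->
  csum (fun k => Cconj (fieldX m (S k)) * RtoC (d_entry r sigma L 0 1 (S k)) * c (S k) n)%C
    (D3 r sigma L m n + fieldY m n * RtoC (d_entry r sigma L 1 1 n))%C.
Proof.
  intros Hm Hn. destruct m as [|i]; [lia|]. destruct n as [|j]; [lia|].
  rewrite fieldY_eq. fold (d4 j). change (D3 r sigma L (S i) (S j)) with (diag d3 i j).
  assert (S1 := csum_scal (RtoC (kappa * i4 i)) _ _ (H_conj_csum i j)).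
  match type of S1 with csum _ ?x => match goal with |- csum _ ?y => replace y with x end end.
  - apply csum_ext with (2 := S1). intros k. rewrite fieldX_eq. fold (d2 k). change (c (S k) (S j)) with (c' k j).
    rewrite Cmult_conj, Cconj_RtoC. ring.
  - unfold diag. destruct (Nat.eqb_spec i j) as [->|]; [|ring].
    transitivity (RtoC (kappa * i4 j) * N' j j * RtoC (d4 j) + RtoC (d3 j) * (1 - RtoC (d4 j * i4 j)))%C.
    + rewrite d4i4. ring.
    + rewrite !RtoC_mult. ring.
Qed.
End Rows.

(** * The solution of the transmission problem *)

Definition tapply (M : matrix (T := R) 2 2) (x : C * C) : C * C :=
  (RtoC (entry M 0 0) * fst x + RtoC (entry M 0 1) * snd x,
   RtoC (entry M 1 0) * fst x + RtoC (entry M 1 1) * snd x)%C.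

Lemma tapply_mul A B x : tapply (Mmult A B) x = tapply A (tapply B x).
Proof.
  unfold tapply; cbn [fst snd]. rewrite !entry_Mmult by lia.
  rewrite !RtoC_plus, !RtoC_mult. f_equal; ring.
Qed.

(** A function that vanishes just outside of a circle vanishes to first order
    at the points of the circle where it is differentiable. *)
Lemma deriv_zero (h : C -> C) (w0 l : C) (d : R) : 0 < Cmod w0 -> 0 < d -> cderiv h w0 l ->
  (forall w, Cmod w0 < Cmod w -> Cmod (w - w0)%C < d -> h w = 0%C) -> h w0 = 0%C /\ l = 0%C.
Proof.
  intros H0 d0 Hl Hz.
  assert (Pt : forall e, 0 < e -> exists v, Cmod w0 < Cmod v /\ Cmod (v - w0)%C < e /\ h v = 0%C).
  { intros e He. destruct (radial_point w0 (Rmin e d) H0) as [v [V1 V2]]; [apply Rmin_pos; auto|].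
    exists v. split; auto. split; [eapply Rlt_le_trans; [exact V2|apply Rmin_l]|].
    apply Hz; auto. eapply Rlt_le_trans; [exact V2|apply Rmin_r]. }
  assert (E0 : h w0 = 0%C).
  { apply cont_zero; [apply (cderiv_cont _ _ _ Hl)|]. intros e He.
    destruct (Pt e He) as [v [_ [V2 V3]]]. exists v; auto. }
  split; auto. destruct Hl as [k [K1 [K2 K3]]]. rewrite <- K2. apply cont_zero; auto.
  intros e He. destruct (Pt e He) as [v [V1 [V2 V3]]]. exists v; split; auto.
  specialize (K1 v). rewrite V3, E0 in K1.
  assert (N : (v - w0)%C <> 0%C) by (intros E1; apply Ceq_minus in E1; subst v; lra).
  replace (k v) with (k v * (v - w0) * / (v - w0))%C by (field; auto). rewrite <- K1. ring.
Qed.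

Section Solution.
Context (Omega0 : C -> Prop) (gamma : R) (Psi : C -> C) (a : nat -> C).
Context (Omega0_open : open (T := C_UniformSpace) Omega0) (Omega0_bounded : bounded Omega0).
Context (HPsi : exterior_conformal_map Omega0 gamma Psi a).
Context (F : nat -> C -> C) (HF : faber_polynomials Omega0 gamma Psi F).
Context (c : mat) (Hc : grunsky_matrix gamma Psi F c).
Context (L : nat) (r sigma : nat -> R) (layers : coating gamma L r sigma).
Context (th : R) (th0 : 0 < th < gamma).
Context (c_bound : exists K, 0 <= K /\ forall m n, (1 <= m)%nat -> (1 <= n)%nat ->
  Cmod (c m n) <= K * th ^ m * th ^ n).
Context (m0 : nat) (m0_pos : (1 <= m0)%nat) (alpha : C) (q : nat -> C).
Context (q_0 : q 0%nat = 0%C) (q_bound : exists K, forall n, Cmod (q n) <= K * th ^ n).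

Definition ext_coef (n : nat) : C * C := (if Nat.eq_dec n m0 then alpha else RtoC 0, Cconj (q n)).

(** The pairs [(p_n, conj q_n)] obtained by stepping inwards from the
    exterior; [i] counts the crossed interfaces. *)
Fixpoint back (n i : nat) : C * C :=
  match i with
  | O => ext_coef n
  | S k => tapply (transfer r sigma n (L - k)) (back n k)
  end.

Definition layer_coef (j n : nat) : C * C := back n (S L - j).

Definition pcoef (j n : nat) : C := fst (layer_coef j n).
Definition qcoef (j n : nat) : C := Cconj (snd (layer_coef j n)).

Lemma layer_coef_step j n : (j <= L)%nat ->
  layer_coef j n = tapply (transfer r sigma n j) (layer_coef (S j) n).
Proof.
  intros Hj. unfold layer_coef. replace (S L - j)%nat with (S (L - j)) by lia.
  simpl back. replace (L - (L - j))%nat with j by lia. auto.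
Qed.

Lemma layer_coef_ext n : layer_coef (S L) n = ext_coef n.
Proof. unfold layer_coef. rewrite Nat.sub_diag. auto. Qed.

(** The transfer matrices along the way multiply up to the matrix of the
    numbers [d_n]. *)
Lemma layer_coef_core n : layer_coef 0 n = tapply (transfer_product r sigma n L) (ext_coef n).
Proof.
  assert (H : forall j, (j <= L)%nat ->
    layer_coef 0 n = tapply (transfer_product r sigma n j) (layer_coef (S j) n)).
  { induction j; intros Hj; [apply layer_coef_step; lia|].
    rewrite IHj by lia. rewrite (layer_coef_step (S j)) by lia.
    simpl transfer_product. rewrite tapply_mul. auto. }
  rewrite <- layer_coef_ext. apply H; lia.
Qed.

Context (core_identity : forall n, (1 <= n)%nat ->
  csum (fun k => pcoef 0 (S k) * c (S k) n)%C (qcoef 0 n)).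

Lemma g_pos : 0 < gamma.
Proof. lra. Qed.

Lemma ext_coef_0 : ext_coef 0 = (RtoC 0, RtoC 0).
Proof.
  unfold ext_coef. destruct (Nat.eq_dec 0 m0); [lia|]. rewrite q_0. f_equal.
  apply (Cconj_RtoC 0).
Qed.

Lemma layer_coef_0 j : layer_coef j 0 = (RtoC 0, RtoC 0).
Proof.
  unfold layer_coef. induction (S L - j)%nat as [|k IH]; simpl; [apply ext_coef_0|].
  rewrite IH. unfold tapply; cbn [fst snd]. f_equal; ring.
Qed.

Lemma r_ge j : (j <= L)%nat -> gamma <= r j.
Proof. apply (layers_r_pos gamma L r sigma layers). Qed.

Lemma r_mono i j : (i <= j)%nat -> (j <= L)%nat -> r i <= r j.
Proof. apply (layers_r_le gamma L r sigma layers). Qed.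

Lemma ext_p_bound t : 0 < t -> exists K, 0 <= K /\ forall n, Cmod (fst (ext_coef n)) <= K * t ^ n.
Proof.
  intros Ht. assert (P : 0 < t ^ m0) by (apply pow_lt; auto).
  exists (Cmod alpha / t ^ m0). split.
  { apply Rmult_le_pos; [apply Cmod_ge_0|apply Rlt_le, Rinv_0_lt_compat; auto]. }
  intros n. unfold ext_coef; cbn [fst]. destruct (Nat.eq_dec n m0) as [->|_].
  - apply Req_le. field. lra.
  - rewrite Cmod_0. repeat apply Rmult_le_pos; [apply Cmod_ge_0|apply Rlt_le, Rinv_0_lt_compat; auto|apply pow_le; lra].
Qed.

(** In layer [j] the series in [w^(-n)] converges for [|w| > th] and that in
    [w^n] for [|w| < r_j^2 / th], hence both converge beyond the interfaces
    [r_(j-1)] and [r_j]. Crossing an interface multiplies [p] and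
    [conj q r^(-2n)] by bounded numbers and mixes them, which preserves these
    bounds. *)
Lemma layer_coef_bound j : (j <= L)%nat -> exists K, 0 <= K /\ forall n,
  Cmod (fst (layer_coef j n)) <= K * (th / (r j * r j)) ^ n /\
  Cmod (snd (layer_coef j n)) <= K * th ^ n.
Proof.
  intros Hj.
  assert (St : forall j, (j <= L)%nat ->
    (exists K, 0 <= K /\ forall n, Cmod (fst (layer_coef (S j) n)) <= K * (th / (r j * r j)) ^ n /\
       Cmod (snd (layer_coef (S j) n)) <= K * th ^ n) ->
    exists K, 0 <= K /\ forall n, Cmod (fst (layer_coef j n)) <= K * (th / (r j * r j)) ^ n /\
       Cmod (snd (layer_coef j n)) <= K * th ^ n).
  { clear j Hj. intros j Hj [K [K0 HK]]. set (s := sigma (S j) / sigma j).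
    set (M := Rabs ((1 + s) / 2) + Rabs ((1 - s) / 2)).
    assert (A1 := Rabs_pos ((1 + s) / 2)). assert (A2 := Rabs_pos ((1 - s) / 2)).
    exists (K * M). split; [apply Rmult_le_pos; auto; unfold M; lra|]. intros n.
    destruct (HK n) as [H1 H2]. rewrite layer_coef_step by auto. unfold tapply; cbn [fst snd].
    change (entry (transfer r sigma n j) 0 0) with ((1 + s) / 2).
    change (entry (transfer r sigma n j) 1 1) with ((1 + s) / 2).
    change (entry (transfer r sigma n j) 0 1) with ((1 - s) * / r j ^ (2 * n) / 2).
    change (entry (transfer r sigma n j) 1 0) with ((1 - s) * r j ^ (2 * n) / 2).
    assert (Rj := r_ge j Hj). set (x := r j ^ (2 * n)).
    assert (x0 : 0 < x) by (apply pow_lt; lra).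
    assert (Et : (th / (r j * r j)) ^ n = th ^ n * / x).
    { unfold Rdiv, x. rewrite Rpow_mult_distr, pow_inv. f_equal. f_equal.
      replace (2 * n)%nat with (n + n)%nat by lia. rewrite pow_add, Rpow_mult_distr. auto. }
    rewrite Et in *. assert (T0 : 0 < th ^ n) by (apply pow_lt; lra).
    assert (xi : 0 < / x) by (apply Rinv_0_lt_compat; auto).
    set (p := fst (layer_coef (S j) n)) in *. set (y := snd (layer_coef (S j) n)) in *.
    assert (Y1 : / x * Cmod y <= / x * (K * th ^ n)) by (apply Rmult_le_compat_l; lra).
    assert (P1 : x * Cmod p <= K * th ^ n).
    { apply Rle_trans with (x * (K * (th ^ n * / x))); [apply Rmult_le_compat_l; lra|].
      apply Req_le. field. lra. }
    assert (Comb : forall u v al be Z, Cmod u <= Z -> Cmod v <= Z ->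
       Cmod (RtoC al * u + RtoC be * v)%C <= Z * (Rabs al + Rabs be)).
    { intros u v al be Z Hu Hv. eapply Rle_trans; [apply Cmod_triangle|]. rewrite !Cmod_mult, !Cmod_R.
      assert (B1 := Rabs_pos al). assert (B2 := Rabs_pos be). nra. }
    split.
    - replace (RtoC ((1 - s) * / x / 2) * y)%C with (RtoC ((1 - s) / 2) * (RtoC (/ x) * y))%C
        by (rewrite Cmult_assoc, <- RtoC_mult; do 2 f_equal; field; lra).
      eapply Rle_trans; [apply (Comb _ _ _ _ (K * (th ^ n * / x)))|].
      + exact H1.
      + rewrite Cmod_mult, Cmod_RtoC_pos by lra. lra.
      + unfold M. lra.
    - replace (RtoC ((1 - s) * x / 2) * p)%C with (RtoC ((1 - s) / 2) * (RtoC x * p))%C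
        by (rewrite Cmult_assoc, <- RtoC_mult; do 2 f_equal; field).
      eapply Rle_trans; [apply (Comb _ _ _ _ (K * th ^ n))|].
      + rewrite Cmod_mult, Cmod_RtoC_pos by lra. lra.
      + exact H2.
      + unfold M. lra. }
  (* Downward induction from the exterior, where [p] is finitely supported and
     therefore bounded by any geometric sequence. *)
  remember (L - j)%nat as k eqn:Ek. revert j Hj Ek. induction k; intros j Hj Ek.
  - apply St; auto. replace j with L by lia.
    assert (RL := r_ge L (le_n L)).
    destruct (ext_p_bound (th / (r L * r L))) as [K1 [P1 H1]]; [apply Rdiv_lt_0_compat; nra|].
    destruct q_bound as [K2 H2]. assert (P2 := geo_K_pos _ _ _ H2).
    exists (K1 + K2). split; [lra|]. intros n. rewrite layer_coef_ext.
    assert (T1 : 0 <= (th / (r L * r L)) ^ n) by (apply pow_le, Rlt_le, Rdiv_lt_0_compat; nra).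
    assert (T2 : 0 <= th ^ n) by (apply pow_le; lra).
    split.
    + eapply Rle_trans; [apply H1|]. nra.
    + unfold ext_coef; cbn [snd]. rewrite Cmod_conj. eapply Rle_trans; [apply H2|]. nra.
  - apply St; auto. destruct (IHk (S j)) as [K [K0 HK]]; try lia.
    exists K; split; auto. intros n. destruct (HK n) as [H1 H2]. split; auto.
    eapply Rle_trans; [exact H1|]. apply Rmult_le_compat_l; auto.
    assert (Rj := r_ge j Hj). assert (RS := r_mono j (S j) ltac:(lia) ltac:(lia)).
    apply pow_incr. split.
    + apply Rlt_le, Rdiv_lt_0_compat; nra.
    + apply Rmult_le_compat_l; [lra|]. apply Rinv_le_contravar; nra.
Qed.

Lemma qcoef_bound j : (j <= S L)%nat -> exists K, forall n, Cmod (qcoef j n) <= K * th ^ n.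
Proof.
  intros Hj. unfold qcoef. destruct (Nat.eq_dec j (S L)) as [->|N].
  - destruct q_bound as [K HK]. exists K. intros n. rewrite layer_coef_ext, Cmod_conj.
    unfold ext_coef; cbn [snd]. rewrite Cmod_conj. auto.
  - destruct (layer_coef_bound j) as [K [_ HK]]; [lia|]. exists K. intros n. rewrite Cmod_conj. apply HK.
Qed.

(** The annulus, or exterior of a disc for the last layer, on which both
    series of layer [j] converge geometrically; it is a neighbourhood of the
    circles that bound the layer. *)
Definition layer_dom (j : nat) (w : C) : Prop :=
  th < Cmod w /\ ((j <= L)%nat -> th * Cmod w < r j * r j).

Lemma layer_dom_open j : open (T := C_UniformSpace) (layer_dom j).
Proof.
  intros w [H1 H2]. assert (A := open_Cmod_gt th w H1).
  destruct (Compare_dec.le_dec j L) as [Hj|Hj].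
  - assert (B := open_Cmod_lt (r j * r j / th) w).
    assert (H3 : Cmod w < r j * r j / th) by (apply Rlt_div_r; specialize (H2 Hj); lra).
    generalize (filter_and _ _ A (B H3)). apply filter_imp. intros z [Z1 Z2]. split; auto. intros _.
    apply Rlt_div_r in Z2; lra.
  - revert A. apply filter_imp. intros z Hz. split; auto. intros; lia.
Qed.

Lemma pcoef_bound j w : (j <= S L)%nat -> layer_dom j w -> exists K t, 0 <= t /\ t * Cmod w < 1 /\
  forall n, Cmod (pcoef j n) <= K * t ^ n.
Proof.
  intros Hj [H1 H2]. unfold pcoef. destruct (Nat.eq_dec j (S L)) as [->|N].
  - destruct (ext_p_bound (/ (Cmod w + 1))) as [K [_ HK]]; [apply Rinv_0_lt_compat; lra|].
    exists K, (/ (Cmod w + 1)). split; [apply Rlt_le, Rinv_0_lt_compat; lra|]. split.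
    + rewrite Rmult_comm. apply Rlt_div_l; lra.
    + intros n. rewrite layer_coef_ext. apply HK.
  - destruct (layer_coef_bound j) as [K [_ HK]]; [lia|].
    assert (Rj := r_ge j ltac:(lia)). specialize (H2 ltac:(lia)).
    exists K, (th / (r j * r j)). split; [apply Rlt_le, Rdiv_lt_0_compat; nra|]. split; [|intros n; apply HK].
    replace (th / (r j * r j) * Cmod w) with (th * Cmod w / (r j * r j)) by (field; lra).
    apply Rlt_div_l; nra.
Qed.

Definition field (j : nat) (w : C) : C := (pser (pcoef j) w + pser (qcoef j) (/ w))%C.

Lemma inv_dom j w : layer_dom j w -> th * Cmod (/ w)%C < 1 /\ w <> 0%C.
Proof.
  intros [H1 _]. assert (N : w <> 0%C) by (apply Cmod_pos_neq; lra). split; auto.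
  rewrite Cmod_inv by auto. apply Rlt_div_l; lra.
Qed.

Lemma field_csum j w : (j <= S L)%nat -> layer_dom j w ->
  csum (fun n => pcoef j n * w ^ n + qcoef j n * (/ w) ^ n)%C (field j w).
Proof.
  intros Hj Hw. destruct (pcoef_bound j w Hj Hw) as [K1 [t [t0 [t1 H1]]]].
  destruct (qcoef_bound j Hj) as [K2 H2]. destruct (inv_dom j w Hw) as [I1 I2].
  apply csum_plus.
  - apply (pser_csum _ K1 t); auto.
  - apply (pser_csum _ K2 th); auto. lra.
Qed.

(** The series of [w f'(w)] is the one needed for the flux, since the normal
    derivative at [Psi w] is [Re (w f'(w))] up to a positive factor. *)
Lemma field_deriv j w : (j <= S L)%nat -> layer_dom j w -> exists l, cderiv (field j) w l /\
  csum (fun n => RtoC (INR n) * (pcoef j n * w ^ n - qcoef j n * (/ w) ^ n))%C (w * l)%C.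
Proof.
  intros Hj Hw. destruct (pcoef_bound j w Hj Hw) as [K1 [t [t0 [t1 H1]]]].
  destruct (qcoef_bound j Hj) as [K2 H2]. destruct (inv_dom j w Hw) as [I1 I2].
  destruct (pser_deriv _ K1 t w t0 H1 t1) as [l1 [S1 D1']].
  destruct (pser_deriv _ K2 th (/ w)%C ltac:(lra) H2 I1) as [l2 [S2 D2']].
  exists (l1 + l2 * (- (1) / (w * w)))%C. split.
  - apply cderiv_plus; auto. apply (cderiv_comp (pser (qcoef j)) (fun w => / w)%C); auto.
    apply (cderiv_inv (fun w => w)); auto. apply cderiv_id.
  - replace (w * (l1 + l2 * (- (1) / (w * w))))%C with (w * l1 - / w * l2)%C by (field; auto).
    apply csum_ext with (2 := csum_minus _ _ _ _ (csum_scal w _ _ S1) (csum_scal (/ w)%C _ _ S2)).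
    intros [|n].
    + change (INR 0) with 0. ring.
    + simpl pred. rewrite !Cpow_S. ring.
Qed.

Lemma field_holo j : (j <= S L)%nat -> holo (layer_dom j) (field j).
Proof. intros Hj w Hw. destruct (field_deriv j w Hj Hw) as [l [Hl _]]. exists l; auto. Qed.

Lemma field_derive_csum j w : (j <= S L)%nat -> layer_dom j w ->
  csum (fun n => RtoC (INR n) * (pcoef j n * w ^ n - qcoef j n * (/ w) ^ n))%C (w * C_derive (field j) w)%C.
Proof.
  intros Hj Hw. destruct (field_deriv j w Hj Hw) as [l [Hl H]].
  rewrite (cderiv_C_derive _ _ _ Hl). exact H.
Qed.

Lemma interface_dom j w : (j <= L)%nat -> Cmod w = r j -> layer_dom j w /\ layer_dom (S j) w.
Proof.
  intros Hj Hw. assert (Rj := r_ge j Hj). split; split; try lra.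
  - intros _. rewrite Hw. apply Rmult_lt_compat_r; lra.
  - intros HS. rewrite Hw. assert (RS := r_mono j (S j) ltac:(lia) HS). nra.
Qed.

(** On the circle through [w] the conjugate of [w^(-n)] is [|w|^(-2n) w^n]. *)
Lemma Re_circle (w y : C) (n : nat) : w <> 0%C ->
  fst (Cconj y * (/ w) ^ n)%C = fst (y * RtoC (/ Cmod w ^ (2 * n)) * w ^ n)%C.
Proof.
  intros Nw.
  assert (E1 : Cconj ((/ w) ^ n) = (RtoC (/ Cmod w ^ (2 * n)) * w ^ n)%C).
  { rewrite pow_mult, <- pow_inv, RtoC_pow, <- Cpow_mult_l, Cpow_conj. f_equal.
    assert (P : 0 < Cmod w ^ 2) by (apply pow_lt, Cmod_gt_0; auto).
    rewrite RtoC_inv by lra. rewrite Cmod2_conj.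
    assert (Nc : Cconj w <> 0%C).
    { apply Cmod_pos_neq. rewrite Cmod_conj. apply Cmod_gt_0; auto. }
    replace (/ (w * Cconj w) * w)%C with (/ Cconj w)%C by (field; auto).
    replace (/ Cconj w)%C with (/ Cconj w * Cconj (w * / w))%C.
    - rewrite Cmult_conj. field. auto.
    - rewrite Cinv_r by auto. rewrite (Cconj_RtoC 1). ring. }
  rewrite <- Cmult_assoc, <- E1.
  replace ((/ w) ^ n)%C with (Cconj (Cconj ((/ w) ^ n))) at 1.
  - rewrite <- Cmult_conj. reflexivity.
  - generalize ((/ w) ^ n)%C. intros [x z]. unfold Cconj; cbn [fst snd]. f_equal. ring.
Qed.

(** [p + conj q r^(-2n)] is preserved by the transfer matrix and
    [p - conj q r^(-2n)] is multiplied by [sigma_(j+1) / sigma_j]. *)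
Lemma field_Re_terms j w n : (j <= L)%nat -> Cmod w = r j ->
  fst (pcoef (S j) n * w ^ n + qcoef (S j) n * (/ w) ^ n)%C =
  fst (pcoef j n * w ^ n + qcoef j n * (/ w) ^ n)%C /\
  sigma (S j) * fst (RtoC (INR n) * (pcoef (S j) n * w ^ n - qcoef (S j) n * (/ w) ^ n))%C =
  sigma j * fst (RtoC (INR n) * (pcoef j n * w ^ n - qcoef j n * (/ w) ^ n))%C.
Proof.
  intros Hj Hw. assert (Rj := r_ge j Hj).
  assert (Nw : w <> 0%C) by (apply Cmod_pos_neq; lra).
  assert (X : forall p y : C, fst (p * w ^ n + Cconj y * (/ w) ^ n)%C = fst ((p + y * RtoC (/ r j ^ (2 * n))) * w ^ n)%C
    /\ fst (p * w ^ n - Cconj y * (/ w) ^ n)%C = fst ((p - y * RtoC (/ r j ^ (2 * n))) * w ^ n)%C).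
  { intros p y. assert (E := Re_circle w y n Nw). rewrite Hw in E.
    set (Z := (Cconj y * (/ w) ^ n)%C) in *. set (Z' := (y * RtoC (/ r j ^ (2 * n)))%C) in *. split.
    - transitivity (fst (p * w ^ n)%C + fst Z); [reflexivity|]. rewrite E.
      rewrite Cmult_plus_distr_r. reflexivity.
    - transitivity (fst (p * w ^ n)%C - fst Z); [reflexivity|]. rewrite E.
      replace ((p - Z') * w ^ n)%C with (p * w ^ n - Z' * w ^ n)%C by ring. reflexivity. }
  assert (S1 := layers_sigma gamma L r sigma layers j ltac:(lia)).
  assert (x0 : 0 < r j ^ (2 * n)) by (apply pow_lt; lra).
  assert (NX : RtoC (r j ^ (2 * n)) <> 0%C) by (intros E; apply RtoC_inj in E; lra).
  unfold pcoef, qcoef. rewrite (layer_coef_step j n) by auto. set (v := layer_coef (S j) n).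
  destruct (X (fst v) (snd v)) as [X1 X2].
  set (T := tapply (transfer r sigma n j) v). destruct (X (fst T) (snd T)) as [X3 X4].
  set (s := sigma (S j) / sigma j). set (x := r j ^ (2 * n)) in *.
  assert (Tp : fst T = (RtoC ((1 + s) / 2) * fst v + RtoC ((1 - s) * / x / 2) * snd v)%C) by reflexivity.
  assert (Tq : snd T = (RtoC ((1 - s) * x / 2) * fst v + RtoC ((1 + s) / 2) * snd v)%C) by reflexivity.
  assert (Ep : (fst T + snd T * RtoC (/ x))%C = (fst v + snd v * RtoC (/ x))%C).
  { rewrite Tp, Tq. unfold Rdiv. rewrite !RtoC_mult, !RtoC_plus, !RtoC_minus, !RtoC_inv by lra. field; auto. }
  assert (Em : (fst T - snd T * RtoC (/ x))%C = (RtoC s * (fst v - snd v * RtoC (/ x)))%C).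
  { rewrite Tp, Tq. unfold Rdiv. rewrite !RtoC_mult, !RtoC_plus, !RtoC_minus, !RtoC_inv by lra. field; auto. }
  split.
  - rewrite X1, X3, Ep. auto.
  - rewrite !fst_RtoC_mult, X2, X4, Em, <- Cmult_assoc, fst_RtoC_mult. unfold s. field. lra.
Qed.

Lemma field_interface j w : (j <= L)%nat -> Cmod w = r j -> fst (field (S j) w) = fst (field j w).
Proof.
  intros Hj Hw. destruct (interface_dom j w Hj Hw) as [D1' D2'].
  rewrite <- (is_series_unique _ _ (csum_fst _ _ (field_csum j w ltac:(lia) D1'))).
  rewrite <- (is_series_unique _ _ (csum_fst _ _ (field_csum (S j) w ltac:(lia) D2'))).
  apply Series_ext. intros n. apply field_Re_terms; auto.
Qed.

Lemma field_interface_deriv j w : (j <= L)%nat -> Cmod w = r j ->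
  sigma (S j) * fst (w * C_derive (field (S j)) w)%C = sigma j * fst (w * C_derive (field j) w)%C.
Proof.
  intros Hj Hw. destruct (interface_dom j w Hj Hw) as [D1' D2'].
  rewrite <- (is_series_unique _ _ (csum_fst _ _ (field_derive_csum j w ltac:(lia) D1'))).
  rewrite <- (is_series_unique _ _ (csum_fst _ _ (field_derive_csum (S j) w ltac:(lia) D2'))).
  rewrite <- !Series_scal_l. apply Series_ext. intros n. apply field_Re_terms; auto.
Qed.

(** ** The field in the core *)

(** The core series has coefficients of order [(th / gamma^2)^n], so it
    converges where the Faber polynomials are [O(g1^n)] for such a [g1]. The
    witness is the midpoint of [gamma] and [gamma^2 / th]. *)
Lemma inner_radius : exists g1, gamma < g1 /\ th * g1 < gamma * gamma.
Proof.
  exists ((gamma + gamma * gamma / th) / 2).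
  assert (Q : gamma < gamma * gamma / th) by (apply Rlt_div_r; nra).
  split; [lra|]. replace (th * ((gamma + gamma * gamma / th) / 2)) with ((th * gamma + gamma * gamma) / 2) by (field; lra).
  nra.
Qed.

(** The closed core together with a collar on which the Faber polynomials are
    still under control. *)
Definition core_nbhd (g1 : R) (z : C) : Prop :=
  closure Omega0 z \/ exists w, gamma < Cmod w /\ Cmod w <= g1 /\ z = Psi w.

(** The Grunsky coefficients as the coefficients of a Laurent series, from the
    constant term on. *)
Definition c_full (m n : nat) : C := if Nat.eq_dec n 0 then RtoC 0 else c m n.

Lemma c_full_csum m w : (1 <= m)%nat -> gamma < Cmod w ->
  csum (fun n => c_full m n * (/ w) ^ n)%C (F m (Psi w) - w ^ m)%C.
Proof. apply (grunsky_csum _ Psi F c Hc). Qed.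

Lemma c_full_bound : exists K, 0 <= K /\ forall m n, (1 <= m)%nat -> Cmod (c_full m n) <= K * th ^ m * th ^ n.
Proof.
  destruct c_bound as [K [K0 HK]]. exists K; split; auto. intros m n Hm. unfold c_full.
  destruct (Nat.eq_dec n 0); [|apply HK; lia]. rewrite Cmod_0.
  repeat apply Rmult_le_pos; auto; apply pow_le; lra.
Qed.

(** In the collar, [F_m (Psi w) = w^m + sum_n c_mn w^(-n)] with [|w| <= g1]. *)
Lemma faber_nbhd_bound g1 : gamma < g1 -> exists K, 0 <= K /\ forall m z, (1 <= m)%nat ->
  core_nbhd g1 z -> Cmod (F m z) <= K * g1 ^ m.
Proof.
  intros H1. destruct (faber_closure_bound _ _ _ _ HPsi F HF g1 H1) as [K1 [P1 HK1]].
  destruct c_full_bound as [K2 [P2 HK2]].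
  assert (Q : 0 <= K2 / (1 - th / gamma)).
  { apply Rmult_le_pos; auto. apply Rlt_le, Rinv_0_lt_compat.
    assert (th / gamma < 1) by (apply Rlt_div_l; lra). lra. }
  exists (K1 + 1 + K2 / (1 - th / gamma)). split; [lra|]. intros m z Hm Hz.
  assert (G0 : 0 < g1 ^ m) by (apply pow_lt; lra).
  destruct Hz as [Hz|[w [W1 [W2 ->]]]].
  - eapply Rle_trans; [apply HK1; auto|]. nra.
  - assert (N : w <> 0%C) by (apply Cmod_pos_neq; lra).
    replace (F m (Psi w)) with (w ^ m + (F m (Psi w) - w ^ m))%C by ring.
    eapply Rle_trans; [apply Cmod_triangle|].
    assert (T1 : Cmod (w ^ m)%C <= g1 ^ m).
    { rewrite Cmod_pow. apply pow_incr. split; [apply Cmod_ge_0|auto]. }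
    assert (T2 : Cmod (F m (Psi w) - w ^ m)%C <= K2 / (1 - th / gamma) * g1 ^ m).
    { rewrite <- (csum_CSeries _ _ (c_full_csum m w Hm W1)).
      eapply Rle_trans; [apply (csum_geo_bound (K2 * g1 ^ m) (th / gamma))|].
      - split; [apply Rlt_le, Rdiv_lt_0_compat; lra|apply Rlt_div_l; lra].
      - intros n. rewrite Cmod_mult, Cmod_pow, Cmod_inv by auto. unfold Rdiv. rewrite Rpow_mult_distr, <- Rmult_assoc.
        apply Rmult_le_compat; [apply Cmod_ge_0|apply pow_le, Rlt_le, Rinv_0_lt_compat; lra| |].
        + eapply Rle_trans; [apply HK2; auto|]. apply Rmult_le_compat_r; [apply pow_le; lra|].
          apply Rmult_le_compat_l; auto. apply pow_incr; lra.
        + apply pow_incr. split; [apply Rlt_le, Rinv_0_lt_compat; lra|apply Rinv_le_contravar; lra].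
      - apply Req_le. field. split; try lra. }
    nra.
Qed.

Definition core_field (z : C) : C := CSeries (fun n => pcoef 0 n * F n z)%C.

Lemma pcoef_0_0 j : pcoef j 0 = 0%C.
Proof. unfold pcoef. rewrite layer_coef_0. auto. Qed.

(** The ratio is [th g1 / gamma^2], less than [1] by the choice of [g1]. *)
Lemma core_term_bound : exists g1 K t, gamma < g1 /\ th * g1 < gamma * gamma /\ 0 <= K /\ 0 <= t < 1 /\
  forall n z, core_nbhd g1 z -> Cmod (pcoef 0 n * F n z)%C <= K * t ^ n.
Proof.
  destruct inner_radius as [g1 [G1 G2]]. destruct (faber_nbhd_bound g1 G1) as [K1 [P1 HK1]].
  destruct (layer_coef_bound 0 ltac:(lia)) as [K2 [P2 HK2]].
  assert (R0 : r 0%nat = gamma) by apply layers. rewrite R0 in HK2.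
  exists g1, (K2 * K1), (th / (gamma * gamma) * g1).
  assert (T0 : 0 < th / (gamma * gamma) * g1) by (apply Rmult_lt_0_compat; [apply Rdiv_lt_0_compat; nra|lra]).
  split; auto. split; auto. split; [apply Rmult_le_pos; auto|]. split.
  { split; [lra|]. replace (th / (gamma * gamma) * g1) with (th * g1 / (gamma * gamma)) by (field; lra).
    apply Rlt_div_l; nra. }
  intros n z Hz. destruct n as [|n].
  - rewrite pcoef_0_0. replace (0 * F 0%nat z)%C with (RtoC 0) by ring. rewrite Cmod_0.
    apply Rmult_le_pos; [apply Rmult_le_pos; auto|apply pow_le; lra].
  - rewrite Cmod_mult, Rpow_mult_distr.
    replace (K2 * K1 * ((th / (gamma * gamma)) ^ S n * g1 ^ S n))
      with (K2 * (th / (gamma * gamma)) ^ S n * (K1 * g1 ^ S n)) by ring.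
    apply Rmult_le_compat; [apply Cmod_ge_0|apply Cmod_ge_0|apply (proj1 (HK2 (S n)))|apply HK1; auto; lia].
Qed.

Lemma closure_cases z : closure Omega0 z -> Omega0 z \/ exists w, Cmod w = gamma /\ z = Psi w.
Proof.
  intros Hz. destruct (classic (Omega0 z)) as [|N]; auto. right.
  destruct HPsi as [_ [_ [_ [_ HB]]]]. apply HB. split; auto.
  apply closure_Cmod. intros e He. exists z. split; auto. rewrite Cminus_diag, Cmod_0; auto.
Qed.

Lemma Omega0_closure z : Omega0 z -> closure Omega0 z.
Proof.
  intros Hz. apply closure_Cmod. intros e He. exists z. split; auto. rewrite Cminus_diag, Cmod_0; auto.
Qed.

(** Interior points have a neighbourhood in the core; boundary points are
    values [Psi w] with [|w| = gamma], and nearby exterior points have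
    preimages close to [w]. *)
Lemma core_nbhd_ball g1 z : gamma < g1 -> closure Omega0 z ->
  exists d, 0 < d /\ forall y, Cmod (y - z)%C < d -> core_nbhd g1 y.
Proof.
  intros H1 Hz. destruct (closure_cases z Hz) as [H0|[w [W1 ->]]].
  - destruct (proj1 (locally_Cmod _ _) (Omega0_open z H0)) as [d [d0 Hd]].
    exists d; split; auto. intros y Hy. left. apply Omega0_closure, Hd, Hy.
  - destruct (PsiInv_limit _ _ _ _ HPsi w (g1 - gamma)) as [d [d0 Hd]]; try lra.
    exists d; split; auto. intros y Hy. destruct (classic (closure Omega0 y)) as [|N]; [left; auto|].
    right. destruct (Hd y N Hy) as [E1 [E2 E3]]. exists (PsiInv gamma Psi y). repeat split; auto.
    generalize (Cmod_sub_ge (PsiInv gamma Psi y) w). lra.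
Qed.

(** Near the closed core the series converges geometrically, and termwise
    differentiation applies. On the collar, inserting the expansion of
    [F_n (Psi w)] and exchanging the sums gives
    [sum_n p_n w^n + sum_k (sum_n p_n c_nk) w^(-k)], and the inner sums are
    [q_k] by [core_identity]. *)
Lemma core_field_holo z : closure Omega0 z -> exists d, 0 < d /\
  holo (fun y => Cmod (y - z)%C < d) core_field /\
  forall w, gamma < Cmod w -> Cmod (Psi w - z)%C < d -> core_field (Psi w) = field 0 w.
Proof.
  intros Hz. destruct core_term_bound as [g1 [K [t [G1 [G2 [K0 [Ht HK]]]]]]].
  destruct (core_nbhd_ball g1 z G1 Hz) as [d [d0 Hd]]. exists d; split; auto. split.
  - intros y Hy. set (s := (d - Cmod (y - z)%C) / 2).
    destruct (csum_deriv (fun n y => pcoef 0 n * F n y)%C y s K t) as [_ D]; auto.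
    + unfold s; lra.
    + intros n x _. destruct (faber_deriv _ _ _ F HF n x) as [l Hl]. eexists. apply cderiv_scal; eassumption.
    + intros n x Hx. apply HK, Hd. eapply Rle_lt_trans; [apply (Cmod_sub_triangle x y z)|]. unfold s in Hx. lra.
    + eexists; exact D.
  - intros w W1 W2. assert (N : w <> 0%C) by (apply Cmod_pos_neq; lra).
    assert (Wg : Cmod w <= g1).
    { destruct (Hd (Psi w) W2) as [H|[v [V1 [V2 V3]]]].
      - exfalso. revert H. apply (ext_not_closure _ _ _ _ HPsi); auto.
      - apply (Psi_inj_ext _ _ _ _ HPsi) in V3; try lra. subst v; auto. }
    destruct c_full_bound as [K2 [P2 HK2]]. destruct (layer_coef_bound 0 ltac:(lia)) as [K1 [P1 HK1]].
    assert (R0 : r 0%nat = gamma) by apply layers. rewrite R0 in HK1.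
    assert (Dm : layer_dom 0 w).
    { split; [lra|]. intros _. rewrite R0. apply Rle_lt_trans with (2 := G2).
      apply Rmult_le_compat_l; lra. }
    destruct (pcoef_bound 0 w ltac:(lia) Dm) as [K3 [t3 [t30 [t31 HK3]]]].
    destruct (pser_csum (pcoef 0) K3 t3 w t30 HK3 t31) as [S1 _].
    set (tg := th / gamma). assert (Tg : 0 < tg < 1).
    { unfold tg. split; [apply Rdiv_lt_0_compat; lra|apply Rlt_div_l; lra]. }
    assert (Iw : / Cmod w <= / gamma) by (apply Rinv_le_contravar; lra).
    assert (Iw0 : 0 < / Cmod w) by (apply Rinv_0_lt_compat; lra).
    assert (Ex : csum (fun n => CSeries (fun k => pcoef 0 n * c_full n k * (/ w) ^ k)%C)
       (CSeries (fun k => CSeries (fun n => pcoef 0 n * c_full n k * (/ w) ^ k)%C))).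
    { apply (csum_exchange (K1 * K2) tg); [lra|]. intros n k. destruct n as [|n].
      - rewrite pcoef_0_0. replace (0 * c_full 0 k * (/ w) ^ k)%C with (RtoC 0) by ring. rewrite Cmod_0.
        repeat apply Rmult_le_pos; auto; apply pow_le; lra.
      - rewrite !Cmod_mult, Cmod_pow, Cmod_inv by auto.
        apply Rle_trans with (K1 * (th / (gamma * gamma)) ^ S n * (K2 * th ^ S n * th ^ k) * (/ gamma) ^ k).
        + apply Rmult_le_compat; [apply Rmult_le_pos; apply Cmod_ge_0|apply pow_le; lra| |apply pow_incr; lra].
          apply Rmult_le_compat; [apply Cmod_ge_0|apply Cmod_ge_0|apply (proj1 (HK1 (S n)))|apply HK2; lia].
        + replace (K1 * (th / (gamma * gamma)) ^ S n * (K2 * th ^ S n * th ^ k) * (/ gamma) ^ k)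
            with (K1 * K2 * ((th / (gamma * gamma)) ^ S n * th ^ S n) * (th ^ k * (/ gamma) ^ k)) by ring.
          rewrite <- !Rpow_mult_distr. fold (th / gamma). fold tg.
          apply Rmult_le_compat_r; [apply pow_le; lra|]. apply Rmult_le_compat_l; [apply Rmult_le_pos; auto|].
          apply pow_incr. replace (th / (gamma * gamma) * th) with (tg * tg) by (unfold tg; field; lra). nra. }
    assert (Inner : forall k, CSeries (fun n => pcoef 0 n * c_full n k * (/ w) ^ k)%C = (qcoef 0 k * (/ w) ^ k)%C).
    { intros k. apply csum_CSeries. apply csum_scal_r. apply (proj2 (csum_shift _ _)).
      rewrite pcoef_0_0. destruct k as [|k].
      - unfold qcoef. rewrite layer_coef_0. cbn [snd]. rewrite Cconj_RtoC.
        replace (0 - 0 * c_full 0 0)%C with (RtoC 0) by ring.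
        apply csum_ext with (2 := csum_zero). intros n. unfold c_full. simpl. ring.
      - replace (qcoef 0 (S k) - 0 * c_full 0 (S k))%C with (qcoef 0 (S k)) by ring.
        apply csum_ext with (2 := core_identity (S k) ltac:(lia)). intros n.
        unfold c_full. destruct (Nat.eq_dec (S k) 0); [lia|auto]. }
    rewrite (CSeries_ext _ _ Inner) in Ex.
    apply csum_CSeries. apply csum_ext with (2 := csum_plus _ _ _ _ S1 Ex). intros n.
    destruct n as [|n].
    + rewrite pcoef_0_0. rewrite (csum_CSeries _ (RtoC 0)); [ring|].
      apply csum_ext with (2 := csum_zero). intros k. ring.
    + assert (S2 := csum_scal (pcoef 0 (S n)) _ _ (c_full_csum (S n) w ltac:(lia) W1)).
      rewrite (csum_CSeries _ (pcoef 0 (S n) * (F (S n) (Psi w) - w ^ S n))%C); [ring|].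
      apply csum_ext with (2 := S2). intros k; ring.
Qed.

(** ** Gluing the fields of the layers *)

(** The index of the circle that bounds from inside the layer of [Psi w]. *)
Definition region_index (w : C) : nat := epsilon (inhabits 0%nat)
  (fun i => (i <= L)%nat /\ r i < Cmod w /\ ((i < L)%nat -> Cmod w < r (S i))).

Lemma region_index_eq i w : (i <= L)%nat -> r i < Cmod w -> ((i < L)%nat -> Cmod w < r (S i)) ->
  region_index w = i.
Proof.
  intros Hi H1 H2. unfold region_index.
  assert (X := epsilon_spec (inhabits 0%nat)
    (fun i => (i <= L)%nat /\ r i < Cmod w /\ ((i < L)%nat -> Cmod w < r (S i)))
    (ex_intro _ i (conj Hi (conj H1 H2)))). cbv beta in X.
  set (k := epsilon _ _) in *. destruct X as [X1 [X2 X3]].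
  destruct (Nat.lt_trichotomy k i) as [Hk|[Hk|Hk]]; auto; exfalso.
  - specialize (X3 ltac:(lia)). assert (M := r_mono (S k) i ltac:(lia) Hi). lra.
  - specialize (H2 ltac:(lia)). assert (M := r_mono (S i) k ltac:(lia) X1). lra.
Qed.

Definition outer_field (i : nat) (z : C) : C := (RtoC 2 * field (S i) (PsiInv gamma Psi z))%C.

Definition solution (z : C) : R :=
  if excluded_middle_informative (closure Omega0 z) then fst (RtoC 2 * core_field z)%C
  else fst (outer_field (region_index (PsiInv gamma Psi z)) z).

Lemma solution_core z : Omega0 z -> solution z = fst (RtoC 2 * core_field z)%C.
Proof.
  intros Hz. apply Omega0_closure in Hz. unfold solution.
  destruct (excluded_middle_informative (closure Omega0 z)); tauto.
Qed.

Lemma region_layer i z : (i <= L)%nat -> region Omega0 Psi L r (S i) z ->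
  exists w, z = Psi w /\ gamma < Cmod w /\ PsiInv gamma Psi z = w /\
    ~ closure Omega0 z /\ layer_dom (S i) w /\ solution z = fst (outer_field i z).
Proof.
  intros Hi [w [W1 [W2 W3]]]. assert (Ri := r_ge i Hi).
  assert (Wg : gamma < Cmod w) by lra.
  assert (Inv : PsiInv gamma Psi z = w).
  { rewrite W3. apply (PsiInv_Psi _ _ _ _ HPsi). lra. }
  assert (Nc : ~ closure Omega0 z) by (rewrite W3; apply (ext_not_closure _ _ _ _ HPsi); auto).
  exists w. split; auto. split; auto. split; auto. split; auto. split.
  - split; [lra|]. intros HS. specialize (W2 ltac:(lia)). assert (RS := r_ge (S i) HS). nra.
  - unfold solution. destruct (excluded_middle_informative (closure Omega0 z)); [tauto|].
    rewrite Inv, (region_index_eq i); auto.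
Qed.

Lemma PsiInv_near w e : gamma < Cmod w -> 0 < e -> exists d, 0 < d /\ forall z, Cmod (z - Psi w)%C < d ->
  gamma < Cmod (PsiInv gamma Psi z) /\ Psi (PsiInv gamma Psi z) = z /\ Cmod (PsiInv gamma Psi z - w)%C < e.
Proof.
  intros Hw He. destruct (PsiInv_limit _ _ _ _ HPsi w e ltac:(lra) He) as [d [d0 Hd]].
  assert (N := ext_open Omega0 _ (ext_not_closure _ _ _ _ HPsi w Hw)).
  apply locally_Cmod in N. destruct N as [d' [d0' Hd']].
  exists (Rmin d d'). split; [apply Rmin_pos; auto|]. intros z Hz. apply Hd.
  - apply Hd'. eapply Rlt_le_trans; [exact Hz|apply Rmin_r].
  - eapply Rlt_le_trans; [exact Hz|apply Rmin_l].
Qed.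

Lemma region_open i : (i <= L)%nat -> open (T := C_UniformSpace) (region Omega0 Psi L r (S i)).
Proof.
  intros Hi z [w [W1 [W2 ->]]]. assert (Ri := r_ge i Hi).
  set (e := if Compare_dec.lt_dec i L then Rmin (Cmod w - r i) (r (S i) - Cmod w) else Cmod w - r i).
  assert (E : 0 < e /\ e <= Cmod w - r i /\ ((i < L)%nat -> e <= r (S i) - Cmod w)).
  { unfold e. destruct (Compare_dec.lt_dec i L) as [HL|HL].
    - specialize (W2 HL). split; [apply Rmin_pos; lra|]. split; [apply Rmin_l|]. intros _; apply Rmin_r.
    - split; [lra|]. split; [lra|]. intros; lia. }
  destruct E as [E1 [E2 E3]].
  destruct (PsiInv_near w e ltac:(lra) E1) as [d [d0 Hd]]. apply locally_Cmod.
  exists d; split; auto. intros y Hy. destruct (Hd y Hy) as [Y1 [Y2 Y3]].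
  exists (PsiInv gamma Psi y). assert (A := Cmod_sub_ge (PsiInv gamma Psi y) w).
  assert (B := Cmod_sub_ge w (PsiInv gamma Psi y)). rewrite Cmod_sub_comm in B.
  split; [lra|]. split; [intros HL; specialize (E3 HL); lra|auto].
Qed.

(** The chain rule for [field o Psi^(-1)], where the inverse has the
    derivative [1 / Psi']. *)
Lemma outer_field_deriv i w : (i <= L)%nat -> gamma < Cmod w -> layer_dom (S i) w ->
  cderiv (outer_field i) (Psi w) (RtoC 2 * (C_derive (field (S i)) w * / C_derive Psi w))%C.
Proof.
  intros Hi Hw Hd. assert (Ei : PsiInv gamma Psi (Psi w) = w) by (apply (PsiInv_Psi _ _ _ _ HPsi); auto).
  apply cderiv_scal. apply (cderiv_comp (field (S i)) (PsiInv gamma Psi)).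
  - apply cderiv_inverse; auto.
    + apply (Psi_deriv _ _ _ _ HPsi). lra.
    + apply (Psi_derive_neq_0 _ _ _ _ HPsi F HF c Hc). lra.
    + apply ccont_C. rewrite Ei. intros e He. destruct (PsiInv_near w e Hw He) as [d [d0 Hd']].
      exists d; split; auto. intros z Hz. apply Hd'; auto.
    + apply locally_Cmod. destruct (PsiInv_near w 1 Hw Rlt_0_1) as [d [d0 Hd']].
      exists d; split; auto. intros z Hz. apply Hd'; auto.
  - rewrite Ei. apply (holo_deriv (layer_dom (S i))); auto. apply field_holo; lia.
Qed.

Lemma outer_field_holo i : (i <= L)%nat -> holo (region Omega0 Psi L r (S i)) (outer_field i).
Proof.
  intros Hi z Hz. destruct (region_layer i z Hi Hz) as [w [-> [W1 [_ [_ [W2 _]]]]]].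
  eexists. apply outer_field_deriv; auto.
Qed.

Lemma limit_within_eps (D : C -> Prop) (f : C -> R) (z0 : C) (l : R) :
  (forall e, 0 < e -> exists d, 0 < d /\ forall z, D z -> Cmod (z - z0)%C < d -> Rabs (f z - l) < e) ->
  limit_within D f z0 l.
Proof.
  intros H P HP. apply locally_R in HP. destruct HP as [e [e0 He]].
  destruct (H e e0) as [d [d0 Hd]]. apply locally_Cmod. exists d; split; [exact d0|].
  intros w Hw Dw. apply He, Hd; auto.
Qed.

Lemma limit_within_ext (D : C -> Prop) (f g : C -> R) (z0 : C) (l : R) :
  (forall z, D z -> f z = g z) -> limit_within D f z0 l -> limit_within D g z0 l.
Proof.
  intros E H P HP. generalize (H P HP). unfold filtermap, within. apply filter_imp.
  intros z Hz Dz. rewrite <- E; auto.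
Qed.

Lemma limit_within_cont (D : C -> Prop) (K : C -> C) (z0 : C) :
  ccont (U := C_UniformSpace) K z0 -> limit_within D (fun z => fst (K z)) z0 (fst (K z0)).
Proof.
  intros H. apply limit_within_eps. intros e He.
  destruct (proj1 (ccont_C _ _) H e He) as [d [d0 Hd]]. exists d; split; auto.
  intros z _ Hz. eapply Rle_lt_trans; [apply (Re_le_Cmod (K z - K z0))|]. auto.
Qed.

Lemma limit_within_PsiInv (D : C -> Prop) (K : C -> C) (w0 : C) : gamma <= Cmod w0 ->
  (forall z, D z -> ~ closure Omega0 z) -> ccont (U := C_UniformSpace) K w0 ->
  limit_within D (fun z => fst (K (PsiInv gamma Psi z))) (Psi w0) (fst (K w0)).
Proof.
  intros Hw HD H. apply limit_within_eps. intros e He.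
  destruct (proj1 (ccont_C _ _) H e He) as [d [d0 Hd]].
  destruct (PsiInv_limit _ _ _ _ HPsi w0 d Hw d0) as [d' [d0' Hd']].
  exists d'; split; auto. intros z Dz Hz. destruct (Hd' z (HD z Dz) Hz) as [_ [_ E]].
  eapply Rle_lt_trans; [apply (Re_le_Cmod (K (PsiInv gamma Psi z) - K w0))|]. auto.
Qed.

(** Value and gradient of the field are continuous functions of [w] up to the
    interfaces, and [Psi^(-1)] is continuous up to the boundary. *)
Lemma layer_limits i w nu : (i <= L)%nat -> gamma <= Cmod w -> layer_dom (S i) w ->
  limit_within (region Omega0 Psi L r (S i)) solution (Psi w) (fst (RtoC 2 * field (S i) w)%C) /\
  limit_within (region Omega0 Psi L r (S i)) (directional_derivative solution nu) (Psi w)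
    (fst (nu * (RtoC 2 * (C_derive (field (S i)) w * / C_derive Psi w)))%C).
Proof.
  intros Hi Hw Hd.
  assert (Nc : forall z, region Omega0 Psi L r (S i) z -> ~ closure Omega0 z).
  { intros z Hz. destruct (region_layer i z Hi Hz) as [v [_ [_ [_ [N _]]]]]. auto. }
  assert (Hf := field_holo (S i) ltac:(lia)). split.
  - apply limit_within_ext with (fun z => fst (RtoC 2 * field (S i) (PsiInv gamma Psi z))%C).
    + intros z Hz. destruct (region_layer i z Hi Hz) as [v [_ [_ [_ [_ [_ E]]]]]]. auto.
    + apply (limit_within_PsiInv _ (fun w => RtoC 2 * field (S i) w)%C); auto.
      apply ccont_mult; [apply ccont_const|]. apply (holo_cont _ _ _ Hf Hd).
  - apply limit_within_ext with (fun z => fst ((fun w => nu * (RtoC 2 * (C_derive (field (S i)) w * / C_derive Psi w)))%C (PsiInv gamma Psi z))).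
    + intros z Hz. assert (Hz' := Hz). destruct (region_layer i z Hi Hz) as [v [E1 [V1 [E2 [_ [V2 _]]]]]].
      rewrite (Re_directional (region Omega0 Psi L r (S i)) (outer_field i)); auto.
      * rewrite E2. cbv beta. rewrite E1. rewrite (cderiv_C_derive _ _ _ (outer_field_deriv i v Hi V1 V2)). auto.
      * apply region_open; auto.
      * apply outer_field_holo; auto.
      * intros y Hy. destruct (region_layer i y Hi Hy) as [x [_ [_ [_ [_ [_ E]]]]]]. auto.
    + apply (limit_within_PsiInv _ (fun w => nu * (RtoC 2 * (C_derive (field (S i)) w * / C_derive Psi w)))%C); auto.
      apply ccont_mult; [apply ccont_const|]. apply ccont_mult; [apply ccont_const|]. apply ccont_mult.
      * apply (holo_cont _ _ _ (holo_derive _ _ (layer_dom_open (S i)) Hf) Hd).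
      * apply ccont_inv; [|apply (Psi_derive_neq_0 _ _ _ _ HPsi F HF c Hc); auto].
        apply (holo_cont _ _ _ (Psi_derive_holo _ _ _ _ HPsi)); auto.
Qed.

Lemma core_holo : holo Omega0 (fun z => RtoC 2 * core_field z)%C.
Proof.
  intros z Hz. destruct (core_field_holo z (Omega0_closure z Hz)) as [d [d0 [H _]]].
  destruct (H z) as [l Hl]; [rewrite Cminus_diag, Cmod_0; auto|]. eexists. apply cderiv_scal. exact Hl.
Qed.

Lemma open_ball (z : C) d : open (T := C_UniformSpace) (fun y => Cmod (y - z)%C < d).
Proof.
  intros y Hy. apply locally_Cmod. exists (d - Cmod (y - z)%C). split; [lra|].
  intros x Hx. eapply Rle_lt_trans; [apply (Cmod_sub_triangle x y z)|]. lra.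
Qed.

(** The limits from inside are computed with [core_field] and have to be
    expressed by [field 0] in order to use the interface conditions. The two
    functions [core_field o Psi] and [field 0] agree just outside of the
    circle and are differentiable on it, hence agree on it to first order by
    [deriv_zero]. *)
Lemma core_limits w nu : Cmod w = gamma ->
  limit_within Omega0 solution (Psi w) (fst (RtoC 2 * field 0 w)%C) /\
  limit_within Omega0 (directional_derivative solution nu) (Psi w)
    (fst (nu * (RtoC 2 * (C_derive (field 0) w * / C_derive Psi w)))%C).
Proof.
  intros Hw. assert (g0 := g_pos).
  assert (Hc0 : closure Omega0 (Psi w)).
  { destruct HPsi as [_ [_ [_ [_ HB]]]]. apply HB. exists w; auto. }
  destruct (core_field_holo _ Hc0) as [d [d0 [Hh He]]].
  assert (Z0 : Cmod (Psi w - Psi w)%C < d) by (rewrite Cminus_diag, Cmod_0; auto).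
  assert (DP := Psi_deriv _ _ _ _ HPsi w ltac:(lra)).
  assert (Dm : layer_dom 0 w).
  { apply interface_dom; [lia|]. rewrite Hw. symmetry. apply layers. }
  assert (Df := holo_deriv _ _ _ (field_holo 0 ltac:(lia)) Dm).
  assert (DV := holo_deriv _ _ _ Hh Z0).
  assert (NP := Psi_derive_neq_0 _ _ _ _ HPsi F HF c Hc w ltac:(lra)).
  assert (DD := cderiv_minus _ _ _ _ _ (cderiv_comp core_field Psi w _ _ DP DV) Df).
  destruct (proj1 (ccont_C _ _) (cderiv_cont _ _ _ DP) d d0) as [d' [d0' Hd']].
  destruct (deriv_zero _ w _ d' ltac:(lra) d0' DD) as [Z1 Z2].
  { intros v V1 V2. cbv beta. rewrite He; [ring|lra|auto]. }
  cbv beta in Z1. apply Ceq_minus in Z1. apply Ceq_minus in Z2.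
  rewrite <- Z1. rewrite <- Z2.
  replace (C_derive core_field (Psi w) * C_derive Psi w * / C_derive Psi w)%C
    with (C_derive core_field (Psi w)) by (field; auto).
  split.
  - apply limit_within_ext with (fun z => fst (RtoC 2 * core_field z)%C).
    + intros z Hz. symmetry; apply solution_core, Hz.
    + apply (limit_within_cont _ (fun z => RtoC 2 * core_field z)%C).
      apply ccont_mult; [apply ccont_const|]. apply (cderiv_cont _ _ _ DV).
  - assert (HV' := holo_derive _ _ (open_ball (Psi w) d) Hh).
    assert (X := limit_within_cont Omega0 (fun z => nu * (RtoC 2 * C_derive core_field z))%C (Psi w)).
    apply limit_within_ext with (2 := X ltac:(apply ccont_mult; [apply ccont_const|apply ccont_mult; [apply ccont_const|apply (holo_cont _ _ _ HV' Z0)]])).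
    intros z Hz. rewrite (Re_directional Omega0 (fun z => RtoC 2 * core_field z)%C); auto.
    + destruct (core_field_holo z (Omega0_closure z Hz)) as [dz [dz0 [H _]]].
      assert (Zz : Cmod (z - z)%C < dz) by (rewrite Cminus_diag, Cmod_0; auto).
      assert (Dz := holo_deriv _ _ z H Zz).
      rewrite (cderiv_C_derive _ _ _ (cderiv_scal (RtoC 2) _ _ _ Dz)). auto.
    + apply core_holo.
    + intros y Hy. apply solution_core, Hy.
Qed.

Lemma inner_limits j w nu : (j <= L)%nat -> Cmod w = r j ->
  limit_within (region Omega0 Psi L r j) solution (Psi w) (fst (RtoC 2 * field j w)%C) /\
  limit_within (region Omega0 Psi L r j) (directional_derivative solution nu) (Psi w)
    (fst (nu * (RtoC 2 * (C_derive (field j) w * / C_derive Psi w)))%C).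
Proof.
  intros Hj Hw. destruct j as [|i].
  - apply (core_limits w nu). rewrite Hw. apply layers.
  - apply (layer_limits i w nu); [lia|rewrite Hw; apply r_ge; auto|exact (proj1 (interface_dom (S i) w Hj Hw))].
Qed.

(** ** Behaviour at infinity *)

Definition background (z : C) : R := fst (RtoC 2 * (alpha * F m0 z))%C.

(** Half of [H - u] is the real part of the series in [1 / w] with these
    coefficients. *)
Definition far_coef (n : nat) : C := (alpha * c_full m0 n - q n)%C.

(** In the exterior [u] comes from [alpha w^m + sum q_n w^(-n)] and [H] from
    [alpha F_m (Psi w) = alpha (w^m + sum c_mn w^(-n))]. *)
Lemma far_field w : r L < Cmod w ->
  csum (fun n => far_coef n * (/ w) ^ n)%C (pser far_coef (/ w)) /\
  background (Psi w) - solution (Psi w) = 2 * fst (pser far_coef (/ w)).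
Proof.
  intros Hw. assert (RL := r_ge L (le_n L)). assert (Wg : gamma < Cmod w) by lra.
  assert (Hr : region Omega0 Psi L r (S L) (Psi w)).
  { exists w. split; auto. split; [intros; lia|auto]. }
  destruct (region_layer L (Psi w) (le_n L) Hr) as [v [_ [_ [E2 [_ [_ E3]]]]]].
  assert (Ei : PsiInv gamma Psi (Psi w) = w) by (apply (PsiInv_Psi _ _ _ _ HPsi); auto).
  assert (Dm : layer_dom (S L) w) by (split; [lra|intros; lia]).
  destruct (inv_dom _ _ Dm) as [I1 I2]. destruct q_bound as [K2 H2].
  destruct (pser_csum q K2 th (/ w)%C ltac:(lra) H2 I1) as [Sq _].
  assert (S1 := csum_minus _ _ _ _ (csum_scal alpha _ _ (c_full_csum m0 w m0_pos Wg)) Sq).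
  assert (Ef : field (S L) w = (alpha * w ^ m0 + pser q (/ w))%C).
  { unfold field. f_equal.
    - apply csum_CSeries.
      assert (Y := csum_single (fun n => pcoef (S L) n * w ^ n)%C m0).
      replace (alpha * w ^ m0)%C with (pcoef (S L) m0 * w ^ m0)%C.
      + apply Y. intros k Hk. unfold pcoef. rewrite layer_coef_ext. unfold ext_coef; cbn [fst].
        destruct (Nat.eq_dec k m0); [tauto|ring].
      + unfold pcoef. rewrite layer_coef_ext. unfold ext_coef; cbn [fst].
        destruct (Nat.eq_dec m0 m0); tauto.
    - unfold pser. apply CSeries_ext. intros n. unfold qcoef. rewrite layer_coef_ext.
      unfold ext_coef; cbn [snd]. f_equal. apply Cconj_conj. }
  assert (S2 : csum (fun n => far_coef n * (/ w) ^ n)%C (alpha * (F m0 (Psi w) - w ^ m0) - pser q (/ w))%C).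
  { apply csum_ext with (2 := S1). intros n. unfold far_coef. ring. }
  assert (Ep : pser far_coef (/ w)%C = (alpha * (F m0 (Psi w) - w ^ m0) - pser q (/ w))%C).
  { apply csum_CSeries, S2. }
  rewrite Ep. split; auto. rewrite E3. unfold background, outer_field. rewrite Ei, Ef.
  rewrite !fst_RtoC_mult, <- Rmult_minus_distr_l. f_equal.
  transitivity (fst (alpha * F m0 (Psi w) - (alpha * w ^ m0 + pser q (/ w)))%C); [reflexivity|].
  f_equal. ring.
Qed.

Lemma far_coef_bound : exists K, 0 <= K /\ forall n, Cmod (far_coef n) <= K * th ^ n.
Proof.
  destruct c_full_bound as [K1 [P1 H1]]. destruct q_bound as [K2 H2].
  assert (P2 := geo_K_pos _ _ _ H2). assert (A0 := Cmod_ge_0 alpha).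
  assert (T0 : 0 <= th ^ m0) by (apply pow_le; lra).
  exists (Cmod alpha * (K1 * th ^ m0) + K2). split.
  { apply Rplus_le_le_0_compat; auto. repeat apply Rmult_le_pos; auto. }
  intros n. unfold far_coef. eapply Rle_trans; [apply Cmod_sub_le|]. rewrite Cmod_mult, Rmult_plus_distr_r.
  apply Rplus_le_compat; auto. rewrite Rmult_assoc. apply Rmult_le_compat_l; auto.
Qed.

(** The constant coefficient vanishes, which leaves a factor [1 / w]. *)
Lemma far_bound : exists M, 0 <= M /\ forall w, r L < Cmod w -> Cmod (pser far_coef (/ w))%C <= M / Cmod w.
Proof.
  destruct far_coef_bound as [K [K0 HK]].
  assert (Tg : 0 < th / gamma < 1) by (split; [apply Rdiv_lt_0_compat; lra|apply Rlt_div_l; lra]).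
  exists (K * th / (1 - th / gamma)). split.
  { apply Rmult_le_pos; [apply Rmult_le_pos; lra|apply Rlt_le, Rinv_0_lt_compat; lra]. }
  intros w Hw. assert (RL := r_ge L (le_n L)). assert (N : w <> 0%C) by (apply Cmod_pos_neq; lra).
  destruct (far_field w Hw) as [S1 _]. apply (proj1 (csum_shift _ _)) in S1.
  assert (F0 : far_coef 0 = 0%C).
  { unfold far_coef, c_full. simpl. rewrite q_0. ring. }
  cbv beta in S1. rewrite F0 in S1. replace (pser far_coef (/ w) - 0 * (/ w) ^ 0)%C with (pser far_coef (/ w)) in S1 by ring.
  rewrite <- (csum_CSeries _ _ S1).
  assert (Iw : / Cmod w <= / gamma) by (apply Rinv_le_contravar; lra).
  assert (Iw0 : 0 < / Cmod w) by (apply Rinv_0_lt_compat; lra).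
  eapply Rle_trans; [apply (csum_geo_bound (K * th * / Cmod w) (th / gamma)); [lra|]|].
  - intros n. rewrite Cmod_mult, Cmod_pow, Cmod_inv by auto.
    apply Rle_trans with (K * th ^ S n * (/ Cmod w * (/ gamma) ^ n)).
    + apply Rmult_le_compat; [apply Cmod_ge_0|apply pow_le; lra|apply HK|].
      simpl. apply Rmult_le_compat_l; [lra|]. apply pow_incr; lra.
    + unfold Rdiv. rewrite Rpow_mult_distr. simpl. apply Req_le. ring.
  - apply Req_le. field. repeat split; lra.
Qed.

Lemma Psi_annulus_bounded R1 : exists M, forall w, gamma <= Cmod w -> Cmod w <= R1 -> Cmod (Psi w) <= M.
Proof.
  destruct (local_uniform (fun w d => gamma <= Cmod w -> Cmod (Psi w) <= / d)) with (M := R1) as [d [d0 Hd]].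
  - intros w d d' H H1 H2 Hw. eapply Rle_trans; [apply H, Hw|]. apply Rinv_le_contravar; lra.
  - intros p. destruct (Rlt_le_dec (Cmod p) gamma) as [Lp|Lp].
    + exists (gamma - Cmod p). split; [lra|]. intros w Hw W1. exfalso. generalize (Cmod_sub_ge w p). lra.
    + destruct (proj1 (ccont_C _ _) (Psi_cont _ _ _ _ HPsi p Lp) 1 Rlt_0_1) as [d [d0 Hd]].
      assert (F0 := Cmod_ge_0 (Psi p)). assert (I0 : 0 < / (Cmod (Psi p) + 1)) by (apply Rinv_0_lt_compat; lra).
      exists (Rmin d (/ (Cmod (Psi p) + 1))). split; [apply Rmin_pos; auto|].
      intros w Hw _. specialize (Hd w (Rlt_le_trans _ _ _ Hw (Rmin_l _ _))).
      apply Rle_trans with (Cmod (Psi p) + 1).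
      * generalize (Cmod_sub_ge (Psi w) (Psi p)); lra.
      * rewrite <- (Rinv_inv (Cmod (Psi p) + 1)) at 1. apply Rinv_le_contravar; [apply Rmin_pos; auto|apply Rmin_r].
  - exists (/ d). intros w H1 H2. apply Hd; auto.
Qed.

(** A large value [z] is [Psi w] with [w] large, and then
    [|z| <= (1 + B / gamma) |w|] by [Psi_growth]. *)
Lemma solution_infinity : exists M R0, forall z, R0 < Cmod z -> Rabs (solution z - background z) <= M / Cmod z.
Proof.
  assert (g0 := g_pos). destruct (Psi_growth _ _ _ _ HPsi) as [B [R1 [HR [B0 HB]]]].
  destruct far_bound as [M [M0 HM]]. destruct Omega0_bounded as [Mo HMo].
  destruct (Psi_annulus_bounded (Rmax R1 (r L))) as [Ma HMa].
  exists (2 * M * (1 + B / gamma)), (Rmax (Mo + 1) (Rmax Ma 0)). intros z Hz.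
  assert (Z1 := Rmax_l (Mo + 1) (Rmax Ma 0)). assert (Z2 := Rmax_r (Mo + 1) (Rmax Ma 0)).
  assert (Z3 := Rmax_l Ma 0). assert (Z4 := Rmax_r Ma 0).
  destruct (closure_or_ext _ _ _ _ HPsi z) as [Hcl|[w [W1 ->]]].
  { exfalso. destruct (proj1 (closure_Cmod _ _) Hcl 1 Rlt_0_1) as [y [Y1 Y2]].
    specialize (HMo y Y1). generalize (Cmod_sub_ge z y). rewrite Cmod_sub_comm. lra. }
  assert (W2 : Rmax R1 (r L) < Cmod w).
  { apply Rnot_le_lt. intros N. specialize (HMa w ltac:(lra) N). lra. }
  assert (W3 : R1 < Cmod w) by (eapply Rle_lt_trans; [apply Rmax_l|exact W2]).
  assert (W4 : r L < Cmod w) by (eapply Rle_lt_trans; [apply Rmax_r|exact W2]).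
  destruct (far_field w W4) as [_ E]. specialize (HM w W4). specialize (HB w W3).
  replace (solution (Psi w) - background (Psi w)) with (- (2 * fst (pser far_coef (/ w)%C))) by lra.
  rewrite Rabs_Ropp, Rabs_mult, (Rabs_pos_eq 2) by lra.
  assert (A := Re_le_Cmod (pser far_coef (/ w)%C)).
  assert (P : Cmod (Psi w) <= (1 + B / gamma) * Cmod w).
  { apply Rle_trans with (Cmod w + B).
    - generalize (Cmod_sub_ge (Psi w) w). lra.
    - assert (B <= B / gamma * Cmod w); [|lra].
      replace (B / gamma * Cmod w) with (B * (Cmod w / gamma)) by (field; lra).
      rewrite <- (Rmult_1_r B) at 1. apply Rmult_le_compat_l; auto. apply Rle_div_r; lra. }
  apply Rle_trans with (2 * (M / Cmod w)); [lra|].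
  apply Rmult_le_reg_r with (Cmod w * Cmod (Psi w)); [apply Rmult_lt_0_compat; lra|].
  replace (2 * (M / Cmod w) * (Cmod w * Cmod (Psi w))) with (2 * M * Cmod (Psi w)) by (field; lra).
  replace (2 * M * (1 + B / gamma) / Cmod (Psi w) * (Cmod w * Cmod (Psi w))) with (2 * M * ((1 + B / gamma) * Cmod w)) by (field; lra).
  apply Rmult_le_compat_l; lra.
Qed.

(** Harmonicity is that of real parts; the interface conditions reduce to
    [field_interface] and [field_interface_deriv], since the normal at [Psi w]
    is a positive multiple of [w Psi'(w)] and the factor [Psi'] cancels
    against the derivative of [Psi^(-1)]. *)
Theorem solution_transmission : transmission_solution Omega0 Psi L r sigma background solution.
Proof.
  assert (g0 := g_pos).
  split; [|split; [|split]].
  - intros j z Hj Hz. destruct j as [|i].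
    + apply (Re_harmonic Omega0 (fun z => RtoC 2 * core_field z)%C); auto.
      * apply core_holo.
      * intros y Hy. apply solution_core, Hy.
    + apply (Re_harmonic (region Omega0 Psi L r (S i)) (outer_field i)); auto.
      * apply region_open; lia.
      * apply outer_field_holo; lia.
      * intros y Hy. destruct (region_layer i y ltac:(lia) Hy) as [x [_ [_ [_ [_ [_ E]]]]]]. auto.
  - intros j w Hj Hw. destruct (interface_dom j w Hj Hw) as [D1' D2'].
    exists (fst (RtoC 2 * field j w)%C). split.
    + replace (fst (RtoC 2 * field j w)%C) with (fst (RtoC 2 * field (S j) w)%C).
      * apply (layer_limits j w 0%C); auto. rewrite Hw. apply r_ge, Hj.
      * assert (E := field_interface j w Hj Hw). unfold Cmult, RtoC; cbn [fst snd]. lra.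
    + apply (inner_limits j w 0%C); auto.
  - intros j w Hj Hw dnu. destruct (interface_dom j w Hj Hw) as [D1' D2']. assert (Rj := r_ge j Hj).
    exists (fst (normal Psi w * (RtoC 2 * (C_derive (field (S j)) w * / C_derive Psi w)))%C),
      (fst (normal Psi w * (RtoC 2 * (C_derive (field j) w * / C_derive Psi w)))%C).
    split; [apply layer_limits; auto; lra|]. split; [apply inner_limits; auto|].
    assert (NP := Psi_derive_neq_0 _ _ _ _ HPsi F HF c Hc w ltac:(lra)).
    assert (Nw : w <> 0%C) by (apply Cmod_pos_neq; lra).
    set (m := Cmod (w * C_derive Psi w)%C).
    assert (m_pos : 0 < m) by (apply Cmod_gt_0, Cmult_neq_0; auto).
    assert (X : forall D : C, fst (normal Psi w * (RtoC 2 * (D * / C_derive Psi w)))%C = 2 / m * fst (w * D)%C).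
    { intros D. transitivity (fst (RtoC (2 / m) * (w * D))%C).
      - f_equal. unfold normal. fold m. rewrite RtoC_div by lra. field.
        split; auto. intros E; apply RtoC_inj in E; lra.
      - unfold Cmult, RtoC; cbn [fst snd]. ring. }
    rewrite !X. assert (E := field_interface_deriv j w Hj Hw).
    transitivity (2 / m * (sigma (S j) * fst (w * C_derive (field (S j)) w)%C)); [ring|].
    rewrite E. ring.
  - destruct solution_infinity as [M [R0 H]]. exists M, R0. exact H.
Qed.

End Solution.

(** * Identification of the polarization tensors *)

Lemma cis_plus s t : cis (s + t) = (cis s * cis t)%C.
Proof.
  unfold cis, Cmult; cbn [fst snd].
  replace (2 * PI * (s + t)) with (2 * PI * s + 2 * PI * t) by ring.
  rewrite cos_plus, sin_plus. f_equal; ring.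
Qed.

Lemma cis_pow t n : (cis t ^ n)%C = cis (INR n * t).
Proof.
  induction n.
  - change (INR 0) with 0. rewrite Rmult_0_l, cis_0. auto.
  - rewrite Cpow_S, IHn, <- cis_plus, S_INR. f_equal. ring.
Qed.

(** Together with [1 ^ n = 1], this gives the two directions that detect a
    complex number by real parts. *)
Lemma root_of_i n : (1 <= n)%nat -> (cis (/ (4 * INR n)) ^ n)%C = Ci.
Proof.
  intros Hn. assert (P : 0 < INR n) by (apply lt_0_INR; lia). rewrite cis_pow.
  replace (INR n * / (4 * INR n)) with (/ 4) by (field; lra).
  unfold cis. replace (2 * PI * / 4) with (PI / 2) by field. rewrite cos_PI2, sin_PI2. reflexivity.
Qed.

Lemma CV_radius_pos (b : nat -> R) (x : R) : x <> 0 -> ex_series (fun n => b n * x ^ n) ->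
  Rbar_lt 0 (CV_radius b).
Proof.
  intros Hx H. apply Rbar_not_le_lt. intros N.
  assert (P := Rabs_pos_lt x Hx).
  apply (CV_disk_outside b x).
  - apply Rbar_le_lt_trans with (1 := N). exact P.
  - apply ex_series_lim_0 in H. exact H.
Qed.

(** Along each ray [w = 1 / (x e)] with [|e| = 1] the hypothesis is a real
    power series in [x] that vanishes near [0], so [Re (b n e^n) = 0]. The
    choices [e^n = 1] and [e^n = i] give the real and imaginary part of
    [b n]. *)
Lemma Laurent_real_unique (b : nat -> C) (R0 : R) : 0 < R0 ->
  (forall w, R0 < Cmod w -> is_series (fun n => fst (b (S n) * (/ w) ^ S n)%C) 0) ->
  forall n, (1 <= n)%nat -> b n = 0%C.
Proof.
  intros HR H.
  assert (Dir : forall e n, Cmod e = 1 -> (1 <= n)%nat -> fst (b n * e ^ n)%C = 0).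
  { intros e n He Hn. assert (Ne : e <> 0%C) by (apply Cmod_pos_neq; lra).
    set (s := fun k => if Nat.eq_dec k 0 then 0 else fst (b k * e ^ k)%C).
    (* Negative [x] are allowed too: they belong to the opposite ray. *)
    assert (S0 : forall x, x <> 0 -> Rabs x < / R0 -> is_series (fun k => s k * x ^ k) 0).
    { intros x Nx Hx. apply (is_series_decr_1 (V := R_NormedModule)).
      assert (NX : RtoC x <> 0%C) by (intros E1; apply RtoC_inj in E1; auto).
      assert (Px := Rabs_pos_lt x Nx).
      assert (Hw : R0 < Cmod (/ (RtoC x * e))%C).
      { rewrite Cmod_inv by (apply Cmult_neq_0; auto). rewrite Cmod_mult, He, Rmult_1_r, Cmod_R.
        rewrite <- (Rinv_inv R0). apply Rinv_lt_contravar; auto. apply Rmult_lt_0_compat; auto. apply Rinv_0_lt_compat; auto. }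
      assert (X := H _ Hw).
      match goal with |- is_series _ ?v => replace v with 0 end.
      - apply (is_series_ext (V := R_NormedModule)) with (2 := X). intros k.
        replace (/ / (RtoC x * e))%C with (RtoC x * e)%C by (field; auto).
        rewrite Cpow_mult_l, <- RtoC_pow. unfold s. destruct (Nat.eq_dec (S k) 0); [lia|].
        replace (b (S k) * (RtoC (x ^ S k) * e ^ S k))%C with (RtoC (x ^ S k) * (b (S k) * e ^ S k))%C by ring.
        unfold Cmult at 1, RtoC; cbn [fst snd]. rewrite Rmult_0_l, Rminus_0_r. apply Rmult_comm.
      - unfold s. simpl. unfold plus, opp; simpl. ring. }
    assert (I0 : 0 < / R0) by (apply Rinv_0_lt_compat; auto).
    assert (Q : s n = (fun _ => 0) n).
    { apply (PSeries_ext_recip s (fun _ => 0) n).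
      - apply (CV_radius_pos s (/ R0 / 2)); [lra|]. exists 0. apply S0; [lra|]. rewrite Rabs_pos_eq; lra.
      - rewrite CV_radius_const_0. exact I.
      - apply locally_R. exists (/ R0). split; auto. intros x Hx. rewrite Rminus_0_r in Hx.
        rewrite PSeries_const_0. destruct (Req_dec x 0) as [->|Nx].
        + rewrite PSeries_0. reflexivity.
        + apply is_series_unique. apply S0; auto. }
    unfold s in Q. destruct (Nat.eq_dec n 0); [lia|exact Q]. }
  intros n Hn. assert (A := Dir 1%C n Cmod_1 Hn). assert (B := Dir _ n (Cmod_cis (/ (4 * INR n))) Hn).
  rewrite Cpow_1_l in A. rewrite root_of_i in B by auto.
  unfold Cmult, Ci, RtoC in A, B; cbn [fst snd] in A, B.
  rewrite (surjective_pairing (b n)). unfold RtoC. f_equal; lra.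
Qed.

Section Identification.
Context (Omega0 : C -> Prop) (gamma : R) (Psi : C -> C) (a : nat -> C).
Context (Omega0_open : open (T := C_UniformSpace) Omega0) (Omega0_bounded : bounded Omega0).
Context (HPsi : exterior_conformal_map Omega0 gamma Psi a).
Context (F : nat -> C -> C) (HF : faber_polynomials Omega0 gamma Psi F).
Context (c : mat) (Hc : grunsky_matrix gamma Psi F c).
Context (L : nat) (r sigma : nat -> R) (layers : coating gamma L r sigma).
Context (F1 F2 : mat) (HF12 : faber_polarization_tensors Omega0 Psi F L r sigma F1 F2).
Context (D4inv Ainv : mat) (HD4 : is_inverse gamma (D4 r sigma L) D4inv).
Context (HA : is_inverse gamma
   (D4 r sigma L -- D2 r sigma L ** mat_conj c ** D4inv ** D2 r sigma L ** c)%C Ainv).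

Let X := fieldX L sigma c D4inv Ainv.
Let Y := fieldY L r sigma c D4inv Ainv.

Lemma background_harmonic m alpha z : harmonic_at (background F m alpha) z.
Proof.
  apply (Re_harmonic (fun _ => True) (fun z => RtoC 2 * (alpha * F m z))%C); auto.
  - intros y _. apply filter_forall. auto.
  - intros y _. destruct (faber_deriv _ _ _ F HF m y) as [l Hl]. eexists. do 2 apply cderiv_scal. exact Hl.
Qed.

(** The coefficients of a background consisting of a single Faber
    polynomial. *)
Definition single (m : nat) (alpha : C) (k : nat) : C := if Nat.eq_dec k m then alpha else RtoC 0.

Lemma single_eq m alpha : single m alpha m = alpha.
Proof. unfold single; destruct (Nat.eq_dec m m); tauto. Qed.

Lemma single_neq m alpha k : k <> m -> single m alpha k = 0%C.
Proof. intros Hk. unfold single; destruct (Nat.eq_dec k m); tauto. Qed.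

Lemma background_expansion m alpha : (1 <= m)%nat ->
  faber_expansion F 0 (single m alpha) (background F m alpha).
Proof.
  intros Hm z. destruct m as [|i]; [lia|]. set (al := single (S i) alpha).
  change (csum (fun k => al (S k) * F (S k) z + Cconj (al (S k)) * Cconj (F (S k) z))%C
    (RtoC (background F (S i) alpha z) - RtoC 0)%C).
  assert (Z := csum_single (fun k => al (S k) * F (S k) z + Cconj (al (S k)) * Cconj (F (S k) z))%C i).
  cbv beta in Z. rewrite (single_eq (S i) alpha : al (S i) = alpha) in Z.
  replace (RtoC (background F (S i) alpha z) - RtoC 0)%C
    with (alpha * F (S i) z + Cconj alpha * Cconj (F (S i) z))%C.
  - apply Z. intros k Hk. unfold al. rewrite single_neq by lia. rewrite Cconj_RtoC. ring.
  - rewrite <- Cmult_conj. unfold background. generalize (alpha * F (S i) z)%C. intros [x y].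
    apply injective_projections; simpl; ring.
Qed.

Definition exterior_coef (m : nat) (alpha : C) (n : nat) : C :=
  if Nat.eq_dec n 0 then RtoC 0 else (alpha * X m n + Cconj alpha * Y m n)%C.

Lemma exterior_coef_pos m alpha n : (1 <= n)%nat ->
  exterior_coef m alpha n = (alpha * X m n + Cconj alpha * Y m n)%C.
Proof. intros Hn. unfold exterior_coef. destruct (Nat.eq_dec n 0); [lia|auto]. Qed.

Section Decay.
Context (th : R) (th0 : 0 < th < gamma).
Context (c_bound : exists K, 0 <= K /\ forall m n, (1 <= m)%nat -> (1 <= n)%nat ->
  Cmod (c m n) <= K * th ^ m * th ^ n).
Context (m : nat) (Hm : (1 <= m)%nat) (alpha : C).

Let q := exterior_coef m alpha.

Lemma exterior_coef_bound : exists K, forall n, Cmod (q n) <= K * th ^ n.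
Proof.
  assert (g0 := gamma_pos _ _ _ _ HPsi).
  destruct (field_decay gamma th L r sigma c D4inv Ainv g0 th0 layers c_bound HD4 HA m Hm) as [K HKf].
  assert (A0 := Cmod_ge_0 alpha).
  assert (Kp : 0 <= K).
  { destruct (HKf 1%nat (le_n 1)) as [H _]. assert (P := Cmod_ge_0 (fieldX L sigma c D4inv Ainv m 1)).
    simpl in H. rewrite Rmult_1_r in H. nra. }
  exists (2 * Cmod alpha * K). intros n. assert (T0 : 0 <= th ^ n) by (apply pow_le; lra).
  unfold q, exterior_coef. destruct (Nat.eq_dec n 0).
  - rewrite Cmod_0. repeat apply Rmult_le_pos; lra.
  - destruct (HKf n) as [H1 H2]; [lia|]. fold X in H1. fold Y in H2.
    eapply Rle_trans; [apply Cmod_triangle|]. rewrite !Cmod_mult, Cmod_conj.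
    assert (U1 := Rmult_le_compat_l _ _ _ A0 H1). assert (U2 := Rmult_le_compat_l _ _ _ A0 H2). lra.
Qed.

(** The equation [p C = q] in the core, split into its [alpha] part,
    [field_X_identity], and its [conj alpha] part, [field_Y_identity]. *)
Lemma exterior_coef_core n : (1 <= n)%nat ->
  csum (fun k => pcoef L r sigma m alpha q 0 (S k) * c (S k) n)%C (qcoef L r sigma m alpha q 0 n).
Proof.
  intros Hn. assert (g0 := gamma_pos _ _ _ _ HPsi).
  assert (I1 := field_X_identity gamma th L r sigma c D4inv Ainv g0 th0 layers c_bound HD4 HA m n Hm Hn).
  assert (I2 := field_Y_identity gamma th L r sigma c D4inv Ainv g0 th0 layers c_bound HD4 HA m n Hm Hn).
  fold X Y in I1, I2. set (d := RtoC (d_entry r sigma L 0 0 m)) in *.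
  assert (I3 : csum (fun k => single m (d * alpha * c m n)%C (S k)) (d * alpha * c m n)%C).
  { assert (Z := csum_single (fun k => single m (d * alpha * c m n)%C (S k)) (pred m)). cbv beta in Z.
    replace (S (pred m)) with m in Z by lia. rewrite single_eq in Z.
    apply Z. intros k Hk. apply single_neq. lia. }
  assert (I := csum_plus _ _ _ _ I3 (csum_plus _ _ _ _ (csum_scal alpha _ _ I1) (csum_scal (Cconj alpha) _ _ I2))).
  match type of I with csum _ ?v => replace (qcoef L r sigma m alpha q 0 n) with v end.
  - apply csum_ext with (2 := I). intros k. unfold pcoef. rewrite layer_coef_core by exact Hm.
    unfold tapply, ext_coef; cbn [fst snd].
    change (entry (transfer_product r sigma (S k) L) 0 0) with (d_entry r sigma L 0 0 (S k)).
    change (entry (transfer_product r sigma (S k) L) 0 1) with (d_entry r sigma L 0 1 (S k)).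
    unfold q. rewrite exterior_coef_pos by lia. rewrite Cplus_conj, !Cmult_conj, Cconj_conj.
    unfold single, d. destruct (Nat.eq_dec (S k) m) as [<-|]; ring.
  - unfold qcoef. rewrite layer_coef_core by exact Hm. unfold tapply, ext_coef; cbn [fst snd].
    change (entry (transfer_product r sigma n L) 1 0) with (d_entry r sigma L 1 0 n).
    change (entry (transfer_product r sigma n L) 1 1) with (d_entry r sigma L 1 1 n).
    unfold q. rewrite exterior_coef_pos by auto.
    rewrite (Cplus_conj (_ * _)%C), !(Cmult_conj (RtoC _)), Cconj_conj, !Cconj_RtoC.
    unfold d, D3, diag. destruct (Nat.eqb_spec m n) as [EE|N]; destruct (Nat.eq_dec n m) as [E1|N']; try congruence.
    + rewrite <- EE. ring.
    + rewrite ?Cconj_RtoC. ring.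
Qed.

Lemma exterior_solution : transmission_solution Omega0 Psi L r sigma (background F m alpha)
  (solution Omega0 gamma Psi F L r sigma m alpha q).
Proof.
  apply (solution_transmission Omega0 gamma Psi a Omega0_open Omega0_bounded HPsi F HF c Hc L r sigma
    layers th th0 c_bound m Hm alpha q eq_refl exterior_coef_bound exterior_coef_core).
Qed.
End Decay.

(** The two summands of a term of the expansion are conjugate to each other. *)
Lemma fpt_term_single m alpha w n : (1 <= m)%nat -> (1 <= n)%nat ->
  fst (fpt_term F1 F2 (single m alpha) w m n) =
  2 * fst (/ RtoC (4 * PI * INR n) * (alpha * F1 m n + Cconj alpha * F2 m n) * (/ w) ^ n)%C.
Proof.
  intros Hm Hn. unfold fpt_term. rewrite single_eq. set (x := (/ RtoC (4 * PI * INR n))%C).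
  assert (xr : Cconj x = x).
  { unfold x. rewrite <- RtoC_inv; [apply Cconj_RtoC|]. assert (P := PI_RGT_0).
    assert (P' : 0 < INR n) by (apply lt_0_INR; lia). nra. }
  set (y := (alpha * F1 m n + Cconj alpha * F2 m n)%C).
  replace (Cconj alpha * Cconj (F1 m n) + alpha * Cconj (F2 m n))%C with (Cconj y)
    by (unfold y; rewrite Cplus_conj, !Cmult_conj, Cconj_conj; reflexivity).
  transitivity (fst (x * y * (/ w) ^ n + Cconj (x * y * (/ w) ^ n))%C).
  - f_equal. rewrite !Cmult_conj, xr. ring.
  - generalize (x * y * (/ w) ^ n)%C. intros [p1 p2]. unfold Cplus, Cconj; cbn [fst snd]. ring.
Qed.

(** The defining expansion is applied to the explicit solution; by [far_field]
    the same function has an expansion with known coefficients, and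
    [Laurent_real_unique] compares the two. *)
Lemma fpt_coefficients (m : nat) (alpha : C) : (1 <= m)%nat -> forall n, (1 <= n)%nat ->
  (alpha * F1 m n + Cconj alpha * F2 m n)%C =
  (RtoC (4 * PI * INR n) * (alpha * c m n - (alpha * X m n + Cconj alpha * Y m n)))%C.
Proof.
  intros Hm.
  destruct (grunsky_bound _ _ _ _ HPsi F HF c Hc)
    as [rho [th [Kc [R0 [R1 [R2 [K0 [_ [_ [_ [_ [HK _]]]]]]]]]]]].
  assert (th0 : 0 < th < gamma) by lra.
  assert (Hcb : exists K, 0 <= K /\ forall m n, (1 <= m)%nat -> (1 <= n)%nat ->
    Cmod (c m n) <= K * th ^ m * th ^ n) by (exists Kc; auto).
  set (q := exterior_coef m alpha). set (far := far_coef c m alpha q).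
  assert (far_eq : forall n, (1 <= n)%nat -> far n = (alpha * c m n - (alpha * X m n + Cconj alpha * Y m n))%C).
  { intros n Hn. unfold far, far_coef, c_full, q. rewrite exterior_coef_pos by auto.
    destruct (Nat.eq_dec n 0); [lia|auto]. }
  assert (far_0 : far 0%nat = 0%C) by (unfold far, far_coef, c_full, q, exterior_coef; simpl; ring).
  set (T := fun n => (/ RtoC (4 * PI * INR n) * (alpha * F1 m n + Cconj alpha * F2 m n))%C).
  assert (Z : forall n, (1 <= n)%nat -> (T n - far n)%C = 0%C).
  { assert (rL : 0 < r L) by (assert (RL := layers_r_pos gamma L r sigma layers L (le_n L)); lra).
    apply (Laurent_real_unique _ (r L) rL). intros w Hw.
    destruct (HF12 0 (single m alpha) _ _ (background_harmonic m alpha) (background_expansion m alpha Hm)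
      (exterior_solution th th0 Hcb m Hm alpha) w Hw) as [s [Hs1 Hs2]].
    destruct (far_field Omega0 gamma Psi a HPsi F c Hc L r sigma layers th th0 m Hm alpha q
      (exterior_coef_bound th th0 Hcb m Hm alpha) w Hw) as [G1 G2]. fold far in G1, G2.
    assert (Es : forall n, fst (s n) = 2 * fst (T (S n) * (/ w) ^ S n)%C).
    { intros n. rewrite <- (csum_unique _ _ _ (csum_single (fun k => fpt_term F1 F2 (single m alpha) w (S k) (S n)) (pred m)
        ltac:(intros k Hk; unfold fpt_term; rewrite single_neq by lia; rewrite Cconj_RtoC; ring)) (Hs1 n)).
      replace (S (pred m)) with m by lia. apply fpt_term_single; lia. }
    apply (proj1 (csum_shift _ _)) in G1. apply csum_fst in G1. cbv beta in G1. rewrite far_0 in G1.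
    apply csum_fst in Hs2. apply (is_series_scal_l (V := R_NormedModule) (/ 2)) in Hs2.
    assert (S2 := is_series_minus _ _ _ _ Hs2 G1).
    match type of S2 with is_series _ ?v => replace 0 with v end.
    - apply (is_series_ext (V := R_NormedModule)) with (2 := S2). intros n. rewrite Es.
      replace ((T (S n) - far (S n)) * (/ w) ^ S n)%C
        with (T (S n) * (/ w) ^ S n - far (S n) * (/ w) ^ S n)%C by ring.
      change (/ 2 * (2 * fst (T (S n) * (/ w) ^ S n)%C) - fst (far (S n) * (/ w) ^ S n)%C =
        fst (T (S n) * (/ w) ^ S n)%C - fst (far (S n) * (/ w) ^ S n)%C). field.
    - replace (pser far (/ w) - 0 * (/ w) ^ 0)%C with (pser far (/ w)) by ring.
      match type of G2 with ?h - ?u = _ => change (/ 2 * (h - u) - fst (pser far (/ w)%C) = 0) end.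
      rewrite G2. field. }
  intros n Hn. specialize (Z n Hn). rewrite far_eq in Z by auto. apply Ceq_minus in Z. rewrite <- Z. unfold T.
  assert (P := PI_RGT_0). assert (P' : 0 < INR n) by (apply lt_0_INR; lia).
  field. intros E1. apply RtoC_inj in E1. nra.
Qed.

(** The choices [alpha = 1] and [alpha = i] determine [F1 + F2] and
    [F1 - F2]. *)
Lemma fpt_formulas m n : (1 <= m)%nat -> (1 <= n)%nat ->
  F1 m n = (RtoC (4 * PI * INR n) * (c m n - X m n))%C /\
  F2 m n = (- (RtoC (4 * PI * INR n) * Y m n))%C.
Proof.
  intros Hm Hn. assert (A := fpt_coefficients m 1%C Hm n Hn). assert (B := fpt_coefficients m Ci Hm n Hn).
  assert (C1 : Cconj 1%C = 1%C) by apply Cconj_RtoC.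
  assert (C2 : Cconj Ci = (- Ci)%C) by (unfold Cconj, Ci, Copp; cbn [fst snd]; f_equal; ring).
  rewrite C1 in A. rewrite C2 in B. set (k := RtoC (4 * PI * INR n)) in *.
  assert (I2 : (Ci * Ci)%C = (- (1))%C) by (unfold Cmult, Ci, Copp, RtoC; cbn [fst snd]; f_equal; ring).
  assert (B' : (F1 m n - F2 m n)%C = (k * (c m n - (X m n - Y m n)))%C).
  { replace (F1 m n - F2 m n)%C with (- (Ci * Ci) * (F1 m n - F2 m n))%C by (rewrite I2; ring).
    replace (- (Ci * Ci) * (F1 m n - F2 m n))%C with (- Ci * (Ci * F1 m n + - Ci * F2 m n))%C by ring.
    rewrite B. transitivity (- (Ci * Ci) * (k * (c m n - (X m n - Y m n))))%C; [ring|]. rewrite I2. ring. }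
  assert (A' : (F1 m n + F2 m n)%C = (k * (c m n - (X m n + Y m n)))%C).
  { replace (F1 m n + F2 m n)%C with (1 * F1 m n + 1 * F2 m n)%C by ring. rewrite A. ring. }
  assert (N2 : RtoC 2 <> 0%C) by (intros E1; apply RtoC_inj in E1; lra).
  assert (T2 : RtoC 2 = (1 + 1)%C) by (rewrite <- RtoC_plus; f_equal; ring).
  split.
  - replace (F1 m n) with (/ RtoC 2 * ((F1 m n + F2 m n) + (F1 m n - F2 m n)))%C by (rewrite T2 in *; field; auto).
    rewrite A', B'. rewrite T2 in *. field; auto.
  - replace (F2 m n) with (/ RtoC 2 * ((F1 m n + F2 m n) - (F1 m n - F2 m n)))%C by (rewrite T2 in *; field; auto).
    rewrite A', B'. rewrite T2 in *. field; auto.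
Qed.
End Identification.

Open Scope C_scope.

Theorem theorem5p2
  (Omega0 : C -> Prop) (gamma : R) (Psi : C -> C) (a : nat -> C)
  (F : nat -> C -> C) (c : mat)
  (L : nat) (r sigma : nat -> R)
  (F1 F2 : mat) (D4inv Ainv : mat)
  (Omega0_domain : is_domain Omega0)
  (Omega0_bounded : bounded Omega0)
  (Omega0_simply_connected : simply_connected Omega0)
  (Psi_exterior_map : exterior_conformal_map Omega0 gamma Psi a)
  (F_faber : faber_polynomials Omega0 gamma Psi F)
  (c_grunsky : grunsky_matrix gamma Psi F c)
  (layers : coating gamma L r sigma)
  (F1_F2_fpt : faber_polarization_tensors Omega0 Psi F L r sigma F1 F2)
  (D4_invertible : is_inverse gamma (D4 r sigma L) D4inv)
  (A_invertible :
     is_inverse gamma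
       (D4 r sigma L
        -- D2 r sigma L ** mat_conj c ** D4inv ** D2 r sigma L ** c)
       Ainv) :
  forall m n : nat, (1 <= m)%nat -> (1 <= n)%nat ->
    F1 m n =
      RtoC (4 * PI * INR n) * c m n
      - RtoC (4 * PI * INR n) * / RtoC (sigma 0%nat) * RtoC (sigma (S L))
        * (D4inv ** c ** Ainv) m n
    /\
    F2 m n =
      RtoC (4 * PI * INR n)
      * ((D3 r sigma L
          -- D1 r sigma L ** mat_conj c ** D4inv ** D2 r sigma L ** c)
         ** Ainv) m n.
Proof.
  intros m n Hm Hn. destruct Omega0_domain as [Ho _].
  destruct (fpt_formulas Omega0 gamma Psi a Ho Omega0_bounded Psi_exterior_map F F_faber c c_grunsky L r sigma
    layers F1 F2 F1_F2_fpt D4inv Ainv D4_invertible A_invertible m n Hm Hn) as [E1 E2].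
  assert (s0 : (0 < sigma 0%nat)%R) by (apply (layers_sigma gamma L r sigma layers); lia).
  split.
  - rewrite E1. unfold fieldX. rewrite RtoC_div by lra. unfold Cdiv. ring.
  - rewrite E2. unfold fieldY. ring.
Qed.
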